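(* Let $0<\alpha,\beta<1$ and $0<\gamma\leq1$ be such that $\alpha+\beta+\gamma>2$, and let $\lambda(z)|dz|$ be an SK-metric on the thrice-punctured Riemann sphere $\widehat{\mathbb{C}}\setminus\{0,1,\infty\}$ with singularities of orders $\alpha,\beta,\gamma$ at $0,1,\infty$, respectively. Then the upper limit $$l:=\limsup_{z\to0}|z|^{\alpha}\lambda(z)$$ satisfies $$l\leq\frac{\delta}{1-\delta^2}(1-\alpha),$$ where $$\delta=\frac{\Gamma(c)}{\Gamma(2-c)}\left(\frac{\Gamma(1-a)\Gamma(1-b)\Gamma(a+1-c)\Gamma(b+1-c)}{\Gamma(a)\Gamma(b)\Gamma(c-a)\Gamma(c-b)}\right)^{1/2}$$ with $$a=\frac{\alpha+\beta-\gamma}{2},\qquad b=\frac{\alpha+\beta+\gamma-2}{2},\qquad c=\alpha.$$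
   Context: A conformal metric $\lambda(z)|dz|$ on a domain $G$ is given by a positive, upper semi-continuous density $\lambda:G\to(0,+\infty)$. Its (generalized) Gaussian curvature is $$\kappa_\lambda(z)=-\frac{1}{\lambda(z)^2}\liminf_{r\to0}\frac{4}{r^2}\left(\frac{1}{2\pi}\int_0^{2\pi}\log\lambda(z+re^{it})\,dt-\log\lambda(z)\right).$$ The metric is an SK-metric if $\kappa_\lambda(z)\leq-4$ at every point $z$ of $G$. A conformal metric on a punctured domain $\Omega\setminus\{p\}$, $\Omega\subseteq\widehat{\mathbb{C}}=\mathbb{C}\cup\{\infty\}$, has a singularity of order $\alpha\leq1$ at $p$ if, in a local coordinate $z$ with $z(p)=0$ in which the metric is written $\lambda(z)|dz|$, one has, as $z\to0$, $\log\lambda(z)=-\alpha\log|z|+O(1)$ if $\alpha<1$, and $\log\lambda(z)=-\log|z|-\log\log(1/|z|)+O(1)$ if $\alpha=1$. (At $p=\infty$ the local coordinate $\zeta=1/z$ is used, in which the density is $\lambda(1/\zeta)|\zeta|^{-2}$.) $\Gamma$ is Euler's Gamma function. *)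

(* Defs.v *)
(* MathComp / MathComp-Analysis *)
From HB Require Import structures.
From mathcomp Require Import all_boot all_order all_algebra.
From mathcomp Require Import complex.
From mathcomp Require Import all_classical all_reals all_analysis.

Set Implicit Arguments.
Unset Strict Implicit.
Unset Printing Implicit Defensive.

Import Order.TTheory GRing.Theory Num.Theory.
Import numFieldNormedType.Exports.

Local Open Scope classical_set_scope.
Local Open Scope ring_scope.

(* Densities are total functions [R[i] -> R]; only their values on the domain
   [G] are ever constrained.  [R[i]^o] is [R[i]] with its usual topology, and
   [Normc.normc] is the modulus with values in [R]. *)

Section ConformalMetrics.
Context {R : realType}.
Implicit Types (G : set R[i]) (lam : R[i] -> R).

Definition upper_semicontinuous_on G lam : Prop :=
  forall (z : R[i]) (y : R), G z -> lam z < y ->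
    \forall w \near within G (nbhs (z : R[i]^o)), lam w < y.

Definition conformal_metric G lam : Prop :=
  (forall z, G z -> 0 < lam z) /\ upper_semicontinuous_on G lam.

(* The integral is extended-real valued: on a small circle inside [G], [ln lam]
   is bounded above, but it need not be bounded below, so the mean may be -oo. *)
Definition circle_mean_ln lam (z : R[i]) (r : R) : \bar R :=
  (((2 * pi)^-1)%:E *
   \int[lebesgue_measure]_(t in `[0%R, (2 * pi)%R])
     (ln (lam (z + r%:C%C * (cos t +i* sin t)%C)))%:E)%E.

Definition gauss_curvature lam (z : R[i]) : \bar R :=
  (- (((lam z ^+ 2)^-1)%:E *
      limf_einf (fun r : R =>
        (4 / r ^+ 2)%:E * (circle_mean_ln lam z r - (ln (lam z))%:E))
        (0%R : R)^'+))%E.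

Definition SK_metric G lam : Prop :=
  conformal_metric G lam /\
  forall z, G z -> (gauss_curvature lam z <= (- 4)%:E)%E.

(* The density of [lam(z)|dz|] in the local coordinate [z - q] at a finite point
   [q], and in the local coordinate [1 / z] at infinity ([None]). *)
Definition local_density lam (p : one_point_compactification R[i]) :
    R[i] -> R :=
  match p with
  | Some q => fun z => lam (q + z)
  | None => fun z => lam z^-1 * Normc.normc z ^- 2
  end.

Definition has_singularity lam (p : one_point_compactification R[i])
    (alpha : R) : Prop :=
  let loglam := fun z : R[i]^o => ln (local_density lam p z) in
  let one := fun _ : R[i]^o => (1 : R) in
  [/\ alpha <= 1,
      alpha < 1 ->
        loglam = (fun z => - alpha * ln (Normc.normc z)) +O_ (0^') one
    & alpha = 1 ->
        loglam = (fun z => - ln (Normc.normc z)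
                           - ln (ln (1 / Normc.normc z))) +O_ (0^') one].

End ConformalMetrics.

(* Euler's integral, which represents the Gamma function for [x > 0] only. *)
Definition Gamma {R : realType} (x : R) : R :=
  \int[lebesgue_measure]_(t in `]0, +oo[) (t `^ (x - 1) * expR (- t)).

Definition delta {R : realType} (a b c : R) : R :=
  Gamma c / Gamma (2 - c) *
  Num.sqrt ((Gamma (1 - a) * Gamma (1 - b) *
             Gamma (a + 1 - c) * Gamma (b + 1 - c)) /
            (Gamma a * Gamma b * Gamma (c - a) * Gamma (c - b))).

(* Main.v *)
Require Import Defs.
From HB Require Import structures.
From mathcomp Require Import all_boot all_order all_algebra.
From mathcomp Require Import complex.
From mathcomp Require Import all_classical all_reals all_analysis.
From mathcomp Require Import measurable_realfun ring lra.

(** The bound comes from comparing [lam] with an explicit metric [1 / D] of curvature [-4]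
    having the same singularities.  With [a + b + 1 = alpha + beta], take
    [D z = |z| ^ alpha |1 - z| ^ beta N z], where [N] is a Hermitian form
    [A |f1| ^ 2 - B |f2| ^ 2] in two solutions of the hypergeometric equation.  If [A B]
    matches the Wronskian of [f1] and [f2], then [ln D] has Laplacian [- 4 / D ^ 2] where
    [D > 0].  The form is chosen diagonal in the local solutions at [0] and at [1]
    simultaneously, hence single-valued; the connection coefficients, given by Euler
    integrals at the endpoints, determine [A] and [B], and
    [N 0 = 1 / (delta (1 - alpha))].

    For the comparison itself, [lam] times the positive part of [D], multiplied by a small
    power of a barrier vanishing at the punctures, attains its maximum, and comparing the
    Laplacians of the logarithms there gives [lam D <= 1] in the limit. Near [0] this
    reads [|z| ^ alpha lam <= 1 / N 0 + o(1) = delta (1 - alpha) + o(1)], which is at most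
    the stated bound because [0 < delta < 1]. *)

Import Order.TTheory GRing.Theory Num.Theory.
Import numFieldNormedType.Exports.
Local Open Scope classical_set_scope.
Local Open Scope ring_scope.
Set Implicit Arguments.
Unset Strict Implicit.
Unset Printing Implicit Defensive.

(** Holomorphy enters only through [cdiff], a complex expansion to second order with cubic error,
    and Laplacians only through [expand], its real counterpart with a separate coefficient for
    [|h| ^ 2]. All other terms of degree one or two average to zero on circles, so these expansions
    are what the generalized curvature of an upper semi-continuous [lam] can be tested against.

    The Euler integrals live on a half-plane [0 < Re w], where principal powers are available. Hence
    [D] is given in two charts, centred at 0 and at 1, which agree on the strip [0 < Re z < 1] by
    the connection formula. The substitution of [1 - z] for [z], with [alpha] and [beta] exchanged,
    carries one chart into the other.

    At infinity the solutions are bounded by [|z| ^ (- b)] only up to an arbitrarily small loss in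
    the exponent. Since [2 b = alpha + beta + gamma - 2], this bounds [lam D] by a multiple of
    [|z| ^ e] there, for every small [e > 0]. The barrier, of order [|z| ^ (- 2)], absorbs this
    growth, while its own Laplacian costs a term proportional to its exponent. *)

Local Notation normc := Normc.normc.
Local Notation Re := complex.Re.
Local Notation Im := complex.Im.

(** * Lebesgue integrals over the open half-line *)

Section HalfLineIntegral.
Context {R : realType}.
Implicit Types (f g G : R -> R).

Definition hintegrable f :=
  (@lebesgue_measure R).-integrable `]0, +oo[ (EFin \o f).

Definition hint f : R := \int[@lebesgue_measure R]_(s in `]0%R, +oo[) f s.

(** The shift by two makes the interval nondegenerate already for [n = 0], where it is
    [[1 / 2, 2]]. *)
Definition exhaustion (n : nat) : set R := `[n.+2%:R^-1, n.+2%:R].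

Lemma hmeasurable f : (forall s : R, 0 < s -> {for s, continuous f}) ->
  measurable_fun (`]0, +oo[ : set R) f.
Proof.
move=> cf; apply: open_continuous_measurable_fun; first exact: interval_open.
by move=> x; rewrite inE /= in_itv /= andbT => /cf.
Qed.

Lemma hintegrable_le f g : measurable_fun (`]0, +oo[ : set R) f ->
  (forall s : R, 0 < s -> `|f s| <= g s) -> hintegrable g -> hintegrable f.
Proof.
move=> mf fg; apply: le_integrable => //; first exact/measurable_EFinP.
move=> s /=; rewrite in_itv /= andbT => /fg fgs.
by rewrite lee_fin (le_trans fgs)// ler_norm.
Qed.

Lemma eq_hint f g : (forall s : R, 0 < s -> f s = g s) -> hint f = hint g.
Proof.
move=> fg; apply: eq_Rintegral => s; rewrite inE /= in_itv /= andbT.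
exact: fg.
Qed.

Lemma eq_hintegrable f g : (forall s : R, 0 < s -> f s = g s) ->
  hintegrable f -> hintegrable g.
Proof.
move=> fg; apply: eq_integrable => // s; rewrite inE /= in_itv /= andbT => s0.
by rewrite fg.
Qed.

Lemma hintegrableD f g : hintegrable f -> hintegrable g ->
  hintegrable (fun s => f s + g s).
Proof.
move=> hf hg; have := integrableD _ hf hg => /(_ (measurable_itv _)).
by apply: eq_integrable => // s _ /=; rewrite EFinD.
Qed.

Lemma hintegrableZ k f : hintegrable f -> hintegrable (fun s => k * f s).
Proof.
move=> hf; have := integrableZl _ k hf => /(_ (measurable_itv _)).
by apply: eq_integrable => // s _ /=; rewrite EFinM.
Qed.

Lemma hintegrableB f g : hintegrable f -> hintegrable g ->
  hintegrable (fun s => f s - g s).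
Proof.
move=> hf hg; have := integrableB _ hf hg => /(_ (measurable_itv _)).
by apply: eq_integrable => // s _ /=; rewrite EFinB.
Qed.

Lemma hintD f g : hintegrable f -> hintegrable g ->
  hint (fun s => f s + g s) = hint f + hint g.
Proof. by move=> hf hg; rewrite /hint RintegralD. Qed.

Lemma hintB f g : hintegrable f -> hintegrable g ->
  hint (fun s => f s - g s) = hint f - hint g.
Proof. by move=> hf hg; rewrite /hint RintegralB. Qed.

Lemma hintZ k f : hintegrable f -> hint (fun s => k * f s) = k * hint f.
Proof. by move=> hf; rewrite /hint RintegralZl. Qed.

Lemma le_hint f g : hintegrable f -> hintegrable g ->
  (forall s : R, 0 < s -> f s <= g s) -> hint f <= hint g.
Proof.
move=> hf hg fg; apply: le_Rintegral => // s /=.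
by rewrite in_itv /= andbT; exact: fg.
Qed.

Lemma normr_hint_le f g : hintegrable f -> hintegrable g ->
  (forall s : R, 0 < s -> `|f s| <= g s) -> `|hint f| <= hint g.
Proof.
move=> hf hg fg; rewrite ler_norml -mulN1r -hintZ//; apply/andP; split.
  apply: le_hint => //; first exact: hintegrableZ.
  by move=> s /fg; rewrite ler_norml mulN1r => /andP[].
by apply: le_hint => // s /fg; rewrite ler_norml => /andP[].
Qed.

Lemma EFin_hint f : hintegrable f ->
  (hint f)%:E = (\int[@lebesgue_measure R]_(s in `]0%R, +oo[) (f s)%:E)%E.
Proof. by move=> hf; rewrite /hint /Rintegral fineK// integrable_fin_num. Qed.

Lemma hint_dominated_convergence (f_ : nat -> R -> R) f g :
  (forall n, measurable_fun (`]0, +oo[ : set R) (f_ n)) ->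
  measurable_fun (`]0, +oo[ : set R) f ->
  (forall s : R, 0 < s -> f_ n s @[n --> \oo] --> f s) ->
  (forall n (s : R), 0 < s -> `|f_ n s| <= g s) -> hintegrable g ->
  hint (f_ n) @[n --> \oo] --> hint f.
Proof.
move=> mf_ mf ff fg hg.
have pos (s : R) : (`]0, +oo[%classic : set R) s -> 0 < s.
  by rewrite /= in_itv /= andbT.
have hf_ n : hintegrable (f_ n) by apply: hintegrable_le (hg) => // s /fg.
have [||||||h1 _ h2] := @dominated_convergence _ _ _ (@lebesgue_measure R)
  `]0, +oo[ _ (fun n => EFin \o f_ n) (EFin \o f) (EFin \o g).
- by [].
- by move=> n; have /measurable_EFinP := mf_ n.
- by have /measurable_EFinP := mf.
- apply: (@aeW _ _ _ _ _) => s /pos s0 /=.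
  by apply/fine_cvgP; split; [exact: nearW|exact: ff].
- exact: hg.
- by apply: aeW => s n /pos s0 /=; rewrite lee_fin; exact: fg.
by apply: fine_cvg; rewrite EFin_hint.
Qed.

End HalfLineIntegral.

(** * Fundamental theorem of calculus on the open half-line *)

Section HalfLineFTC.
Context {R : realType}.
Implicit Types (f g G : R -> R).

Lemma cvg_at_right0 (u : nat -> R) : (forall n, 0 < u n) ->
  u n @[n --> \oo] --> 0 -> u n @[n --> \oo] --> 0^'+.
Proof.
move=> u0 uc A nA; have h : \oo (fun n => 0 < u n -> A (u n)) := uc _ nA.
by change (\oo (fun n => A (u n))); apply: filterS h => n; apply; exact: u0.
Qed.

Lemma cvg_inv_nat2 : n.+2%:R^-1 @[n --> \oo] --> (0 : R)^'+.
Proof.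
apply: cvg_at_right0; first by move=> n; rewrite invr_gt0 ltr0n.
by have := @cvg_harmonic R; rewrite -(cvg_shiftS (@harmonic R)).
Qed.

Lemma cvg_nat2 : (n.+2%:R : R) @[n --> \oo] --> +oo.
Proof.
have := @cvgr_idn R; rewrite -(cvg_shiftS (fun n => n%:R : R)).
by rewrite -(cvg_shiftS (fun n => n.+1%:R : R)).
Qed.

Lemma exhaustion_gt0 n (s : R) : exhaustion n s -> 0 < s.
Proof.
rewrite /exhaustion /= in_itv /= => /andP[h _]; apply: lt_le_trans h.
by rewrite invr_gt0 ltr0n.
Qed.

Lemma exhaustion_near (s : R) : 0 < s -> \forall n \near \oo, exhaustion n s.
Proof.
move=> s0; near=> n; rewrite /exhaustion /= in_itv /=; apply/andP; split.
  near: n; have := cvg_inv_nat2 => /(_ [set x | x <= s]); apply.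
  by near=> x; rewrite /= ltW//; near: x; exact: nbhs_right_lt.
near: n; have := cvg_nat2 => /(_ [set x | s <= x]); apply.
by apply: nbhs_pinfty_ge; rewrite num_real.
Unshelve. all: by end_near. Qed.

Lemma bigcup_exhaustion : \bigcup_n exhaustion n = (`]0, +oo[%classic : set R).
Proof.
apply/seteqP; split=> s; first by move=> [n _ /exhaustion_gt0]; rewrite /= in_itv /= andbT.
rewrite /= in_itv /= andbT => /exhaustion_near [N _ /(_ N)] h.
by exists N => //; apply: h => /=.
Qed.

Lemma exhaustion_nd : {homo @exhaustion R : n m / (n <= m)%N >-> (n <= m)%O}.
Proof.
move=> n m nm; apply/subsetPset => s; rewrite /exhaustion /= !in_itv /=.
move=> /andP[h1 h2]; apply/andP; split.
  by apply: le_trans h1; rewrite lef_pV2 ?posrE ?ltr0n// ler_nat.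
by apply: le_trans h2 _; rewrite ler_nat.
Qed.

Variables (g G : R -> R).
Hypothesis dG : forall s : R, 0 < s -> is_derive s 1 G (g s).
Hypothesis cg : forall s : R, 0 < s -> {for s, continuous g}.

Lemma integral_exhaustion n :
  (\int[@lebesgue_measure R]_(x in exhaustion n) (g x)%:E =
   (G n.+2%:R - G n.+2%:R^-1)%:E)%E.
Proof.
have n0 : (0 : R) < n.+2%:R^-1 by rewrite invr_gt0 ltr0n.
have nn : n.+2%:R^-1 < n.+2%:R :> R.
  rewrite (@lt_trans _ _ 1)//; last by rewrite ltr1n.
  by rewrite invf_lt1 ?ltr0n ?ltr1n.
have cG s : 0 < s -> {for s, continuous G}.
  move=> /dG h; apply: differentiable_continuous; apply/derivable1_diffP.
  by have := @ex_derive _ _ _ _ _ _ _ h.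
rewrite EFinB /exhaustion; apply: continuous_FTC2 => //.
- apply: continuous_in_subspaceT => x; rewrite inE /= in_itv /= => /andP[h _].
  by apply: cg; exact: lt_le_trans h.
- split.
  + move=> x; rewrite in_itv /= => /andP[h _]; have := dG (lt_trans n0 h).
    by move=> k; exact: (@ex_derive _ _ _ _ _ _ _ k).
  + by apply: cvg_at_right_filter; exact: cG.
  + by apply: cvg_at_left_filter; apply: cG; rewrite ltr0n.
- move=> x; rewrite in_itv /= => /andP[h _]; have k := dG (lt_trans n0 h).
  by rewrite derive1E; apply: (@derive_val _ _ _ _ _ _ _ k).
Qed.

(** Each integral over the exhaustion is an increment of [G], hence at most [2 M]; nonnegativity of
    [g] lets monotone convergence pass this bound to the whole half-line. *)
Lemma hintegrable_derive (M : R) : (forall s : R, 0 < s -> 0 <= g s) ->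
  (forall s : R, 0 < s -> `|G s| <= M) -> hintegrable g.
Proof.
move=> g0 GM; apply/integrableP; split.
  by apply/measurable_EFinP; exact: hmeasurable.
have -> : (\int[lebesgue_measure]_(x in `]0%R, +oo[) `|(EFin \o g) x| =
   \int[lebesgue_measure]_(x in `]0%R, +oo[) (g x)%:E)%E.
  apply: eq_integral => s; rewrite inE /= in_itv /= andbT => /g0 gs.
  by rewrite ger0_norm.
rewrite -bigcup_exhaustion.
have cv := @ge0_nondecreasing_set_cvg_integral _ (measurableTypeR R) R (@exhaustion R) (EFin \o g)
  (@lebesgue_measure R) exhaustion_nd.
have {}cv : (\int[lebesgue_measure]_(x in exhaustion i) (EFin \o g) x)%E @[i --> \oo]
  --> (\int[lebesgue_measure]_(x in \bigcup_i exhaustion i) (EFin \o g) x)%E.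
  apply: cv.
  - by move=> i; exact: measurable_itv.
  - move=> i; have /measurable_EFinP := hmeasurable cg.
    apply: measurable_funS => //.
    by move=> s /exhaustion_gt0 s0; rewrite /= in_itv /= andbT.
  - by move=> i x /exhaustion_gt0 /g0; rewrite lee_fin.
apply: (@le_lt_trans _ _ (M + M)%:E); last by rewrite ltry.
apply: (@cvge_to_le _ _ _ _ _ _ _ cv); apply: nearW => n /=.
rewrite integral_exhaustion lee_fin; apply: lerD.
  by rewrite (le_trans (ler_norm _))// GM// ltr0n.
by rewrite (le_trans (ler_norm _))// normrN GM// invr_gt0 ltr0n.
Qed.

(** Here [g] may change sign: the truncations of [g] to the exhaustion are dominated by [|g|], and
    their integrals are increments of [G] between points tending to both ends. *)
Lemma hint_derive (L0 L1 : R) : hintegrable g ->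
  G s @[s --> 0^'+] --> L0 -> G s @[s --> +oo] --> L1 ->
  hint g = L1 - L0.
Proof.
move=> hg G0 G1.
have cv : hint (g \_ (exhaustion n)) @[n --> \oo] --> hint g.
  apply: (hint_dominated_convergence (g := fun s => `|g s|)).
  - move=> n; apply/(measurable_restrict g (measurable_itv _) (measurable_itv _)).
    apply: measurable_funS (hmeasurable cg); first exact: measurable_itv.
    by move=> s [].
  - exact: hmeasurable.
  - move=> s s0; apply: cvg_near_cst.
    by apply: filterS (exhaustion_near s0) => n As; rewrite patchT ?inE.
  - by move=> n s _; rewrite /patch; case: ifP => // _; rewrite normr0.
  - by have := integrable_abse hg.
have {}cv : G n.+2%:R - G n.+2%:R^-1 @[n --> \oo] --> hint g.
  apply: cvg_trans cv; apply: near_eq_cvg; apply: nearW => n /=.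
  rewrite /hint -Rintegral_mkcondr setIidr.
    by rewrite /Rintegral integral_exhaustion.
  by move=> s /exhaustion_gt0 s0; rewrite /= in_itv /= andbT.
apply: (cvg_unique _ cv) => //; apply: cvgB.
  exact: (@cvg_comp _ _ _ (fun n => n.+2%:R) G _ _ _ cvg_nat2 G1).
exact: (@cvg_comp _ _ _ (fun n => n.+2%:R^-1) G _ _ _ cvg_inv_nat2 G0).
Qed.

End HalfLineFTC.

(** * Integrability of the kernels [s ^ (x - 1) (1 + s) ^ y] *)

Section RealPowers.
Context {R : realType}.
Implicit Types (x y s t : R) (f g : R -> R).

Lemma powRDp s x y : 0 < s -> s `^ (x + y) = s `^ x * s `^ y.
Proof. by move=> s0; rewrite powRD// (gt_eqF s0) implybT. Qed.

Lemma powRS s x : 0 < s -> s `^ (x + 1) = s `^ x * s.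
Proof. by move=> s0; rewrite powRDp// powRr1// ltW. Qed.

Lemma continuous_powR_pos x s : 0 < s -> {for s, continuous (@powR R ^~ x)}.
Proof.
move=> s0; apply: differentiable_continuous; apply/derivable1_diffP.
by apply: derivable_powR; rewrite in_itv /= s0.
Qed.

Lemma is_derive_ext (f g : R -> R) s a b : is_derive s 1 f a ->
  f = g -> a = b -> is_derive s 1 g b.
Proof. by move=> h <- <-. Qed.

Lemma is_derive_pow_kernel x y s : 0 < s ->
  is_derive s 1 (fun t => t `^ x * (1 + t) `^ y)
    (x * s `^ (x - 1) * (1 + s) `^ y + y * s `^ x * (1 + s) `^ (y - 1)).
Proof.
move=> s0; have s1 : 0 < 1 + s by rewrite addr_gt0.
have d1 := is_derive1_powR x s0.
have d2 : is_derive s 1 (fun t => (1 + t) `^ y) (y * (1 + s) `^ (y - 1)).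
  have d3 : is_derive s 1 (fun t : R => 1 + t) 1.
    have h : is_derive s 1 (cst 1 + id : R -> R) (0 + 1) by exact: is_deriveD.
    by apply: (is_derive_ext h) => //; rewrite add0r.
  have := @is_derive1_comp _ (@powR R ^~ y) (fun t : R => 1 + t) s _ _
    (is_derive1_powR y s1) d3.
  by rewrite mulr1.
apply: (is_derive_ext (is_deriveM d1 d2)) => //.
by rewrite /GRing.scale /=; ring.
Qed.

Lemma continuous_pow_kernel x y s : 0 < s ->
  {for s, continuous (fun t => t `^ x * (1 + t) `^ y)}.
Proof.
move=> s0; apply: differentiable_continuous; apply/derivable1_diffP.
by have [] := is_derive_pow_kernel x y s0.
Qed.

Lemma powR_cvgy x : x < 0 -> t `^ x @[t --> +oo] --> (0 : R).
Proof.
move=> x0; apply/cvgrPdist_lt => e e0; near=> t.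
have t0 : 0 < t by near: t; apply: nbhs_pinfty_gt; rewrite num_real.
rewrite sub0r normrN ger0_norm ?powR_ge0// /powR gt_eqF//.
rewrite -[ltRHS](@lnK _ e)// ltr_expR.
have : expR (ln e / x) < t.
  by near: t; apply: nbhs_pinfty_gt; rewrite num_real.
by rewrite -[X in _ < X]lnK// ltr_expR ltr_ndivrMr// mulrC.
Unshelve. all: by end_near. Qed.

(** The dominating function is a sum of two kernels with explicit bounded primitives:
    [(s / (1 + s)) ^ x] in [h1], for [s] near 0, and [(1 + s) ^ (x + y)] in [h2], for large [s],
    both up to a constant factor. *)
Lemma hintegrable_pow x y : 0 < x -> x + y < 0 ->
  hintegrable (fun s => s `^ (x - 1) * (1 + s) `^ y).
Proof.
move=> x0 xy.
have h1 : hintegrable (fun s => s `^ (x - 1) * (1 + s) `^ (- x - 1)).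
  apply: (@eq_hintegrable _ (fun s => x^-1 * (x * (s `^ (x - 1) * (1 + s) `^ (- x - 1))))).
    by move=> s s0; rewrite mulKf// gt_eqF.
  apply: hintegrableZ; apply: (@hintegrable_derive _ _ (fun t => t `^ x * (1 + t) `^ (- x)) _ _ 1).
  - move=> s s0; apply: (is_derive_ext (is_derive_pow_kernel x (- x) s0)) => //.
    have s1 : 0 < 1 + s by rewrite addr_gt0.
    have -> : s `^ x = s `^ (x - 1) * s by rewrite -powRS// subrK.
    have -> : (1 + s) `^ (- x) = (1 + s) `^ (- x - 1) * (1 + s) by rewrite -powRS// subrK.
    by ring.
  - move=> s s0; apply: cvgM; first exact: cvg_cst.
    exact: continuous_pow_kernel.
  - by move=> s s0; rewrite !mulr_ge0 ?powR_ge0// ltW.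
  - move=> s s0; have s1 : 0 < 1 + s by rewrite addr_gt0.
    rewrite ger0_norm ?mulr_ge0 ?powR_ge0// powRN ler_pdivrMr ?powR_gt0// mul1r.
    by apply: ge0_ler_powR; rewrite ?nnegrE; lra.
have h2 : hintegrable (fun s => (1 + s) `^ (x - 1 + y)).
  apply: (@eq_hintegrable _ (fun s => (- (x + y))^-1 * (- (x + y) * (s `^ 0 * (1 + s) `^ (x + y - 1))))).
    by move=> s s0; rewrite mulKf ?powRr0 ?mul1r ?oppr_eq0 ?lt_eqF//; congr (_ `^ _); ring.
  apply: hintegrableZ; apply: (@hintegrable_derive _ _ (fun t => - (t `^ 0 * (1 + t) `^ (x + y))) _ _ 1).
  - move=> s s0; apply: (is_derive_ext (is_deriveN (is_derive_pow_kernel 0 (x + y) s0))) => //.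
    by ring.
  - move=> s s0; apply: cvgM; first exact: cvg_cst.
    exact: continuous_pow_kernel.
  - by move=> s s0; rewrite !mulr_ge0 ?powR_ge0// oppr_ge0 ltW.
  - move=> s s0; have s1 : 0 < 1 + s by rewrite addr_gt0.
    rewrite normrN ger0_norm ?mulr_ge0 ?powR_ge0// powRr0 mul1r.
    rewrite -[leRHS](powRr0 (1 + s)); apply: ler_powR; last exact: ltW.
    by rewrite lerDl ltW.
have h3 := hintegrableZ 2 (hintegrableD h1 h2).
apply: hintegrable_le h3; first by apply: hmeasurable => s; exact: continuous_pow_kernel.
move=> s s0; have s1 : 0 < 1 + s by rewrite addr_gt0.
have s1' : 1 <= 1 + s by rewrite lerDl ltW.
rewrite ger0_norm ?mulr_ge0 ?powR_ge0//.
(* For [s <= 1] the quotient by the first kernel, [(1 + s) ^ (1 + x + y)], is at most 2. For [s > 1]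
   the numbers [s] and [1 + s] are comparable, and [s ^ (x - 1) <= 2 (1 + s) ^ (x - 1)] whatever the
   sign of [x - 1]. *)
have [sle|sge] := leP s 1.
  apply: (@le_trans _ _ (s `^ (x - 1) * (2 * (1 + s) `^ (- x - 1)))); last first.
    by rewrite mulrCA ler_pM2l// lerDl powR_ge0.
  rewrite ler_wpM2l ?powR_ge0//.
  have -> : y = (- x - 1) + (1 + (x + y)) by ring.
  rewrite powRDp// mulrC ler_wpM2r ?powR_ge0//.
  apply: (@le_trans _ _ (1 + s)); last by rewrite -[leRHS]/(1 + 1) lerD2l.
  by rewrite -[leRHS]powRr1 ?(ltW s1)//; apply: ler_powR => //; rewrite gerDl ltW.
apply: (@le_trans _ _ (2 * (1 + s) `^ (x - 1 + y))); last first.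
  by rewrite ler_pM2l// lerDr mulr_ge0// powR_ge0.
rewrite [(1 + s) `^ _ in leRHS]powRDp// mulrA ler_wpM2r ?powR_ge0//.
have [x1|x1] := leP 1 x.
  apply: (@le_trans _ _ ((1 + s) `^ (x - 1))); last by rewrite ler_peMl ?powR_ge0 ?ler1n.
  by apply: ge0_ler_powR; rewrite ?nnegrE; lra.
have -> : x - 1 = - (1 - x) by ring.
rewrite !powRN -ler_pdivrMr ?invr_gt0 ?powR_gt0// invrK mulrC.
rewrite ler_pdivrMr ?powR_gt0//.
apply: (@le_trans _ _ ((2 * s) `^ (1 - x))).
  by apply: ge0_ler_powR; rewrite ?nnegrE; lra.
rewrite powRM ?(ltW s0)// ler_wpM2r ?powR_ge0//.
by rewrite -[leRHS]powRr1//; apply: ler_powR; rewrite ?ler1n//; lra.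
Qed.

(** A zero integral would put all of []0, 1[], where [f] does not vanish, inside a null set. *)
Lemma hint_gt0 f : hintegrable f -> (forall s, 0 < s -> 0 < f s) -> 0 < hint f.
Proof.
move=> hf f0; rewrite lt_neqAle; apply/andP; split; last first.
  by apply: Rintegral_ge0 => s /=; rewrite in_itv /= andbT => /f0/ltW.
apply/eqP => h0; have := EFin_hint hf; rewrite -h0 => h1.
have mf := measurable_int _ hf.
have [h2 _] := @ae_eq_integral_abs _ _ R (@lebesgue_measure R) `]0, +oo[
  (measurable_itv _) (EFin \o f) mf.
have /h2 [N [mN N0 sub]] : (\int[lebesgue_measure]_(x in `]0%R, +oo[) `|(EFin \o f) x| = 0)%E.
  apply: etrans (esym h1); apply: eq_integral => s; rewrite inE /= in_itv /= andbT => s0.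
  by rewrite ger0_norm// ltW// f0.
have : (lebesgue_measure (`]0%R, 1%R[%classic : set R) <= lebesgue_measure N)%E.
  apply: le_measure; rewrite ?inE//.
  apply: subset_trans sub => s /=; rewrite !in_itv /= => /andP[s0 _] h.
  by have := h; rewrite s0 => /(_ isT) [] /eqP; rewrite gt_eqF// f0.
by rewrite lebesgue_measure_itv /= lte01 N0 sube0 leNgt lte01.
Qed.

End RealPowers.

(** * The Gamma integral, its functional equation and scaling *)

Section GammaBeta.
Context {R : realType}.
Implicit Types (x y s t c : R) (f g : R -> R).
Local Notation mu := (@lebesgue_measure R).

Lemma cvg_tail_integral c f : 0 < c -> (forall s, 0 < s -> 0 <= f s) ->
  (forall s, 0 < s -> {for s, continuous f}) ->
  (\int[mu]_(x in `[(c * n.+2%:R^-1)%R, +oo[) (f x)%:E)%E @[n --> \oo] -->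
  (\int[mu]_(x in `]0%R, +oo[) (f x)%:E)%E.
Proof.
move=> c0 f0 cf.
have pos n : 0 < c * n.+2%:R^-1 by rewrite mulr_gt0// invr_gt0 ltr0n.
have sub n s : (`[c * n.+2%:R^-1, +oo[%classic : set R) s -> 0 < s.
  by rewrite /= in_itv /= andbT; apply: lt_le_trans.
have <- : \bigcup_n (`[c * n.+2%:R^-1, +oo[%classic : set R) = `]0, +oo[%classic.
  apply/seteqP; split=> s; first by move=> [n _ /sub]; rewrite /= in_itv /= andbT.
  rewrite /= in_itv /= andbT => s0.
  have /exhaustion_near [N _ /(_ N)] : 0 < c^-1 * s by rewrite mulr_gt0// invr_gt0.
  move=> /(_ (leqnn _)); rewrite /exhaustion /= in_itv /= => /andP[h _].
  by exists N => //=; rewrite in_itv /= andbT -ler_pdivlMl.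
apply: (@ge0_nondecreasing_set_cvg_integral _ (measurableTypeR R) R
  (fun n => `[c * n.+2%:R^-1, +oo[%classic) (EFin \o f) mu).
- move=> n m nm; apply/subsetPset => s; rewrite /= !in_itv /= !andbT.
  by apply: le_trans; rewrite ler_pM2l// lef_pV2 ?posrE ?ltr0n// ler_nat.
- by move=> i; exact: measurable_itv.
- move=> i; have /measurable_EFinP := hmeasurable cf.
  by apply: measurable_funS => // s /sub; rewrite /= in_itv /= andbT.
- by move=> i s /sub /f0; rewrite lee_fin.
Qed.

(** The substitution is made on half-lines bounded away from 0, because [f] may be singular there.
    The cutoffs [c / (n + 2)] and [1 / (n + 2)] correspond to each other, so both sides are limits
    of equal sequences. *)
Lemma integral_scale c f : 0 < c -> (forall s, 0 < s -> 0 <= f s) ->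
  (forall s, 0 < s -> {for s, continuous f}) ->
  (\int[mu]_(x in `]0%R, +oo[) (f x)%:E =
   \int[mu]_(x in `]0%R, +oo[) (c * f (c * x))%R%:E)%E.
Proof.
move=> c0 f0 cf.
have dc s : is_derive s 1 (fun t : R => c * t) c.
  have h : is_derive s 1 (c \*: (id : R -> R)) (c *: 1) by exact: is_deriveZ.
  by apply: (is_derive_ext h); rewrite // /GRing.scale /= mulr1.
have dE : derive1 (fun t : R => c * t) = cst c.
  by apply/funext => s; rewrite derive1E (@derive_val _ _ _ _ _ _ _ (dc s)).
have cc s : {for s, continuous (fun t : R => c * t)}.
  by apply: differentiable_continuous; apply/derivable1_diffP; have [] := dc s.
have cvg1 := cvg_tail_integral c0 f0 cf.
have /cvg_tail_integral cvg2 : (0 : R) < 1 by [].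
have {}cvg2 := cvg2 (fun x => c * f (c * x)) _ _.
have p1 s : 0 < s -> 0 <= c * f (c * s) by move=> s0; rewrite mulr_ge0 ?f0 ?mulr_gt0 ?ltW.
have p2 s : 0 < s -> {for s, continuous (fun x => c * f (c * x))}.
  move=> s0; apply: cvgM; first exact: cvg_cst.
  by apply: (@continuous_comp _ _ _ (fun t : R => c * t) f); [exact: cc|apply: cf; rewrite mulr_gt0].
have {}cvg2 := cvg2 p1 p2.
apply: (cvg_unique _ cvg1) => //.
apply: cvg_trans cvg2; apply: near_eq_cvg; apply: nearW => n.
have n0 : (0 : R) < n.+2%:R^-1 by rewrite invr_gt0 ltr0n.
rewrite mul1r (@increasing_ge0_integration_by_substitutiony _ (fun t => c * t) f n.+2%:R^-1).
- by apply: eq_integral => s _; rewrite dE /= mulrC.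
- by move=> s t _ _ st; rewrite ltr_pM2l.
- by move=> s _; rewrite dE; exact: cst_continuous.
- by rewrite dE; apply: is_cvg_cst.
- by rewrite dE; apply: is_cvg_cst.
- split; first by move=> s _; have [] := dc s.
  by apply: cvg_at_right_filter; exact: cc.
- by apply: gt0_cvgMry => //.
- apply: continuous_in_subspaceT => s; rewrite inE /= in_itv /= andbT => h.
  by apply: cf; apply: lt_le_trans h; rewrite mulr_gt0.
- by move=> s; rewrite in_itv /= andbT => h; apply: f0; apply: lt_trans h; rewrite mulr_gt0.
Qed.

(** Euler's Beta function [B(x, y)], in the form obtained from the integral over [[0, 1]] by
    [t = s / (1 + s)]. *)
Definition Betaf x y := hint (fun s => s `^ (x - 1) * (1 + s) `^ (- (x + y))).

Lemma GammaE x : Gamma x = hint (fun t => t `^ (x - 1) * expR (- t)).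
Proof. by []. Qed.

Lemma hintegrable_Betaf x y : 0 < x -> 0 < y ->
  hintegrable (fun s => s `^ (x - 1) * (1 + s) `^ (- (x + y))).
Proof. by move=> x0 y0; apply: hintegrable_pow => //; lra. Qed.

Lemma Betaf_gt0 x y : 0 < x -> 0 < y -> 0 < Betaf x y.
Proof.
move=> x0 y0; apply: hint_gt0; first exact: hintegrable_Betaf.
by move=> s s0; rewrite mulr_gt0 ?powR_gt0 ?addr_gt0.
Qed.

(** From [1 + t <= p (1 + t / p) <= p exp (t / p)], raised to the power [p]. It dominates the Gamma
    kernel by a Beta kernel. *)
Lemma expRN_le_powR p t : 1 <= p -> 0 <= t ->
  expR (- t) <= p `^ p * (1 + t) `^ (- p).
Proof.
move=> p1 t0; have p0 : 0 < p by lra.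
have t1 : 0 < 1 + t by lra.
rewrite expRN powRN -ler_pdivrMr ?powR_gt0 ?invr_gt0// ?powR_gt0//.
rewrite invrK mulrC ler_pdivrMr ?expR_gt0//.
have -> : expR t = expR (t / p) `^ p by rewrite -expRM divfK// gt_eqF.
rewrite -powRM ?expR_ge0 ?(ltW p0)//.
apply: ge0_ler_powR; rewrite ?nnegrE ?mulr_ge0 ?expR_ge0 ?(ltW p0) ?(ltW t1)//.
apply: (@le_trans _ _ (p * (1 + t / p))); last by rewrite ler_pM2l// expR_ge1Dx.
by rewrite mulrDr mulr1 mulrCA divff ?mulr1 ?gt_eqF// lerD2r.
Qed.

Lemma continuous_gamma_kernel x t : 0 < t ->
  {for t, continuous (fun s => s `^ x * expR (- s))}.
Proof.
move=> t0; apply: cvgM; first exact: continuous_powR_pos.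
apply: (@continuous_comp _ _ _ (fun s : R => - s) expR).
  exact: opp_continuous.
exact: continuous_expR.
Qed.

Lemma hintegrable_Gamma x : 0 < x ->
  hintegrable (fun t => t `^ (x - 1) * expR (- t)).
Proof.
move=> x0.
have h : hintegrable (fun t => (x + 1) `^ (x + 1) * (t `^ (x - 1) * (1 + t) `^ (- (x + 1)))).
  by apply: hintegrableZ; apply: hintegrable_Betaf.
apply: hintegrable_le h; first by apply: hmeasurable => s; exact: continuous_gamma_kernel.
move=> s s0; rewrite ger0_norm ?mulr_ge0 ?powR_ge0 ?expR_ge0// mulrCA.
by rewrite ler_wpM2l ?powR_ge0// expRN_le_powR//; lra.
Qed.

Lemma Gamma_gt0 x : 0 < x -> 0 < Gamma x.
Proof.
move=> x0; rewrite GammaE; apply: hint_gt0; first exact: hintegrable_Gamma.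
by move=> s s0; rewrite mulr_gt0 ?powR_gt0 ?expR_gt0.
Qed.

Lemma GammaS x : 0 < x -> Gamma (x + 1) = x * Gamma x.
Proof.
move=> x0.
have h1 := hintegrable_Gamma x0.
have x1 : 0 < x + 1 by lra.
have h2 := hintegrable_Gamma x1.
rewrite !GammaE -hintZ//; apply/eqP; rewrite eq_sym -subr_eq0; apply/eqP.
rewrite -hintB//; last exact: hintegrableZ.
rewrite (@hint_derive _ _ (fun t => t `^ x * expR (- t)) _ _ 0 0) ?subrr//.
- move=> s s0.
  have d1 := is_derive1_powR x s0.
  have d2 : is_derive s 1 (fun t : R => expR (- t)) (- expR (- s)).
    have k : is_derive s 1 (- (id : R -> R)) (- 1) by exact: is_deriveN.
    have := @is_derive1_comp _ expR (- (id : R -> R)) s _ _ (is_derive_expR (- s)) k.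
    by rewrite mulrN1.
  apply: (is_derive_ext (is_deriveM d1 d2)) => //.
  by rewrite /GRing.scale /= addrK; ring.
- move=> s s0; apply: cvgB.
    by apply: cvgM; [exact: cvg_cst|exact: continuous_gamma_kernel].
  exact: continuous_gamma_kernel.
- by apply: hintegrableB => //; exact: hintegrableZ.
- have : s `^ x * 1 @[s --> 0^'+] --> 0 * (1 : R) by apply: cvgM; [exact: powR_cvg0|exact: cvg_cst].
  rewrite mul0r => h; apply: (squeeze_cvgr _ (cvg_cst 0) h).
  near=> s; rewrite mulr_ge0 ?powR_ge0 ?expR_ge0//= ler_wpM2l ?powR_ge0//.
  by rewrite expR_le1 oppr_le0.
(* The bound for the exponential with [p = x + 1] gives [s ^ x exp (- s) <= C s ^ x (1 + s) ^ (- x -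
   1) <= C / s]. *)
- have : (x + 1) `^ (x + 1) * s `^ (-1) @[s --> +oo] --> (x + 1) `^ (x + 1) * (0 : R).
    by apply: cvgM; [exact: cvg_cst|apply: powR_cvgy; lra].
  rewrite mulr0 => h; apply: (squeeze_cvgr _ (cvg_cst 0) h).
  near=> s; have s0 : 0 < s by near: s; apply: nbhs_pinfty_gt; rewrite num_real.
  rewrite mulr_ge0 ?powR_ge0 ?expR_ge0//=.
  have -> : -1 = x + - (x + 1) by ring.
  rewrite [s `^ (x + _)]powRDp// mulrCA ler_wpM2l ?powR_ge0//.
  have p1 : 1 <= x + 1 by lra.
  apply: le_trans (expRN_le_powR p1 (ltW s0)) _.
  rewrite ler_wpM2l ?powR_ge0// !powRN lef_pV2 ?posrE ?powR_gt0//; last lra.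
  by apply: ge0_ler_powR; rewrite ?nnegrE; lra.
Unshelve. all: by end_near. Qed.

Lemma Gamma_scale x c : 0 < x -> 0 < c ->
  (\int[mu]_(s in `]0%R, +oo[) (s `^ (x - 1) * expR (- (c * s)))%R%:E =
   (c `^ (- x) * Gamma x)%R%:E)%E.
Proof.
move=> x0 c0; rewrite EFinM GammaE EFin_hint; last exact: hintegrable_Gamma.
rewrite [in RHS](@integral_scale c) //; last 2 first.
- by move=> s s0; rewrite mulr_ge0 ?powR_ge0 ?expR_ge0.
- by move=> s; exact: continuous_gamma_kernel.
rewrite -ge0_integralZl//=.
- apply: eq_integral => s; rewrite inE /= in_itv /= andbT => s0.
  rewrite -EFinM; congr EFin; rewrite powRM ?ltW// !mulrA.
  rewrite -[_ * c * _]mulrA mulr_powRB1 ?(ltW c0)// powRN mulVf ?mul1r//.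
  by rewrite gt_eqF ?powR_gt0.
- apply/measurable_EFinP; apply: hmeasurable => s s0.
  apply: cvgM; first exact: cvg_cst.
  apply: (@continuous_comp _ _ _ (fun t : R => c * t) (fun s => s `^ (x - 1) * expR (- s))).
    by apply: cvgM; [exact: cvg_cst|exact: cvg_id].
  by apply: continuous_gamma_kernel; rewrite mulr_gt0.
- move=> s; rewrite in_itv /= andbT => s0; rewrite lee_fin mulr_ge0 ?mulr_ge0 ?powR_ge0 ?expR_ge0//.
  exact: ltW.
- by rewrite lee_fin powR_ge0.
Qed.

End GammaBeta.

(** * The Beta function as a quotient of Gamma values *)

Section GammaProduct.
Context {R : realType}.
Implicit Types (x y s t c : R).
Local Notation mu := (@lebesgue_measure R).
Local Notation D := (`]0%R, +oo[%classic : set R).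

(** Tonelli's theorem is applied on the whole plane, so the indicator of the quadrant is made part
    of the integrand. *)
Lemma tonelli_quadrant (H : R -> R -> R) :
  measurable_fun [set: measurableTypeR R * measurableTypeR R] (fun p => H p.1 p.2) ->
  (forall s u, 0 <= H s u) ->
  (\int[mu]_(s in D) \int[mu]_(u in D) (H s u)%:E =
   \int[mu]_(u in D) \int[mu]_(s in D) (H s u)%:E)%E.
Proof.
move=> mH H0.
pose f := fun p : measurableTypeR R * measurableTypeR R =>
  (\1_D p.1 * (\1_D p.2 * H p.1 p.2))%:E.
have mD : measurable (D : set (measurableTypeR R)) by exact: measurable_itv.
have mI : measurable_fun [set: measurableTypeR R] (\1_D : R -> R).
  exact: measurable_indic.
have mf : measurable_fun setT f.
  apply/measurable_EFinP; apply: measurable_funM.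
    by apply: (measurableT_comp mI); exact: measurable_fst.
  by apply: measurable_funM => //; apply: (measurableT_comp mI); exact: measurable_snd.
have f0 p : (0 <= f p)%E by rewrite lee_fin !mulr_ge0// /indic; case: (_ \in _).
have := @fubini_tonelli _ _ (measurableTypeR R) (measurableTypeR R) R mu mu f mf f0.
have e1 : (\int[mu]_s \int[mu]_u f (s, u) = \int[mu]_(s in D) \int[mu]_(u in D) (H s u)%:E)%E.
  rewrite [RHS]integral_mkcond; apply: eq_integral => s _; rewrite /patch.
  case: ifPn => sD; last first.
    by apply: integral0_eq => u _; rewrite /f /= /indic (negbTE sD) mul0r.
  rewrite [RHS]integral_mkcond; apply: eq_integral => u _; rewrite /patch /f /= /indic sD mul1r.
  by case: ifPn => uD; rewrite ?mul1r ?mul0r.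
have e2 : (\int[mu]_u \int[mu]_s f (s, u) = \int[mu]_(u in D) \int[mu]_(s in D) (H s u)%:E)%E.
  rewrite [RHS]integral_mkcond; apply: eq_integral => u _; rewrite /patch.
  case: ifPn => uD; last first.
    by apply: integral0_eq => s _; rewrite /f /= /indic (negbTE uD) mul0r mulr0.
  rewrite [RHS]integral_mkcond; apply: eq_integral => s _; rewrite /patch /f /= /indic uD mul1r.
  by case: ifPn => sD; rewrite ?mul1r ?mul0r.
by rewrite e1 e2.
Qed.

(** The kernel [s ^ (x - 1) u ^ (x + y - 1) exp (- (1 + s) u)] is integrated in both orders.
    Integrating over [u] leaves [Gamma (x + y)] times the Beta kernel; integrating over [s] leaves
    [Gamma x] times the Gamma kernel of [y]. *)
Lemma GammaM x y : 0 < x -> 0 < y ->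
  Gamma x * Gamma y = Gamma (x + y) * Betaf x y.
Proof.
move=> x0 y0; apply: EFin_inj; have xy0 : 0 < x + y by lra.
pose H s u : R := s `^ (x - 1) * (u `^ (x + y - 1) * expR (- ((1 + s) * u))).
have m1 := @measurable_fst _ _ (measurableTypeR R) (measurableTypeR R).
have m2 := @measurable_snd _ _ (measurableTypeR R) (measurableTypeR R).
have mH : measurable_fun [set: measurableTypeR R * measurableTypeR R] (fun p => H p.1 p.2).
  apply: measurable_funM; first exact: (measurableT_comp (measurable_powR _) m1).
  apply: measurable_funM; first exact: (measurableT_comp (measurable_powR _) m2).
  apply: (measurableT_comp (@measurable_expR R)).
  apply: measurableT_comp => //; apply: measurable_funM => //.
  by apply: measurable_funD.
have H0 s u : 0 <= H s u by rewrite !mulr_ge0 ?powR_ge0 ?expR_ge0.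
have := tonelli_quadrant mH H0.
have -> : (\int[mu]_(s in D) \int[mu]_(u in D) (H s u)%:E = (Gamma (x + y) * Betaf x y)%:E)%E.
  rewrite EFinM [X in _ = (_ * X)%E]EFin_hint; last exact: hintegrable_Betaf.
  rewrite -ge0_integralZl//=.
  - apply: eq_integral => s; rewrite inE /= in_itv /= andbT => s0.
    under eq_integral do rewrite EFinM.
    rewrite ge0_integralZl//=; last 3 first.
    + apply/measurable_EFinP; apply: hmeasurable => u u0.
      apply: cvgM; first exact: continuous_powR_pos.
      apply: (@continuous_comp _ _ _ (fun u : R => - ((1 + s) * u)) expR); last exact: continuous_expR.
      by apply: cvgN; apply: cvgM; [exact: cvg_cst|exact: cvg_id].
    + by move=> u _; rewrite lee_fin mulr_ge0 ?powR_ge0 ?expR_ge0.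
    + by rewrite lee_fin powR_ge0.
    rewrite Gamma_scale//; last lra.
    by rewrite -!EFinM; congr EFin; ring.
  - apply/measurable_EFinP; apply: hmeasurable => s s0.
    exact: continuous_pow_kernel.
  - by move=> s _; rewrite lee_fin mulr_ge0 ?powR_ge0.
  - by rewrite lee_fin ltW// Gamma_gt0.
have -> : (\int[mu]_(u in D) \int[mu]_(s in D) (H s u)%:E = (Gamma x * Gamma y)%:E)%E.
  rewrite EFinM [X in _ = (_ * X)%E]EFin_hint; last exact: hintegrable_Gamma.
  rewrite -ge0_integralZl//=.
  - apply: eq_integral => u; rewrite inE /= in_itv /= andbT => u0.
    have -> : (\int[mu]_(s in D) (H s u)%:E = \int[mu]_(s in D)
        ((u `^ (x + y - 1) * expR (- u))%R%:E * (s `^ (x - 1) * expR (- (u * s)))%R%:E))%E.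
      apply: eq_integral => s _; rewrite -EFinM; congr EFin; rewrite /H mulrDl mul1r opprD expRD.
      by rewrite [s * u]mulrC; ring.
    rewrite ge0_integralZl//=; last 3 first.
    + apply/measurable_EFinP; apply: hmeasurable => s s0.
      apply: cvgM; first exact: continuous_powR_pos.
      apply: (@continuous_comp _ _ _ (fun s : R => - (u * s)) expR); last exact: continuous_expR.
      by apply: cvgN; apply: cvgM; [exact: cvg_cst|exact: cvg_id].
    + by move=> s _; rewrite lee_fin mulr_ge0 ?powR_ge0 ?expR_ge0.
    + by rewrite lee_fin mulr_ge0 ?powR_ge0 ?expR_ge0.
    rewrite Gamma_scale// -!EFinM; congr EFin.
    have -> : u `^ (y - 1) = u `^ (x + y - 1) * u `^ (- x) by rewrite -powRDp//; congr (_ `^ _); ring.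
    move: (Gamma x) => G; by ring.
  - apply/measurable_EFinP; apply: hmeasurable => s s0.
    exact: continuous_gamma_kernel.
  - by move=> s _; rewrite lee_fin mulr_ge0 ?powR_ge0 ?expR_ge0.
  - by rewrite lee_fin ltW// Gamma_gt0.
by move=> ->.
Qed.

Lemma BetafE x y : 0 < x -> 0 < y ->
  Betaf x y = Gamma x * Gamma y / Gamma (x + y).
Proof.
move=> x0 y0; rewrite GammaM// mulrC mulKf// gt_eqF// Gamma_gt0//; lra.
Qed.

(* [4 t <= (1 + t) ^ 2] turns the shift of both arguments by [s] into a factor
   [(t / (1 + t) ^ 2) `^ s <= 4 `^ (- s)]. *)
Lemma Betaf_shift_lt x y s : 0 < x -> 0 < y -> 0 < s ->
  Betaf (x + s) (y + s) < Betaf x y.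
Proof.
move=> x0 y0 s0.
have xs : 0 < x + s by lra.
have ys : 0 < y + s by lra.
apply: (@le_lt_trans _ _ (4 `^ (- s) * Betaf x y)).
  rewrite /Betaf -hintZ; last exact: hintegrable_Betaf.
  apply: le_hint; [exact: hintegrable_Betaf|by apply: hintegrableZ; exact: hintegrable_Betaf|].
  move=> t t0; have t1 : 0 < 1 + t by lra.
  have -> : x + s - 1 = (x - 1) + s by ring.
  have -> : - (x + s + (y + s)) = - (x + y) + (- s + - s) by ring.
  rewrite [t `^ (x - 1 + s)]powRDp// [(1 + t) `^ (_ + (- s + - s))]powRDp// [(1 + t) `^ (- s + - s)]powRDp// [leLHS](_ : _ = (t `^ s * ((1 + t) `^ (- s) * (1 + t) `^ (- s))) *
    (t `^ (x - 1) * (1 + t) `^ (- (x + y)))); last by ring.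
  rewrite ler_wpM2r ?mulr_ge0 ?powR_ge0// -powRM ?(ltW t1)//.
  rewrite !powRN -ler_pdivlMr ?invr_gt0 ?powR_gt0 ?mulr_gt0// invrK mulrC.
  rewrite ler_pdivlMr ?powR_gt0// -powRM ?(ltW t0)//.
  apply: ge0_ler_powR; rewrite ?nnegrE ?mulr_ge0 ?(ltW s0) ?(ltW t0) ?(ltW t1)//.
  by rewrite -subr_ge0 (_ : _ - _ = (1 - t) ^+ 2) ?sqr_ge0//; ring.
rewrite gtr_pMl; last exact: Betaf_gt0.
rewrite powRN invf_lt1 ?powR_gt0// -[ltLHS](powRr0 4) /powR (_ : 4 == 0 = false) ?ltr_expR ?ltr_pM2r//.
- by rewrite ln_gt0//; lra.
- by apply/negbTE; rewrite gt_eqF.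
Qed.

End GammaProduct.

(** * The constant [delta]: bounds and expression by Beta values *)

Lemma ratioM_lt1 {R : realFieldType} (p q r s : R) : 0 < p -> 0 < q ->
  0 < r -> 0 < s -> p < r -> q < s -> p / r * (q / s) < 1.
Proof.
move=> p0 q0 r0 s0 pr qs; rewrite -[ltRHS]mulr1; apply: ltr_pM.
- by rewrite divr_ge0// ltW.
- by rewrite divr_ge0// ltW.
- by rewrite ltr_pdivrMr// mul1r.
- by rewrite ltr_pdivrMr// mul1r.
Qed.

Section Delta.
Context {R : realType}.
Variables (a b c : R).
Hypotheses (a0 : 0 < a) (a1 : a < 1) (b0 : 0 < b) (b1 : b < 1) (c0 : 0 < c)
  (c1 : c < 1) (ac : a < c) (bc : b < c).

Lemma sqr_delta : delta a b c ^+ 2 = (Gamma c / Gamma (2 - c)) ^+ 2 *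
  ((Gamma (1 - a) * Gamma (1 - b) * Gamma (a + 1 - c) * Gamma (b + 1 - c)) /
   (Gamma a * Gamma b * Gamma (c - a) * Gamma (c - b))).
Proof.
by rewrite exprMn sqr_sqrtr// divr_ge0// !mulr_ge0// ltW// Gamma_gt0//
  ?subr_gt0//; move: a0 a1 b0 b1 c0 c1 ac bc; lra.
Qed.

Lemma delta_gt0 : 0 < delta a b c.
Proof.
by rewrite mulr_gt0 ?divr_gt0 ?sqrtr_gt0 ?divr_gt0 ?mulr_gt0// Gamma_gt0//
  ?subr_gt0//; move: a0 a1 b0 b1 c0 c1 ac bc; lra.
Qed.

(** By the Gamma quotients, [delta ^ 2 = B(a + 1 - c, 1 - a) / B(a, c - a) * B(b + 1 - c, 1 - b) /
    B(b, c - b)]. In each ratio the numerator is the denominator with both arguments raised by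
    [1 - c > 0]. *)
Lemma delta_lt1 : delta a b c < 1.
Proof.
have h2 : 0 < 2 - c by move: c1; lra.
have d0 := delta_gt0.
rewrite -(@ltr_pXn2r _ 2) ?nnegrE ?ler01 ?(ltW d0)// expr1n sqr_delta.
have s0 : 0 < 1 - c by rewrite subr_gt0.
have pa : 0 < c - a by rewrite subr_gt0.
have pb : 0 < c - b by rewrite subr_gt0.
have ha := Betaf_shift_lt a0 pa s0.
have hb := Betaf_shift_lt b0 pb s0.
have p1 : 0 < a + (1 - c) by rewrite addr_gt0.
have p2 : 0 < c - a + (1 - c) by rewrite addr_gt0.
have p3 : 0 < b + (1 - c) by rewrite addr_gt0.
have p4 : 0 < c - b + (1 - c) by rewrite addr_gt0.
have q1 := Betaf_gt0 a0 pa; have q2 := Betaf_gt0 b0 pb.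
have q3 := Betaf_gt0 p1 p2; have q4 := Betaf_gt0 p3 p4.
apply: (@le_lt_trans _ _ ((Betaf (a + (1 - c)) (c - a + (1 - c)) / Betaf a (c - a)) *
  (Betaf (b + (1 - c)) (c - b + (1 - c)) / Betaf b (c - b)))); last first.
  exact: (ratioM_lt1 q3 q4 q1 q2 ha hb).
rewrite !BetafE//.
have -> : a + (1 - c) = a + 1 - c by ring.
have -> : b + (1 - c) = b + 1 - c by ring.
have -> : c - a + (1 - c) = 1 - a by ring.
have -> : c - b + (1 - c) = 1 - b by ring.
have -> : a + 1 - c + (1 - a) = 2 - c by ring.
have -> : b + 1 - c + (1 - b) = 2 - c by ring.
have -> : a + (c - a) = c by ring.
have -> : b + (c - b) = c by ring.
have g1 := Gamma_gt0 a0; have g2 := Gamma_gt0 b0; have g3 := Gamma_gt0 pa.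
have g4 := Gamma_gt0 pb; have g5 := Gamma_gt0 c0.
have g6 := Gamma_gt0 h2.
move: g1 g2 g3 g4 g5 g6.
move: (Gamma a) (Gamma b) (Gamma (c - a)) (Gamma (c - b)) (Gamma c) (Gamma (2 - c))
  (Gamma (1 - a)) (Gamma (1 - b)) (Gamma (a + 1 - c)) (Gamma (b + 1 - c)).
move=> Ga Gb Gca Gcb Gc G2 G3 G4 G5 G6 k1 k2 k3 k4 k5 k6.
rewrite le_eqVlt; apply/orP; left; apply/eqP; field.
by rewrite !gt_eqF.
Qed.

(** The form in which [delta] meets the connection problem. For [c = alpha] and
    [a + b + 1 = alpha + beta] the Beta values are the endpoint data at 0 of the two local solutions
    at 1, and the identity becomes the condition [X ^ 2 n1 n2 = m1 m2] of [hermitian_change] with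
    [X = 1 / (delta (1 - alpha))]. *)
Lemma delta_Betaf :
  (delta a b c * (1 - c)) ^+ 2 * (Betaf b (1 - c) * Betaf (c - a) (1 - c)) =
  a * (c - b) * (Betaf c (a + 1 - c) * Betaf c (1 - b)).
Proof.
have s0 : 0 < 1 - c by rewrite subr_gt0.
have pa : 0 < c - a by rewrite subr_gt0.
have pb : 0 < c - b by rewrite subr_gt0.
have p1 : 0 < a + 1 - c by move: a0 c1; lra.
have p2 : 0 < 1 - b by rewrite subr_gt0.
have p3 : 0 < b + 1 - c by move: b0 c1; lra.
have p4 : 0 < 1 - a by rewrite subr_gt0.
rewrite (exprMn 2 (delta a b c)) sqr_delta (BetafE b0 s0) (BetafE pa s0) (BetafE c0 p1) (BetafE c0 p2).
have -> : 2 - c = 1 - c + 1 by ring.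
have -> : b + (1 - c) = b + 1 - c by ring.
have -> : c - a + (1 - c) = 1 - a by ring.
have -> : c + (a + 1 - c) = a + 1 by ring.
have -> : c + (1 - b) = c - b + 1 by ring.
rewrite !GammaS//.
have g1 := Gamma_gt0 a0; have g2 := Gamma_gt0 b0; have g3 := Gamma_gt0 pa.
have g4 := Gamma_gt0 pb; have g5 := Gamma_gt0 c0; have g6 := Gamma_gt0 s0.
have g7 := Gamma_gt0 p3; have g8 := Gamma_gt0 p4.
move: s0 pb a0 g1 g2 g3 g4 g5 g6 g7 g8.
move: (Gamma a) (Gamma b) (Gamma (c - a)) (Gamma (c - b)) (Gamma c) (Gamma (1 - c))
  (Gamma (1 - a)) (Gamma (1 - b)) (Gamma (a + 1 - c)) (Gamma (b + 1 - c)).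
move=> Ga Gb Gca Gcb Gc G2 G3 G4 G5 G6 t0 tb ta k1 k2 k3 k4 k5 k6 k7 k8.
by field; rewrite !gt_eqF.
Qed.

End Delta.

(** * Modulus, real and imaginary parts *)

Section ComplexModulus.
Context {R : realType}.
Implicit Types (z w : R[i]) (r : R).

Lemma normcMc z w : normc (z * w) = normc z * normc w.
Proof. exact: Normc.normcM. Qed.

Lemma normcDc z w : normc (z + w) <= normc z + normc w.
Proof. exact: le_normcD. Qed.

Lemma normcNc z : normc (- z) = normc z.
Proof. exact: normcN. Qed.

Lemma normcBC z w : normc (z - w) = normc (w - z).
Proof. by rewrite -normcNc opprB. Qed.

Lemma normc_ge0 z : 0 <= normc z.
Proof. by case: z => x y; exact: sqrtr_ge0. Qed.

Lemma sqr_normcE z : normc z ^+ 2 = Re z ^+ 2 + Im z ^+ 2.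
Proof. by case: z => x y /=; rewrite sqr_sqrtr// addr_ge0 ?sqr_ge0. Qed.

Lemma normc_eq0 z : (normc z == 0) = (z == 0).
Proof.
by apply/eqP/eqP => [/Normc.eq0_normc//|->]; exact: Normc.normc0.
Qed.

Lemma normc_gt0 z : (0 < normc z) = (z != 0).
Proof. by rewrite lt_neqAle eq_sym normc_eq0 normc_ge0 andbT. Qed.

Lemma normc_real r : normc r%:C%C = `|r|.
Proof. by rewrite /= expr0n addr0 sqrtr_sqr. Qed.

Lemma normcX z n : normc (z ^+ n) = normc z ^+ n.
Proof.
elim: n => [|n IH]; first by rewrite !expr0 Normc.normc1.
by rewrite !exprS normcMc IH.
Qed.

Lemma ReM z w : Re (z * w) = Re z * Re w - Im z * Im w.
Proof. by case: z => ? ?; case: w. Qed.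

Lemma ImM z w : Im (z * w) = Re z * Im w + Im z * Re w.
Proof. by case: z => ? ?; case: w. Qed.

Lemma ReD z w : Re (z + w) = Re z + Re w.
Proof. by case: z => ? ?; case: w. Qed.

Lemma ImD z w : Im (z + w) = Im z + Im w.
Proof. by case: z => ? ?; case: w. Qed.

Lemma ReN z : Re (- z) = - Re z.
Proof. by case: z. Qed.

Lemma ImN z : Im (- z) = - Im z.
Proof. by case: z. Qed.

Lemma Re_real r : Re (r%:C%C : R[i]) = r. Proof. by []. Qed.

Lemma Im_real r : Im (r%:C%C : R[i]) = 0. Proof. by []. Qed.

Definition ReImE := (ReD, ImD, ReN, ImN, ReM, ImM, Re_real, Im_real).

Lemma complex_ext z w : Re z = Re w -> Im z = Im w -> z = w.
Proof. by case: z => ? ?; case: w => ? ? /= -> ->. Qed.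

Lemma normr_Re_le z : `|Re z| <= normc z.
Proof.
rewrite -(@ler_pXn2r _ 2) ?nnegrE ?normc_ge0// sqr_normcE real_normK ?num_real//.
by rewrite lerDl sqr_ge0.
Qed.

Lemma normr_Im_le z : `|Im z| <= normc z.
Proof.
rewrite -(@ler_pXn2r _ 2) ?nnegrE ?normc_ge0// sqr_normcE real_normK ?num_real//.
by rewrite lerDr sqr_ge0.
Qed.

Lemma Re_le_normc z : Re z <= normc z.
Proof. exact: le_trans (ler_norm _) (normr_Re_le z). Qed.

Lemma normc_le_ReIm z : normc z <= `|Re z| + `|Im z|.
Proof.
rewrite -(@ler_pXn2r _ 2) ?nnegrE ?normc_ge0 ?addr_ge0// sqr_normcE sqrrD.
rewrite !real_normK ?num_real// lerD2r lerDl mulrn_wge0// mulr_ge0//.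
Qed.

Lemma Re_gt0_neq0 z : 0 < Re z -> z != 0.
Proof. by apply: contraTneq => ->; rewrite ltxx. Qed.

End ComplexModulus.

(** * Complex curves and principal powers *)

Section ComplexPower.
Context {R : realType}.
Implicit Types (z w q k : R[i]) (r s t : R) (F G : R -> R[i]).

Definition is_cderive t F (d : R[i]) :=
  is_derive t 1 (fun s => Re (F s)) (Re d) /\
  is_derive t 1 (fun s => Im (F s)) (Im d).

Lemma is_cderive_ext F G t d e : is_cderive t F d -> (forall s, F s = G s) ->
  d = e -> is_cderive t G e.
Proof. by move=> h /funext <- <-. Qed.

Lemma is_cderive_cst q t : is_cderive t (fun=> q) 0.
Proof. by split; exact: is_derive_cst. Qed.

Lemma is_cderive_real t : is_cderive t (fun s => s%:C%C) 1.
Proof. by split; [exact: is_derive_id|exact: is_derive_cst]. Qed.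

Lemma is_cderiveD F G t d e : is_cderive t F d -> is_cderive t G e ->
  is_cderive t (fun s => F s + G s) (d + e).
Proof.
move=> [h1 h2] [k1 k2]; split.
  apply: (is_derive_ext (is_deriveD h1 k1)); last by rewrite ReD.
  by apply/funext => s; rewrite ReD.
apply: (is_derive_ext (is_deriveD h2 k2)); last by rewrite ImD.
by apply/funext => s; rewrite ImD.
Qed.

Lemma is_cderiveM F G t d e : is_cderive t F d -> is_cderive t G e ->
  is_cderive t (fun s => F s * G s) (d * G t + F t * e).
Proof.
move=> [h1 h2] [k1 k2]; split.
  apply: (is_derive_ext (is_deriveB (is_deriveM h1 k1) (is_deriveM h2 k2))).
    by apply/funext => s; rewrite ReM.
  by rewrite !ReImE /GRing.scale /=; ring.
apply: (is_derive_ext (is_deriveD (is_deriveM h1 k2) (is_deriveM h2 k1))).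
  by apply/funext => s; rewrite ImM.
by rewrite !ReImE /GRing.scale /=; ring.
Qed.

Lemma is_cderive_affine q k t : is_cderive t (fun s => q + s%:C%C * k) k.
Proof.
apply: (is_cderive_ext (is_cderiveD (is_cderive_cst q t)
  (is_cderiveM (is_cderive_real t) (is_cderive_cst k t)))) => //.
by rewrite mulr0 addr0 mul1r add0r.
Qed.

(** The real mean value theorem is applied to both components separately, whence the factor 2. *)
Lemma cmean_value F (F' : R -> R[i]) (M t : R) : 0 <= t ->
  (forall s, 0 <= s <= t -> is_cderive s F (F' s)) ->
  (forall s, 0 <= s <= t -> normc (F' s) <= M) ->
  normc (F t - F 0) <= 2 * M * t.
Proof.
move=> t0 dF FM.
have rmv (f f' : R -> R) : (forall s, 0 <= s <= t -> is_derive s 1 f (f' s)) ->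
    (forall s, 0 <= s <= t -> `|f' s| <= M) -> `|f t - f 0| <= M * t.
  move=> df fM.
  have cf : {within `[0, t], continuous f}.
    apply: derivable_within_continuous => s; rewrite in_itv /= => st.
    by have [] := df _ st.
  have df' s : s \in `]0, t[ -> is_derive s 1 f (f' s).
    by rewrite in_itv /= => /andP[s0 st]; apply: df; rewrite !ltW.
  have [s] := MVT_segment t0 df' cf.
  rewrite in_itv /= subr0 => /fM h ->.
  by rewrite normrM (ger0_norm t0) ler_wpM2r.
apply: le_trans (normc_le_ReIm _) _.
have -> : 2 * M * t = M * t + M * t by ring.
rewrite !ReImE; apply: lerD.
  apply: (rmv (fun s => Re (F s)) (fun s => Re (F' s))) => s st; first by have [] := dF s st.
  exact: le_trans (normr_Re_le _) (FM _ st).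
apply: (rmv (fun s => Im (F s)) (fun s => Im (F' s))) => s st; first by have [] := dF s st.
exact: le_trans (normr_Im_le _) (FM _ st).
Qed.

(** This is [ln |w|] without the square root, so that differentiation yields rational functions. The
    arctangent in [carg] is the principal argument exactly when [0 < Re w]. *)
Definition cln_mod w : R := ln (Re w ^+ 2 + Im w ^+ 2) / 2.
Definition carg w : R := atan (Im w / Re w).

(* The principal branch of [w ^ r]; meaningful on the half-plane [0 < Re w] only. *)
Definition cpow r w : R[i] :=
  (expR (r * cln_mod w) * cos (r * carg w) +i*
   (expR (r * cln_mod w) * sin (r * carg w)))%C.

Lemma expR_cln_mod w : w != 0 -> expR (cln_mod w) = normc w.
Proof.
move=> w0; rewrite /cln_mod -sqr_normcE lnXn ?normc_gt0//.
by rewrite -(mulr_natr (ln _)) mulfK ?pnatr_eq0// lnK// posrE normc_gt0.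
Qed.

Lemma normc_cpow r w : w != 0 -> normc (cpow r w) = normc w `^ r.
Proof.
move=> w0; rewrite -[LHS]ger0_norm ?normc_ge0// -sqrtr_sqr sqr_normcE /=.
rewrite !exprMn -mulrDr cos2Dsin2 mulr1 sqrtr_sqr ger0_norm ?expR_ge0//.
by rewrite mulrC expRM expR_cln_mod.
Qed.

Lemma cpow_real r (x : R) : 0 < x -> cpow r x%:C%C = (x `^ r)%:C%C.
Proof.
move=> x0; rewrite /cpow /carg /= mul0r atan0 mulr0 cos0 sin0 mulr1 mulr0.
have x0' : x%:C%C != 0 :> R[i] by apply: Re_gt0_neq0.
by rewrite mulrC expRM expR_cln_mod// normc_real gtr0_norm.
Qed.

Lemma cpow1 w : 0 < Re w -> cpow 1 w = w.
Proof.
move=> w0; have w1 := Re_gt0_neq0 w0.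
rewrite /cpow !mul1r expR_cln_mod//.
have k2 : 0 < 1 + (Im w / Re w) ^+ 2 by rewrite ltr_pwDl ?sqr_ge0.
have k : cos (carg w) = Re w / normc w.
  have -> : normc w = Re w * Num.sqrt (1 + (Im w / Re w) ^+ 2).
    have e : Num.sqrt (Re w ^+ 2) = Re w by rewrite sqrtr_sqr gtr0_norm.
    rewrite -{1}e -sqrtrM ?sqr_ge0//.
    rewrite -[LHS]ger0_norm ?normc_ge0// -sqrtr_sqr sqr_normcE; congr Num.sqrt.
    by field; rewrite gt_eqF.
  by rewrite /carg cos_atan invfM mulrA divff ?mul1r// gt_eqF.
have n0 : normc w != 0 by rewrite normc_eq0.
have k3 : sin (carg w) = Im w / Re w * cos (carg w).
  rewrite -[Im w / Re w]atanK /tan divfK//.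
  by rewrite /carg cos_atan invr_eq0 sqrtr_eq0 -ltNge.
apply: complex_ext => /=; rewrite ?k3 k.
  by rewrite mulrCA divff ?mulr1.
by field; rewrite n0 gt_eqF.
Qed.

Lemma cpowD r s w : cpow (r + s) w = cpow r w * cpow s w.
Proof.
rewrite /cpow !mulrDl expRD cosD sinD; apply: complex_ext => /=; ring.
Qed.

Lemma cpow0 w : cpow 0 w = 1.
Proof. by rewrite /cpow !mul0r expR0 cos0 sin0 mulr1 mulr0. Qed.

Lemma cpowS r w : 0 < Re w -> cpow (r + 1) w = cpow r w * w.
Proof. by move=> w0; rewrite cpowD cpow1. Qed.

End ComplexPower.

(** * Derivative and Taylor estimates of complex powers *)

Section ComplexPowerDerivative.
Context {R : realType}.
Implicit Types (z w q k : R[i]) (r s t : R) (F G : R -> R[i]).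

Lemma is_cderive_cpow r q k t : 0 < Re (q + t%:C%C * k) ->
  is_cderive t (fun s => cpow r (q + s%:C%C * k))
    (r%:C%C * k * cpow (r - 1) (q + t%:C%C * k)).
Proof.
move=> X0; have [dX dY] := is_cderive_affine q k t.
(* This factorization writes the components of [w ^ r] linearly in those of [w ^ (r - 1)], so that
   matching the computed derivative with the stated one becomes a rational identity. *)
have PE : cpow r (q + t%:C%C * k) = cpow (r - 1) (q + t%:C%C * k) * (q + t%:C%C * k).
  by rewrite -cpowS// subrK.
set w := q + t%:C%C * k in X0 PE *.
set X := fun s : R => Re (q + s%:C%C * k) in dX.
set Y := fun s : R => Im (q + s%:C%C * k) in dY.
have Xt : X t = Re w by [].
have Yt : Y t = Im w by [].
have S0 : 0 < Re w ^+ 2 + Im w ^+ 2 by rewrite ltr_pwDl ?sqr_ge0 ?exprn_gt0.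
have dS : is_derive t 1 (fun s => X s ^+ 2 + Y s ^+ 2) (2 * (Re w * Re k + Im w * Im k)).
  apply: (is_derive_ext (is_deriveD (is_deriveM dX dX) (is_deriveM dY dY))) => //.
  by rewrite /GRing.scale /= Xt Yt; ring.
have dL : is_derive t 1 (fun s => cln_mod (q + s%:C%C * k))
    ((Re w * Re k + Im w * Im k) / (Re w ^+ 2 + Im w ^+ 2)).
  have h := @is_derive1_comp _ (@ln R) (fun s => X s ^+ 2 + Y s ^+ 2) t _ _ (is_derive1_ln S0) dS.
  apply: (is_derive_ext (is_deriveM h (is_derive_cst (2^-1 : R) t 1))) => //.
  rewrite /GRing.scale /=; field.
  by rewrite gt_eqF.
have dV := is_deriveV (lt0r_neq0 X0 : X t != 0) dX.
have dA : is_derive t 1 (fun s => Y s / X s) ((Im k * Re w - Im w * Re k) / Re w ^+ 2).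
  apply: (is_derive_ext (is_deriveM dY dV)) => //.
  rewrite /GRing.scale /= Xt Yt; field.
  by rewrite gt_eqF.
have dT : is_derive t 1 (fun s => carg (q + s%:C%C * k))
    ((Im k * Re w - Im w * Re k) / (Re w ^+ 2 + Im w ^+ 2)).
  have h := @is_derive1_comp _ (@atan R) _ t _ _ (is_derive1_atan _) dA.
  apply: (is_derive_ext h) => //; rewrite Xt Yt; field.
  by rewrite !gt_eqF.
have scl (f : R -> R) d : is_derive t 1 f d -> is_derive t 1 (fun s => r * f s) (r * d).
  move=> df; apply: (is_derive_ext (is_deriveM (is_derive_cst r t 1) df)) => //.
  by rewrite /GRing.scale /= mulr0 addr0.
have drL := scl _ _ dL; have drT := scl _ _ dT.
have dE := @is_derive1_comp _ (@expR R) _ t _ _ (is_derive_expR _) drL.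
have dC := @is_derive1_comp _ (@cos R) _ t _ _ (is_derive_cos _) drT.
have dN := @is_derive1_comp _ (@sin R) _ t _ _ (is_derive_sin _) drT.
have e1 := congr1 (@complex.Re R) PE; have e2 := congr1 (@complex.Im R) PE.
rewrite ReM in e1; rewrite ImM in e2.
rewrite [LHS]/= in e1; rewrite [LHS]/= in e2.
set p := Re (cpow (r - 1) w) in e1; set p' := Im (cpow (r - 1) w) in e2.
have RP : Re (r%:C%C * k * cpow (r - 1) w) = r * (Re k * p - Im k * p').
  by rewrite /p /p' !ReM !ImM Re_real Im_real; ring.
have IP : Im (r%:C%C * k * cpow (r - 1) w) = r * (Re k * p' + Im k * p).
  by rewrite /p /p' !ImM !ReM Re_real Im_real; ring.
have dP : is_derive t 1 (fun s => expR (r * cln_mod (q + s%:C%C * k)) * cos (r * carg (q + s%:C%C * k)))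
    (Re (r%:C%C * k * cpow (r - 1) w)).
  apply: (is_derive_ext (is_deriveM dE dC)) => //.
  rewrite RP /GRing.scale /=.
  transitivity (r / (Re w ^+ 2 + Im w ^+ 2) * ((Re w * Re k + Im w * Im k) *
     (expR (r * cln_mod w) * cos (r * carg w)) - (Im k * Re w - Im w * Re k) *
     (expR (r * cln_mod w) * sin (r * carg w)))); first by ring.
  rewrite e1 e2; field.
  by rewrite gt_eqF.
split; first exact: dP.
apply: (is_derive_ext (is_deriveM dE dN)) => //.
rewrite IP /GRing.scale /=.
transitivity (r / (Re w ^+ 2 + Im w ^+ 2) * ((Re w * Re k + Im w * Im k) *
   (expR (r * cln_mod w) * sin (r * carg w)) + (Im k * Re w - Im w * Re k) *
   (expR (r * cln_mod w) * cos (r * carg w)))); first by ring.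
rewrite e1 e2; field.
by rewrite gt_eqF.
Qed.

Lemma normc_cpowN_le r w (m : R) : 0 <= r -> 0 < m -> m <= Re w ->
  normc (cpow (- r) w) <= m `^ (- r).
Proof.
move=> r0 m0 mw; have w0 : 0 < Re w by exact: lt_le_trans mw.
have mn : m <= normc w by exact: le_trans mw (Re_le_normc w).
rewrite normc_cpow ?Re_gt0_neq0// !powRN lef_pV2 ?posrE ?powR_gt0//; last exact: lt_le_trans mn.
by apply: ge0_ler_powR; rewrite ?nnegrE ?(ltW m0) ?normc_ge0.
Qed.

Section Taylor.
Variables (q k : R[i]) (m : R).
Hypotheses (m0 : 0 < m) (mq : forall t, 0 <= t <= 1 -> m <= Re (q + t%:C%C * k)).

Let pos t : 0 <= t <= 1 -> 0 < Re (q + t%:C%C * k).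
Proof. by move=> /mq; exact: lt_le_trans. Qed.

Let itv01 s t : 0 <= t <= 1 -> 0 <= s <= t -> 0 <= s <= 1.
Proof. by move=> /andP[_ t1] /andP[-> st]; exact: le_trans t1. Qed.

Let base (f : R[i] -> R[i]) : f (q + 0%:C%C * k) = f q.
Proof. by rewrite (_ : 0%:C%C = 0)// mul0r addr0. Qed.

(** The three orders are obtained successively: the derivative of each remainder is [- r k] times
    the preceding one with [r + 1] for [r], and every use of the mean value inequality doubles the
    constant. With nonpositive exponents the lower bound [m] on the real part controls the modulus
    along the whole segment. *)
Lemma cpowN_taylor1 r t : 0 <= r -> 0 <= t <= 1 ->
  normc (cpow (- r) (q + t%:C%C * k) - cpow (- r) q) <=
  2 * r * normc k * m `^ (- r - 1).
Proof.
move=> r0 t01; have /andP[t0 t1] := t01.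
have := @cmean_value _ (fun s => cpow (- r) (q + s%:C%C * k))
  (fun s => (- r)%:C%C * k * cpow (- r - 1) (q + s%:C%C * k))
  (r * normc k * m `^ (- r - 1)) t t0.
rewrite base => h; apply: le_trans (h _ _) _.
- by move=> s /(itv01 t01) s01; apply: is_cderive_cpow; exact: pos.
- move=> s /(itv01 t01) s01; rewrite !normcMc normc_real normrN ger0_norm//.
  rewrite ler_wpM2l ?mulr_ge0 ?normc_ge0//.
  have -> : - r - 1 = - (r + 1) by ring.
  by apply: normc_cpowN_le; rewrite ?mq// addr_ge0.
- rewrite -!mulrA ler_pM2l// !mulrA -[leRHS]mulr1 ler_wpM2l//.
  by rewrite !mulr_ge0 ?normc_ge0 ?powR_ge0.
Qed.

Lemma cpowN_taylor2 r t : 0 <= r -> 0 <= t <= 1 ->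
  normc (cpow (- r) (q + t%:C%C * k) - cpow (- r) q +
    t%:C%C * (r%:C%C * k * cpow (- r - 1) q)) <=
  4 * r * (r + 1) * normc k ^+ 2 * m `^ (- r - 2).
Proof.
move=> r0 t01; have /andP[t0 t1] := t01.
set c := r%:C%C * k * cpow (- r - 1) q.
have := @cmean_value _ (fun s => cpow (- r) (q + s%:C%C * k) + (0 + s%:C%C * c))
  (fun s => - r%:C%C * k * (cpow (- (r + 1)) (q + s%:C%C * k) - cpow (- (r + 1)) q))
  (r * normc k * (2 * (r + 1) * normc k * m `^ (- (r + 1) - 1))) t t0.
rewrite (_ : 0%:C%C = 0)// !mul0r !addr0 !add0r addrAC => h; apply: le_trans (h _ _) _.
- move=> s /(itv01 t01) s01.
  apply: (is_cderive_ext (is_cderiveD (is_cderive_cpow (- r) (pos s01)) (is_cderive_affine 0 c s))) => //.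
  rewrite /c opprD rmorphN; ring.
- move=> s /(itv01 t01) s01; rewrite !normcMc normcNc normc_real ger0_norm//.
  rewrite ler_wpM2l ?mulr_ge0 ?normc_ge0//.
  by apply: cpowN_taylor1 => //; rewrite addr_ge0.
- have -> : - (r + 1) - 1 = - r - 2 by ring.
  set u := m `^ _; have u0 : 0 <= u by exact: powR_ge0.
  rewrite [leLHS](_ : _ = 4 * r * (r + 1) * normc k ^+ 2 * u * t); last by ring.
  by rewrite ler_piMr// !mulr_ge0 ?sqr_ge0 ?addr_ge0 ?exprn_ge0 ?normc_ge0 ?ler0n.
Qed.

Lemma cpowN_taylor3 r : 0 <= r ->
  normc (cpow (- r) (q + k) - (cpow (- r) q - r%:C%C * k * cpow (- r - 1) q +
    (r * (r + 1) / 2)%:C%C * k ^+ 2 * cpow (- r - 2) q)) <=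
  8 * r * (r + 1) * (r + 2) * normc k ^+ 3 * m `^ (- r - 3).
Proof.
move=> r0.
set c := r%:C%C * k * cpow (- r - 1) q.
set d := (r * (r + 1) / 2)%:C%C * k ^+ 2 * cpow (- r - 2) q.
have := @cmean_value _ (fun s => cpow (- r) (q + s%:C%C * k) + ((0 + s%:C%C * c) +
    s%:C%C * (0 + s%:C%C * - d)))
  (fun s => - r%:C%C * k * (cpow (- (r + 1)) (q + s%:C%C * k) - cpow (- (r + 1)) q
     + s%:C%C * ((r + 1)%:C%C * k * cpow (- (r + 1) - 1) q)))
  (r * normc k * (4 * (r + 1) * (r + 1 + 1) * normc k ^+ 2 * m `^ (- (r + 1) - 2))) 1 ler01.
rewrite (_ : 0%:C%C = 0)// (_ : 1%:C%C = 1)// !(mul0r, mul1r, addr0, add0r) => h.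
rewrite [X in normc X <= _](_ : _ = cpow (- r) (q + k) + (c - d) - cpow (- r) q); last by ring.
apply: le_trans (h _ _) _.
- move=> s s01.
  apply: (is_cderive_ext (is_cderiveD (is_cderive_cpow (- r) (pos s01))
    (is_cderiveD (is_cderive_affine 0 c s) (is_cderiveM (is_cderive_real s) (is_cderive_affine 0 (- d) s))))) => //.
  have -> : - (r + 1) - 1 = - r - 2 by ring.
  have -> : - (r + 1) = - r - 1 by ring.
  have d2 : d + d = r%:C%C * (r + 1)%:C%C * k ^+ 2 * cpow (- r - 2) q.
    by rewrite /d -!mulrDl -rmorphD /= -splitr rmorphM.
  transitivity ((- r)%:C%C * k * cpow (- r - 1) (q + s%:C%C * k) + c - s%:C%C * (d + d)); first by ring.
  by rewrite d2 /c rmorphN; ring.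
- move=> s s01; rewrite !normcMc normcNc normc_real ger0_norm//.
  rewrite ler_wpM2l ?mulr_ge0 ?normc_ge0//.
  by apply: cpowN_taylor2 => //; rewrite addr_ge0.
- have -> : - (r + 1) - 2 = - r - 3 by ring.
  set u := m `^ _; rewrite le_eqVlt; apply/orP; left; apply/eqP; ring.
Qed.

End Taylor.
End ComplexPowerDerivative.

(** * Second-order complex expansions *)

Section LocalExpansion.
Context {R : realType}.
Implicit Types (z w h d e : R[i]) (f g F G : R[i] -> R[i]) (u v : R[i] -> R).

Definition bigO n F := exists K r0 : R, 0 < r0 /\
  forall h, normc h < r0 -> normc (F h) <= K * normc h ^+ n.

Lemma bigO_ge0 n F : bigO n F -> exists K r0 : R, [/\ 0 < r0, r0 <= 1, 0 <= K &
  forall h, normc h < r0 -> normc (F h) <= K * normc h ^+ n].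
Proof.
move=> [K [r0 [r00 FK]]]; exists `|K|, (Num.min r0 1); split => //.
- by rewrite lt_min r00 ltr01.
- by rewrite ge_min lexx orbT.
- move=> h; rewrite lt_min => /andP[/FK hF _]; apply: le_trans hF _.
  by rewrite ler_wpM2r ?exprn_ge0 ?normc_ge0 ?ler_norm.
Qed.

Lemma bigO_le n F G : (forall h, normc (G h) <= normc (F h)) -> bigO n F -> bigO n G.
Proof.
move=> FG [K [r0 [r00 FK]]]; exists K, r0; split=> // h /FK.
exact: le_trans (FG h).
Qed.

Lemma bigO_ext n F G : (forall h, F h = G h) -> bigO n F -> bigO n G.
Proof. by move=> FG; apply: bigO_le => h; rewrite FG. Qed.

Lemma bigOD n F G : bigO n F -> bigO n G -> bigO n (fun h => F h + G h).
Proof.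
move=> [K [r [r0 FK]]] [L [s [s0 GL]]]; exists (K + L), (Num.min r s).
rewrite lt_min r0 s0; split=> // h; rewrite lt_min => /andP[/FK h1 /GL h2].
by rewrite mulrDl (le_trans (normcDc _ _))// lerD.
Qed.

Lemma bigOM m n F G : bigO m F -> bigO n G -> bigO (m + n) (fun h => F h * G h).
Proof.
move=> [K [r [r0 FK]]] [L [s [s0 GL]]]; exists (K * L), (Num.min r s).
rewrite lt_min r0 s0; split=> // h; rewrite lt_min => /andP[/FK h1 /GL h2].
by rewrite normcMc exprD mulrACA ler_pM// normc_ge0.
Qed.

Lemma bigO_mono m n F : (n <= m)%N -> bigO m F -> bigO n F.
Proof.
move=> nm /bigO_ge0[K [r [r0 r1 K0 FK]]]; exists K, r; split=> // h hr.
apply: le_trans (FK _ hr) _; rewrite ler_wpM2l// ler_wiXn2l ?normc_ge0//.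
by rewrite (le_trans (ltW hr)).
Qed.

Lemma bigO_cst z : bigO 0 (fun=> z).
Proof. by exists (normc z), 1; split=> // h _; rewrite expr0 mulr1. Qed.

Lemma bigO_id : bigO 1 id.
Proof. by exists 1, 1; split=> // h _; rewrite expr1 mul1r. Qed.

Lemma bigOZ n z F : bigO n F -> bigO n (fun h => z * F h).
Proof. exact: bigOM (bigO_cst z). Qed.

Lemma bigO_Re n F : bigO n F -> bigO n (fun h => (Re (F h))%:C%C).
Proof. by apply: bigO_le => h; rewrite normc_real normr_Re_le. Qed.

Lemma bigO_sqr_normc : bigO 2 (fun h => (normc h ^+ 2)%:C%C).
Proof.
exists 1, 1; split=> // h _.
by rewrite normc_real ger0_norm ?exprn_ge0 ?normc_ge0// mul1r.
Qed.

(** The second coefficient may remain anonymous, since its terms average to zero on circles. The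
    error is cubic so that circle means divided by [r ^ 2] are determined up to [O(r)]. *)
Definition cdiff f z d := exists e,
  bigO 3 (fun h => f (z + h) - (f z + d * h + e * h ^+ 2)).

Lemma cdiff_cst z d : cdiff (fun=> d) z 0.
Proof.
exists 0; exists 0, 1; split=> // h _.
by rewrite !mul0r !addr0 subrr Normc.normc0.
Qed.

Lemma cdiff_affine p q z : cdiff (fun w => p + q * w) z q.
Proof.
exists 0; exists 0, 1; split=> // h _.
by rewrite (_ : _ - _ = 0) ?mul0r ?Normc.normc0//; ring.
Qed.

Lemma cdiff_id z : cdiff id z 1.
Proof.
exists 0; exists 0, 1; split=> // h _.
by rewrite (_ : _ - _ = 0) ?mul0r ?Normc.normc0//; ring.
Qed.

Lemma cdiffD f g z d e : cdiff f z d -> cdiff g z e ->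
  cdiff (fun w => f w + g w) z (d + e).
Proof.
move=> [d2 h1] [e2 h2]; exists (d2 + e2); apply: bigO_ext (bigOD h1 h2) => h.
by ring.
Qed.

Lemma bigO_poly2 a b c : bigO 0 (fun h => a + b * h + c * h ^+ 2).
Proof.
apply: bigOD; first apply: bigOD; first exact: bigO_cst.
  by apply: (@bigO_mono 1) => //; apply: bigOZ; exact: bigO_id.
by apply: (@bigO_mono 2) => //; apply: bigOZ; exact: (bigOM bigO_id bigO_id).
Qed.

Lemma cdiffM f g z d e : cdiff f z d -> cdiff g z e ->
  cdiff (fun w => f w * g w) z (d * g z + f z * e).
Proof.
move=> [d2 h1] [e2 h2]; exists (d2 * g z + d * e + f z * e2).
have hG : bigO 0 (fun h => g (z + h)).
  apply: bigO_ext (bigOD (bigO_mono (leq0n 3) h2) (bigO_poly2 (g z) e e2)) => h.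
  by rewrite subrK.
have h4 := bigOM h1 hG.
have h5 := bigOM (bigO_poly2 (f z) d d2) h2.
have h6 : bigO (3 + 0) (fun h => (h * (h * h)) * (d * e2 + d2 * e + d2 * e2 * h + 0 * h ^+ 2)).
  by apply: (bigOM (bigOM bigO_id (bigOM bigO_id bigO_id))); exact: bigO_poly2.
apply: bigO_ext (bigOD (bigOD h4 h5) h6) => h; ring.
Qed.

Lemma cdiffZ f z d k : cdiff f z d -> cdiff (fun w => k * f w) z (k * d).
Proof. by move=> /(cdiffM (cdiff_cst z k)); rewrite mul0r add0r. Qed.

Lemma cdiff_comp_affine f p q z d : cdiff f (p + q * z) d ->
  cdiff (fun w => f (p + q * w)) z (d * q).
Proof.
move=> [e [K [r [r0 hK]]]]; exists (e * q ^+ 2).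
have q0 : 0 <= normc q by exact: normc_ge0.
have q1 : 0 < 1 + normc q by rewrite ltr_pwDl.
exists (`|K| * normc q ^+ 3), (r / (1 + normc q)); split; first exact: divr_gt0.
move=> h; rewrite ltr_pdivlMr// => hr.
have qh : normc (q * h) < r.
  by apply: le_lt_trans hr; rewrite normcMc mulrC ler_wpM2l ?normc_ge0// lerDr.
have := hK _ qh; rewrite normcMc !exprMn.
rewrite (_ : p + q * (z + h) = p + q * z + q * h); last by ring.
rewrite (_ : d * (q * h) = d * q * h); last by ring.
rewrite (_ : e * (q ^+ 2 * h ^+ 2) = e * q ^+ 2 * h ^+ 2); last by ring.
move=> h1; apply: le_trans h1 _; rewrite -[leRHS]mulrA ler_wpM2r ?ler_norm//.
by rewrite mulr_ge0// exprn_ge0// normc_ge0.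
Qed.

Lemma cdiff_near f g z d : (exists r : R, 0 < r /\ forall h, normc h < r -> f (z + h) = g (z + h)) ->
  cdiff f z d -> cdiff g z d.
Proof.
move=> [r [r0 fg]] [e [K [s [s0 hK]]]]; exists e; exists K, (Num.min r s).
rewrite lt_min r0 s0; split=> // h; rewrite lt_min => /andP[/fg <- /hK].
by have := fg 0; rewrite addr0 Normc.normc0 => -> .
Qed.

Lemma is_derive_quadratic (f : R -> R) (t d K r : R) : 0 < r ->
  (forall e : R, `|e| < r -> `|f (t + e) - f t - d * e| <= K * e ^+ 2) ->
  is_derive t 1 f d.
Proof.
move=> r0 fK; have K1 : 0 < `|K| + 1 by rewrite addrC ltr_pwDl.
have cv : h^-1 *: ((f \o shift t) (h *: (1 : R)) - f t) @[h --> 0^'] --> d.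
  apply/cvgrPdist_le => e e0; near=> h.
  have h0 : h != 0 by near: h; exact: nbhs_dnbhs_neq.
  have hr : `|h| < Num.min r (e / (`|K| + 1)).
    by near: h; apply: dnbhs0_lt; rewrite lt_min r0 divr_gt0.
  move: hr; rewrite lt_min => /andP[hr he].
  rewrite /= /GRing.scale /= mulr1 [h + t]addrC distrC.
  have -> : h^-1 * (f (t + h) - f t) - d = h^-1 * (f (t + h) - f t - d * h).
    by field.
  rewrite normrM normfV mulrC ler_pdivrMr ?normr_gt0//.
  apply: le_trans (fK _ hr) _.
  apply: (@le_trans _ _ ((`|K| + 1) * `|h| * `|h|)); last first.
    rewrite ler_wpM2r//; by rewrite mulrC -ler_pdivlMr ?ltW.
  rewrite -mulrA -expr2 real_normK ?num_real// ler_wpM2r ?sqr_ge0//.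
  by rewrite (le_trans (ler_norm _))// lerDl.
apply: DeriveDef; first exact: (cvgP _ cv).
exact: (cvg_lim _ cv).
Unshelve. all: by end_near. Qed.

Lemma cdiff_is_cderive f z h d t : cdiff f (z + t%:C%C * h) d ->
  is_cderive t (fun s => f (z + s%:C%C * h)) (d * h).
Proof.
move=> [e [K [r [r0 hK]]]].
have n0 : 0 <= normc h by exact: normc_ge0.
have n1 : 0 < 1 + normc h by rewrite ltr_pwDl.
pose L := `|K| * normc h ^+ 3 + normc e * normc h ^+ 2.
have main (x : R) : `|x| < Num.min 1 (r / (1 + normc h)) ->
   normc (f (z + (t + x)%:C%C * h) - f (z + t%:C%C * h) - d * h * x%:C%C) <= L * x ^+ 2.
  rewrite lt_min => /andP[x1 xr].
  have xh : normc (x%:C%C * h) < r.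
    move: xr; rewrite ltr_pdivlMr// => xr; apply: le_lt_trans xr.
    by rewrite normcMc normc_real ler_wpM2l// lerDr.
  have := hK _ xh.
  rewrite (_ : z + t%:C%C * h + x%:C%C * h = z + (t + x)%:C%C * h); last first.
    by rewrite rmorphD /=; ring.
  set A := f _; set B := f _; rewrite normcMc normc_real => h1.
  have -> : A - B - d * h * x%:C%C = (A - (B + d * (x%:C%C * h) + e * (x%:C%C * h) ^+ 2))
     + e * (x%:C%C * h) ^+ 2 by ring.
  apply: le_trans (normcDc _ _) _; rewrite /L mulrDl; apply: lerD.
    apply: le_trans h1 _.
    apply: (@le_trans _ _ (`|K| * normc h ^+ 3 * `|x| * `|x| ^+ 2)).
      have -> : `|K| * normc h ^+ 3 * `|x| * `|x| ^+ 2 = `|K| * (`|x| * normc h) ^+ 3 by ring.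
      by rewrite ler_wpM2r ?ler_norm ?exprn_ge0 ?mulr_ge0.
    rewrite real_normK ?num_real// ler_wpM2r ?sqr_ge0//.
    by rewrite ler_piMr ?(ltW x1)// mulr_ge0 ?exprn_ge0.
  rewrite normcMc normcX normcMc normc_real exprMn real_normK ?num_real//.
  by rewrite le_eqVlt; apply/orP; left; apply/eqP; ring.
have r1 : 0 < Num.min 1 (r / (1 + normc h)) by rewrite lt_min ltr01 divr_gt0.
split; apply: (is_derive_quadratic r1 (K := L)) => x /main h1; apply: le_trans h1.
  apply: le_trans (normr_Re_le _); set A := f _; set B := f _.
  by rewrite ReD ReN ReD ReN [Re (_ * x%:C%C)]ReM Re_real Im_real mulr0 subr0.
apply: le_trans (normr_Im_le _); set A := f _; set B := f _.
by rewrite ImD ImN ImD ImN [Im (_ * x%:C%C)]ImM Re_real Im_real mulr0 add0r.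
Qed.

(** The mean value inequality with bound 0. Wronskians are shown in this way to be constant on
    convex sets. *)
Lemma cdiff0_segment f z w :
  (forall t : R, 0 <= t <= 1 -> cdiff f (z + t%:C%C * (w - z)) 0) -> f w = f z.
Proof.
move=> df; apply/eqP; rewrite -subr_eq0 -normc_eq0 eq_le normc_ge0 andbT.
have := @cmean_value _ (fun s => f (z + s%:C%C * (w - z))) (fun=> 0) 0 1 ler01.
rewrite (_ : 0%:C%C = 0)// (_ : 1%:C%C = 1)// mul0r mul1r addr0 [z + _]addrC subrK mulr0 mul0r.
apply; last by move=> s _; rewrite Normc.normc0.
by move=> s /df /cdiff_is_cderive; rewrite mul0r.
Qed.

End LocalExpansion.

(** * Real expansions: gradient and Laplacian *)

Section RealExpansion.
Context {R : realType}.
Implicit Types (z w h d e p q : R[i]) (f : R[i] -> R[i]) (g u v : R[i] -> R).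

Definition rbigO n u := bigO n (fun h => (u h)%:C%C).

Lemma rbigO_ext n u v : (forall h, u h = v h) -> rbigO n u -> rbigO n v.
Proof. by move=> uv; apply: bigO_ext => h; rewrite uv. Qed.

Lemma rbigOD n u v : rbigO n u -> rbigO n v -> rbigO n (fun h => u h + v h).
Proof. by move=> hu hv; apply: bigO_ext (bigOD hu hv) => h; rewrite rmorphD. Qed.

Lemma rbigOM m n u v : rbigO m u -> rbigO n v -> rbigO (m + n) (fun h => u h * v h).
Proof. by move=> hu hv; apply: bigO_ext (bigOM hu hv) => h; rewrite rmorphM. Qed.

Lemma rbigOZ n (k : R) u : rbigO n u -> rbigO n (fun h => k * u h).
Proof. by move=> hu; apply: bigO_ext (bigOZ k%:C%C hu) => h; rewrite rmorphM. Qed.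

Lemma rbigO_lin p : rbigO 1 (fun h => Re (p * h)).
Proof. by apply: bigO_Re; apply: bigOZ; exact: bigO_id. Qed.

Lemma rbigO_quad q (c : R) : rbigO 2 (fun h => Re (q * h ^+ 2) + c * normc h ^+ 2).
Proof.
apply: rbigOD; last by apply: rbigOZ; exact: bigO_sqr_normc.
by apply: bigO_Re; apply: bigOZ; exact: (bigOM bigO_id bigO_id).
Qed.

(* [z] is a local expansion centre, [p] carries the gradient, and [4 * c] is the
   Laplacian of [g] at [z]. *)
Definition expand g z p (c : R) := exists q, rbigO 3 (fun h =>
  g (z + h) - (g z + Re (p * h) + (Re (q * h ^+ 2) + c * normc h ^+ 2))).

Lemma expand_eq g z p p' c c' : expand g z p c -> p = p' -> c = c' -> expand g z p' c'.
Proof. by move=> h <- <-. Qed.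

Lemma expandD g u z p p' c c' : expand g z p c -> expand u z p' c' ->
  expand (fun w => g w + u w) z (p + p') (c + c').
Proof.
move=> [q hq] [q' hq']; exists (q + q'); apply: rbigO_ext (rbigOD hq hq') => h.
by rewrite !mulrDl !ReD; ring.
Qed.

Lemma expandZ (k : R) g z p c : expand g z p c ->
  expand (fun w => k * g w) z (k%:C%C * p) (k * c).
Proof.
move=> [q hq]; exists (k%:C%C * q); apply: rbigO_ext (rbigOZ k hq) => h.
by rewrite -!mulrA ![Re (k%:C%C * _)]ReM Re_real Im_real; ring.
Qed.

Lemma expand_cst (k : R) z : expand (fun=> k) z 0 0.
Proof.
exists 0; exists 0, 1; split=> // h _.
by rewrite !mul0r normc_real !addr0 subrr normr0.
Qed.

Lemma expand_near g u z p c :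
  (exists r : R, 0 < r /\ forall h, normc h < r -> g (z + h) = u (z + h)) ->
  expand g z p c -> expand u z p c.
Proof.
move=> [r [r0 fg]] [e [K [s [s0 hK]]]]; exists e; exists K, (Num.min r s).
rewrite lt_min r0 s0; split=> // h; rewrite lt_min => /andP[/fg <- /hK].
by have := fg 0; rewrite addr0 Normc.normc0 => -> .
Qed.

Lemma bigO_conj n (F : R[i] -> R[i]) : bigO n F -> bigO n (fun h => (F h)^*%C).
Proof.
by apply: bigO_le => h; case: (F h) => x y /=; rewrite sqrrN.
Qed.

(** The Laplacian of [|f| ^ 2] is [4 |f'| ^ 2]. The terms [h1] to [h4] are what remains of
    [|f + d h + e h ^ 2 + rho| ^ 2] beyond degree two. *)
Lemma expand_sqr_normc f z d : cdiff f z d ->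
  expand (fun w => normc (f w) ^+ 2) z (2 * (f z)^*%C * d) (normc d ^+ 2).
Proof.
move=> [e hf]; exists (2 * (f z)^*%C * e).
set rho := (fun h => _) in hf.
have h1 : bigO (1 + 2) (fun h => (d * h)^*%C * (2 * e * (h * h))).
  apply: bigOM; first by apply: bigO_conj; apply: bigOZ; exact: bigO_id.
  by apply: bigOZ; exact: (bigOM bigO_id bigO_id).
have h2 : bigO 3 (fun h => (e * (h * h))^*%C * (e * (h * h))).
  apply: (@bigO_mono _ (2 + 2)) => //; apply: bigOM; last first.
    by apply: bigOZ; exact: (bigOM bigO_id bigO_id).
  by apply: bigO_conj; apply: bigOZ; exact: (bigOM bigO_id bigO_id).
have h3 : bigO (0 + 3) (fun h => (f z + d * h + e * h ^+ 2)^*%C * (2 * rho h)).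
  by apply: bigOM; [apply: bigO_conj; exact: bigO_poly2|apply: bigOZ].
have h4 : bigO 3 (fun h => (rho h)^*%C * rho h).
  by apply: (@bigO_mono _ (3 + 3)) => //; apply: bigOM => //; exact: bigO_conj.
apply: bigO_ext (bigO_Re (bigOD (bigOD h1 h2) (bigOD h3 h4))) => h; congr (_%:C)%C.
have -> : f (z + h) = f z + d * h + e * h ^+ 2 + rho h by rewrite /rho; ring.
move: (f z) (rho h) => [a a'] [r r']; case: d {hf rho h1 h2 h3 h4} => d d'; case: e => e e'.
case: h => h h'; rewrite !sqr_normcE !expr2 /=.
by ring.
Qed.

(** With [x] replaced by [t x], the left-hand side has [t]-derivative [t ^ 2 x ^ 3 / (1 + t x)],
    where [1 + t x >= 1 / 2]. The complex mean value inequality, used for a real function, brings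
    the constant from 2 to 4. *)
Lemma ln1D_quadratic (x : R) : `|x| <= 2^-1 ->
  `|ln (1 + x) - x + x ^+ 2 / 2| <= 4 * `|x| ^+ 3.
Proof.
move=> x2.
have pos (t : R) : 0 <= t <= 1 -> 2^-1 <= 1 + t * x.
  move=> /andP[t0 t1]; have : `|t * x| <= 2^-1.
    by rewrite normrM ger0_norm//; apply: le_trans x2; rewrite ler_piMl.
  by rewrite ler_norml => /andP[h _]; lra.
have := @cmean_value _ (fun t => (ln (1 + t * x) - t * x + t ^+ 2 * x ^+ 2 / 2)%:C%C)
  (fun t => (t ^+ 2 * x ^+ 3 / (1 + t * x))%:C%C) (2 * `|x| ^+ 3) 1 ler01.
have e : (ln (1 + 1 * x) - 1 * x + 1 ^+ 2 * x ^+ 2 / 2) -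
   (ln (1 + 0 * x) - 0 * x + 0 ^+ 2 * x ^+ 2 / 2) = ln (1 + x) - x + x ^+ 2 / 2.
  by rewrite mul1r mul0r addr0 ln1; ring.
rewrite -rmorphB e normc_real => h; apply: le_trans (h _ _) _; last by rewrite mulr1 mulrA -natrM.
- move=> t t01; have p1 : 0 < 1 + t * x by apply: lt_le_trans (pos _ t01).
  split; last exact: is_derive_cst.
  have dA : is_derive t 1 (fun s : R => s * x) x.
    apply: (is_derive_ext (is_deriveM (is_derive_id t 1) (is_derive_cst x t 1))) => //.
    by rewrite /GRing.scale /= mulr0 mulr1 add0r.
  have dB : is_derive t 1 (fun s : R => 1 + s * x) x.
    by apply: (is_derive_ext (is_deriveD (is_derive_cst (1 : R) t 1) dA)) => //; rewrite add0r.
  have dL := @is_derive1_comp _ (@ln R) (fun s => 1 + s * x) t _ _ (is_derive1_ln p1) dB.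
  have dQ := is_deriveM (is_deriveM dA dA) (is_derive_cst (2^-1 : R) t 1).
  apply: (is_derive_ext (is_deriveD (is_deriveB dL dA) dQ)).
    by apply/funext => s /=; rewrite -exprMn expr2.
  rewrite /GRing.scale /= mulr0 add0r; field.
  by rewrite gt_eqF.
- move=> t t01; have p1 := pos _ t01; have /andP[t0 t1] := t01.
  have p0 : 0 < 1 + t * x by apply: lt_le_trans p1.
  rewrite normc_real normrM normfV (gtr0_norm p0) ler_pdivrMr// normrM normrX normrX (ger0_norm t0).
  apply: (@le_trans _ _ (1 * `|x| ^+ 3)).
    by rewrite ler_wpM2r ?exprn_ge0// exprn_ile1.
  rewrite [leRHS](_ : _ = 2 * (1 + t * x) * `|x| ^+ 3); last by ring.
  by rewrite ler_wpM2r ?exprn_ge0//; lra.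
Qed.

Lemma rbigO_ln u : rbigO 1 u -> rbigO 3 (fun h => ln (1 + u h) - u h + u h ^+ 2 / 2).
Proof.
move=> /bigO_ge0[K [r [r0 r1 K0 uK]]].
have K1 : 0 < 2 * (K + 1) by lra.
exists (4 * K ^+ 3), (Num.min r (2 * (K + 1))^-1).
rewrite lt_min r0 invr_gt0 K1; split => // h; rewrite lt_min => /andP[/uK hu hr].
rewrite normc_real expr1 in hu; rewrite normc_real.
apply: le_trans (ln1D_quadratic _) _.
  apply: le_trans hu _; move: hr; rewrite -[ltRHS]mul1r ltr_pdivlMr// => hr.
  have := normc_ge0 h; nra.
by rewrite -mulrA -exprMn ler_pM2l// lerXn2r// nnegrE mulr_ge0 ?normc_ge0.
Qed.

(** Splits the square of a linear term into a rotation-invariant part, which counts for the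
    Laplacian, and a harmonic part. *)
Lemma sqr_Re_half w : Re w ^+ 2 = (normc w ^+ 2 + Re (w ^+ 2)) / 2.
Proof. by rewrite sqr_normcE; case: w => x y; rewrite [in RHS]expr2 /=; field. Qed.

Lemma ReZ (k : R) w : Re (k%:C%C * w) = k * Re w.
Proof. by rewrite ReM Re_real Im_real mul0r subr0. Qed.

(** The rule [Laplacian (ln g) = (Laplacian g) / g - |grad g| ^ 2 / g ^ 2], divided by 4. The last
    term is the invariant half of the square of the linear part in the logarithmic series; its
    harmonic half goes into the coefficient of [h ^ 2]. *)
Lemma expand_ln g z p c : 0 < g z -> expand g z p c ->
  expand (fun w => ln (g w)) z ((g z)^-1%:C%C * p)
    (c / g z - normc p ^+ 2 / (4 * g z ^+ 2)).
Proof.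
move=> g0 [q hq]; set g1 := g z in g0 hq *.
set rho := (fun h => _) in hq.
pose L h := g1^-1 * Re (p * h); pose Q h := g1^-1 * (Re (q * h ^+ 2) + c * normc h ^+ 2).
pose x h := L h + Q h + g1^-1 * rho h.
have L1 : rbigO 1 L by apply: rbigOZ; exact: rbigO_lin.
have Q2 : rbigO 2 Q by apply: rbigOZ; exact: rbigO_quad.
have r3 : rbigO 3 (fun h => g1^-1 * rho h) by exact: rbigOZ.
have x1 : rbigO 1 x.
  apply: rbigOD; last exact: (bigO_mono _ r3).
  by apply: rbigOD => //; exact: (bigO_mono _ Q2).
have d2 : rbigO 2 (fun h => Q h + g1^-1 * rho h).
  by apply: rbigOD => //; exact: (bigO_mono _ r3).
have s3 := rbigOM d2 (rbigOD x1 L1).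
have l3 := rbigO_ln x1.
have xE h : 1 + x h = g (z + h) / g1.
  have -> : g (z + h) = rho h + (g1 + Re (p * h) + (Re (q * h ^+ 2) + c * normc h ^+ 2)).
    by rewrite /rho /g1; ring.
  rewrite /x /L /Q; field.
  by rewrite gt_eqF.
exists (g1^-1%:C%C * q - (g1^-1 ^+ 2 / 4)%:C%C * p ^+ 2).
have := rbigOD l3 (rbigOD r3 (rbigOZ (- 2^-1) s3)).
move=> [K [s [s0 hK]]].
have [K' [r [r0 r1 K0 xK]]] := bigO_ge0 x1.
have K1 : 0 < K' + 1 by lra.
exists K, (Num.min s (Num.min r (K' + 1)^-1)).
rewrite !lt_min s0 r0 invr_gt0 K1; split=> // h.
rewrite !lt_min => /and3P[/hK hs /xK hr hi].
rewrite normc_real expr1 in hr.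
have xs : - 1 < x h.
  have : `|x h| < 1.
    apply: le_lt_trans hr _; move: hi; rewrite -[ltRHS]mul1r ltr_pdivlMr// => hi.
    by have := normc_ge0 h; nra.
  by rewrite ltr_norml => /andP[].
have gp : 0 < g (z + h) by rewrite -(pmulr_lgt0 _ (_ : 0 < g1^-1)) ?invr_gt0// -xE; lra.
rewrite (_ : ln (g (z + h)) = ln (1 + x h) + ln g1); last first.
  by rewrite xE ln_div ?posrE// subrK.
apply: le_trans hs; rewrite le_eqVlt; apply/orP; left; apply/eqP; congr (normc (_%:C)%C).
have e1 : L h ^+ 2 = g1^-1 ^+ 2 * ((normc p ^+ 2 * normc h ^+ 2 + Re (p ^+ 2 * h ^+ 2)) / 2).
  by rewrite /L exprMn sqr_Re_half normcMc !exprMn.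
transitivity (ln (1 + x h) - x h + g1^-1 * rho h + L h ^+ 2 / 2).
  rewrite e1 mulrBl -[_%:C%C * q * _]mulrA -[_%:C%C * p ^+ 2 * _]mulrA -[_%:C%C * p * _]mulrA ReD ReN !ReZ.
  rewrite /x /L /Q.
  move: (Re (p * h)) (Re (q * h ^+ 2)) (Re (p ^+ 2 * h ^+ 2)) => a1 a2 a3.
  field.
  by rewrite gt_eqF.
rewrite /x; ring.
Qed.

End RealExpansion.

(** * Curvature at a point of contact from above *)

Section CurvatureAtMaximum.
Context {R : realType}.
Implicit Types (z h p q : R[i]) (lam g : R[i] -> R).
Local Notation mu := (@lebesgue_measure R).

(* No measurability is needed, since the integral of a nonnegative function is a
   supremum over the simple functions below it. *)
Lemma le_integral_pointwise (D : set R) (f g : R -> \bar R) :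
  (forall t, D t -> f t <= g t)%E ->
  (\int[mu]_(t in D) f t <= \int[mu]_(t in D) g t)%E.
Proof.
have ge0_le (u v : R -> \bar R) : (forall t, D t -> 0 <= u t)%E ->
    (forall t, D t -> u t <= v t)%E ->
    (\int[mu]_(t in D) u t <= \int[mu]_(t in D) v t)%E.
  move=> u0 uv; have v0 t : D t -> (0 <= v t)%E by move=> Dt; exact: le_trans (u0 _ Dt) (uv _ Dt).
  rewrite !ge0_integralE//; apply: le_ereal_sup => _ [k /= ku <-].
  exists k => // t; apply: le_trans (ku t) _; rewrite /patch.
  by case: ifPn => //; rewrite inE => /uv.
move=> fg; rewrite [leLHS]integralE [leRHS]integralE; apply: leeB.
  apply: ge0_le => t Dt; rewrite !funeposE; first by rewrite le_max lexx orbT.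
  by rewrite ge_max !le_max lexx !orbT andbT fg.
apply: ge0_le => t Dt; rewrite !funenegE; first by rewrite le_max lexx orbT.
by rewrite ge_max !le_max lexx !orbT andbT leeN2 fg.
Qed.

Lemma sin2piE : sin (2 * pi) = 0 :> R.
Proof. by rewrite mulr_natl sin2pi. Qed.

Lemma cos2piE : cos (2 * pi) = 1 :> R.
Proof. by rewrite mulr_natl cos2pi. Qed.

(** The integrand is a general second-order expansion restricted to a circle; its first and second
    harmonics have mean zero. *)
Lemma integral_trig (A a b c d : R) :
  (\int[mu]_(t in `[0%R, (2 * pi)%R])
    (A + (a * cos t - b * sin t) + (c * (cos t ^+ 2 - sin t ^+ 2) - d * (2 * sin t * cos t)))%R%:E
   = (2 * pi * A)%R%:E)%E.
Proof.
pose F (t : R) := A * t + (a * sin t + b * cos t) + (c * (sin t * cos t) + d * (cos t * cos t)).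
have dF (t : R) : is_derive t 1 F (A + (a * cos t - b * sin t) +
    (c * (cos t ^+ 2 - sin t ^+ 2) - d * (2 * sin t * cos t))).
  have ds := is_derive_sin t; have dc := is_derive_cos t.
  have k (r : R) (f : R -> R) e : is_derive t 1 f e -> is_derive t 1 (fun s => r * f s) (r * e).
    move=> df; apply: (is_derive_ext (is_deriveM (is_derive_cst r t 1) df)) => //.
    by rewrite /GRing.scale /= mulr0 addr0.
  have i : is_derive t 1 (fun s : R => s) 1 by exact: is_derive_id.
  apply: (is_derive_ext (is_deriveD (is_deriveD (k A _ _ i)
    (is_deriveD (k a _ _ ds) (k b _ _ dc))) (is_deriveD (k c _ _ (is_deriveM ds dc))
    (k d _ _ (is_deriveM dc dc))))) => //.
  by rewrite /GRing.scale /=; ring.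
have p0 : 0 < 2 * pi :> R by rewrite mulr_gt0 ?pi_gt0.
have cont (f : R -> R) : (forall t : R, {for t, continuous f}) -> {within `[0, 2 * pi], continuous f}.
  by move=> cf; apply: continuous_subspaceT => t; exact: cf.
have cF (t : R) : {for t, continuous F}.
  by apply: differentiable_continuous; apply/derivable1_diffP; have [] := dF t.
rewrite (@continuous_FTC2 _ _ F) //.
- by rewrite -EFinB /F sin2piE cos2piE sin0 cos0; congr EFin; ring.
- apply: cont => t.
  have cs := @continuous_sin R t; have cc := @continuous_cos R t.
  have cC (r : R) : {for t, continuous (fun=> r : R)} by exact: cst_continuous.
  apply: cvgD; first apply: cvgD; first exact: cC.
    by apply: cvgB; apply: cvgM => //; exact: cC.
  apply: cvgB; apply: cvgM; try exact: cC.
    by apply: cvgB; apply: cvgM.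
  by apply: cvgM => //; apply: cvgM => //; exact: cC.
- split; first by move=> t _; have [] := dF t.
    by apply: cvg_at_right_filter; exact: cF.
  by apply: cvg_at_left_filter; exact: cF.
- by move=> t _; rewrite derive1E (@derive_val _ _ _ _ _ _ _ (dF t)).
Qed.

Lemma limf_einf_le (f : R -> \bar R) (F : set_system R) (M : \bar R) : ProperFilter F ->
  (\forall r \near F, (f r <= M)%E) -> (limf_einf f F <= M)%E.
Proof.
move=> PF fM; rewrite /limf_einf /= leeNl limf_esupE; apply: le_ereal_inf_tmp => _ [V FV <-].
have FI : F (V `&` [set r | (f r <= M)%E]) by exact: filterI.
have [r [Vr fr]] := filter_ex FI.
apply: le_trans (_ : (- f r <= _)%E); first by rewrite leeN2.
by apply: ereal_sup_ubound; exists r.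
Qed.

(** Since [g] touches [ln lam] from above at [z], its circle means dominate, and the lower limit
    defining the curvature is at most [4 c]. Curvature at most [- 4] then reads
    [4 lam ^ 2 <= 4 c]. *)
Lemma curvature_at_contact lam g z p c : 0 < lam z -> ln (lam z) = g z ->
  (exists r : R, 0 < r /\ forall h, normc h < r -> ln (lam (z + h)) <= g (z + h)) ->
  expand g z p c -> (gauss_curvature lam z <= (- 4)%:E)%E -> lam z ^+ 2 <= c.
Proof.
move=> l0 lg [r0 [r00 lle]] [q /bigO_ge0[K [r1 [r10 _ K0 hK]]]] curv.
have p0 : 0 < 2 * pi :> R by rewrite mulr_gt0 ?pi_gt0.
have mean (r : R) : 0 < r -> r < r0 -> r < r1 ->
    (circle_mean_ln lam z r <= (g z + c * r ^+ 2 + K * r ^+ 3)%:E)%E.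
  move=> r_gt0 rr0 rr1.
  have nr t : normc (r%:C * (cos t +i* sin t))%C = r.
    rewrite normcMc normc_real gtr0_norm//.
    by rewrite /= cos2Dsin2 sqrtr1 mulr1.
  rewrite /circle_mean_ln lee_pdivrMl// -EFinM.
  rewrite -(@integral_trig _ (r * Re p) (r * Im p) (r ^+ 2 * Re q) (r ^+ 2 * Im q)).
  apply: le_integral_pointwise => t _; rewrite lee_fin.
  set h := (_ * _)%C; have nh : normc h = r by exact: nr.
  apply: le_trans (lle _ _) _; first by rewrite nh.
  have := hK h; rewrite nh normc_real => /(_ rr1) /ler_normlP[_].
  rewrite lerBlDl => hle; apply: le_trans hle _.
  have -> : Re (p * h) = r * Re p * cos t - r * Im p * sin t.
    by rewrite /h !(ReM, ImM, Re_real, Im_real) /=; ring.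
  have -> : Re (q * h ^+ 2) = r ^+ 2 * Re q * (cos t ^+ 2 - sin t ^+ 2) - r ^+ 2 * Im q * (2 * sin t * cos t).
    by rewrite /h expr2 !(ReM, ImM, Re_real, Im_real) /=; ring.
  by rewrite le_eqVlt; apply/orP; left; apply/eqP; ring.
have lim e : 0 < e -> (limf_einf (fun r : R =>
        (4 / r ^+ 2)%:E * (circle_mean_ln lam z r - (ln (lam z))%:E))%E
        (0%R : R)^'+ <= (4 * c + e)%:E)%E.
  move=> e0; apply: limf_einf_le; near=> r.
  have r_gt0 : 0 < r by [].
  have rr0 : r < r0 by near: r; exact: nbhs_right_lt.
  have rr1 : r < r1 by near: r; exact: nbhs_right_lt.
  (* The cubic error contributes [4 K r] after multiplication by [4 / r ^ 2]; this radius keeps it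
     below [e]. *)
  have rK : r < e / (4 * (K + 1)).
    by near: r; apply: nbhs_right_lt; rewrite divr_gt0// mulr_gt0//; lra.
  have K1 : 0 < 4 * (K + 1) by lra.
  rewrite ltr_pdivlMr// in rK.
  have q0 : 0 < 4 / r ^+ 2 by rewrite divr_gt0// exprn_gt0.
  apply: (@le_trans _ _ ((4 / r ^+ 2)%:E * ((g z + c * r ^+ 2 + K * r ^+ 3)%:E - (ln (lam z))%:E))%E).
    by apply: lee_wpmul2l; [rewrite lee_fin ltW|apply: leeB => //; exact: mean].
  rewrite -EFinB -EFinM lee_fin lg.
  have -> : 4 / r ^+ 2 * (g z + c * r ^+ 2 + K * r ^+ 3 - g z) = 4 * c + 4 * K * r.
    by field; rewrite gt_eqF.
  by rewrite lerD2l; nra.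
rewrite /gauss_curvature in curv.
apply/ler_addgt0Pr => e e0.
have := lim _ e0 => h; move: curv; rewrite EFinN leeN2.
move=> k; have l2 : 0 < (lam z ^+ 2)^-1 by rewrite invr_gt0 exprn_gt0.
have : ((4 : R)%:E <= ((lam z ^+ 2)^-1)%:E * (4 * c + e)%:E)%E.
  by apply: le_trans k _; apply: lee_wpmul2l => //; rewrite lee_fin ltW.
rewrite -EFinM lee_fin ler_pdivlMl ?exprn_gt0//; lra.
Unshelve. all: by end_near. Qed.

End CurvatureAtMaximum.

(** * Euler integrals and differentiation under the integral *)

Section ComplexIntegral.
Context {R : realType}.
Implicit Types (F G : R -> R[i]) (f g : R -> R) (w h : R[i]).

Definition cintegrable F :=
  hintegrable (fun s => Re (F s)) /\ hintegrable (fun s => Im (F s)).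

Definition cint F : R[i] :=
  (hint (fun s => Re (F s)) +i* hint (fun s => Im (F s)))%C.

Definition ccontinuous F := forall s : R, 0 < s ->
  {for s, continuous (fun s => Re (F s))} /\ {for s, continuous (fun s => Im (F s))}.

Lemma is_cderive_continuous F : (forall s : R, 0 < s -> exists d, is_cderive s F d) ->
  ccontinuous F.
Proof.
move=> dF s /dF[d [d1 d2]]; split; apply: differentiable_continuous; apply/derivable1_diffP.
  by have [] := d1.
by have [] := d2.
Qed.

Lemma cintegrable_le F g : ccontinuous F ->
  (forall s : R, 0 < s -> normc (F s) <= g s) -> hintegrable g -> cintegrable F.
Proof.
move=> cF Fg hg; split; (apply: hintegrable_le hg; first by apply: hmeasurable => s /cF[]) => s /Fg.
  exact: le_trans (normr_Re_le _).
exact: le_trans (normr_Im_le _).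
Qed.

Lemma eq_cint F G : (forall s : R, 0 < s -> F s = G s) -> cint F = cint G.
Proof.
by move=> FG; apply: complex_ext; apply: eq_hint => s /FG ->.
Qed.

Lemma cintegrableD F G : cintegrable F -> cintegrable G ->
  cintegrable (fun s => F s + G s).
Proof.
move=> [f1 f2] [g1 g2]; split.
  by apply: eq_hintegrable (hintegrableD f1 g1) => s _; rewrite ReD.
by apply: eq_hintegrable (hintegrableD f2 g2) => s _; rewrite ImD.
Qed.

Lemma cintegrableZ w F : cintegrable F -> cintegrable (fun s => w * F s).
Proof.
move=> [f1 f2]; split.
  apply: eq_hintegrable (hintegrableB (hintegrableZ (Re w) f1) (hintegrableZ (Im w) f2)) => s _.
  by rewrite ReM.
apply: eq_hintegrable (hintegrableD (hintegrableZ (Re w) f2) (hintegrableZ (Im w) f1)) => s _.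
by rewrite ImM.
Qed.

Lemma cintD F G : cintegrable F -> cintegrable G ->
  cint (fun s => F s + G s) = cint F + cint G.
Proof.
move=> [f1 f2] [g1 g2]; apply: complex_ext; rewrite ?ReD ?ImD /=.
  by rewrite -hintD//; apply: eq_hint => s _; rewrite ReD.
by rewrite -hintD//; apply: eq_hint => s _; rewrite ImD.
Qed.

Lemma cintZ w F : cintegrable F -> cint (fun s => w * F s) = w * cint F.
Proof.
move=> [f1 f2]; apply: complex_ext; rewrite ?ReM ?ImM /=.
  rewrite -!hintZ// -hintB//; [|exact: hintegrableZ|exact: hintegrableZ].
  by apply: eq_hint => s _; rewrite ReM.
rewrite -!hintZ// -hintD//; [|exact: hintegrableZ|exact: hintegrableZ].
by apply: eq_hint => s _; rewrite ImM.
Qed.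

Lemma cint_real f : cint (fun s => (f s)%:C%C) = (hint f)%:C%C.
Proof.
apply: complex_ext => //=; rewrite /hint (@eq_Rintegral _ _ _ _ _ (cst 0)) ?Rintegral_cst ?mul0r//.
Qed.

Lemma normc_cint_le F g : cintegrable F -> hintegrable g ->
  (forall s : R, 0 < s -> normc (F s) <= g s) -> normc (cint F) <= 2 * hint g.
Proof.
move=> [f1 f2] hg Fg; apply: le_trans (normc_le_ReIm _) _.
rewrite mulr_natl mulr2n; apply: lerD; apply: normr_hint_le => // s /Fg.
  exact: le_trans (normr_Re_le _).
exact: le_trans (normr_Im_le _).
Qed.

(** The substitution [t = s / (1 + s)] in Euler's integral turns [1 - t (1 - w)] into
    [(1 + s w) / (1 + s)]. For [0 < Re w] the base [1 + s w] stays in the right half-plane, where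
    [cpow] is the principal power. *)
Definition ker x y r w s : R[i] :=
  (s `^ (x - 1) * (1 + s) `^ y)%:C%C * cpow (- r) (1 + s%:C%C * w).

Definition Jint x y r w := cint (ker x y r w).

Lemma Re_1D w s : Re (1 + s%:C%C * w) = 1 + s * Re w.
Proof. by rewrite ReD ReZ. Qed.

Lemma Re_1D_gt0 w s : 0 < Re w -> 0 < s -> 0 < Re (1 + s%:C%C * w).
Proof. by move=> w0 s0; rewrite Re_1D ltr_pwDl// mulr_ge0// ltW. Qed.

Lemma is_cderive_ker x y r w s : 0 < Re w -> 0 < s ->
  is_cderive s (ker x y r w)
    (((x - 1) * s `^ (x - 1 - 1) * (1 + s) `^ y + y * s `^ (x - 1) * (1 + s) `^ (y - 1))%:C%C
      * cpow (- r) (1 + s%:C%C * w)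
   + (s `^ (x - 1) * (1 + s) `^ y)%:C%C * ((- r)%:C%C * w * cpow (- r - 1) (1 + s%:C%C * w))).
Proof.
move=> w0 s0; apply: (is_cderive_ext (is_cderiveM _ (is_cderive_cpow (- r) (Re_1D_gt0 w0 s0)))) => //.
by split; [exact: is_derive_pow_kernel|exact: is_derive_cst].
Qed.

Lemma ccontinuous_ker x y r w : 0 < Re w -> ccontinuous (ker x y r w).
Proof.
move=> w0; apply: is_cderive_continuous => s s0.
by eexists; exact: is_cderive_ker.
Qed.

Lemma min1_gt0 (m : R) : 0 < m -> 0 < Num.min 1 m.
Proof. by move=> m0; rewrite lt_min ltr01. Qed.

Lemma min1_le (m s : R) : 0 < s -> Num.min 1 m * (1 + s) <= 1 + s * m.
Proof.
move=> s0; rewrite mulrDr mulr1; apply: lerD; first by rewrite ge_min lexx.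
by rewrite mulrC ler_pM2l// ge_min lexx orbT.
Qed.

(** The minimum comes from [Re (1 + s w) = 1 + s Re w >= min (1, Re w) (1 + s)]. *)
Lemma normc_ker_le x y r w s : 0 <= r -> 0 < Re w -> 0 < s ->
  normc (ker x y r w s) <=
  Num.min 1 (Re w) `^ (- r) * (s `^ (x - 1) * (1 + s) `^ (y - r)).
Proof.
move=> r0 w0 s0; have s1 : 0 < 1 + s by lra.
have m0 := min1_gt0 w0.
rewrite normcMc normc_real ger0_norm ?mulr_ge0 ?powR_ge0//.
rewrite (powRDp y (- r) s1) [leRHS](_ : _ = (s `^ (x - 1) * (1 + s) `^ y) *
  (Num.min 1 (Re w) `^ (- r) * (1 + s) `^ (- r))); last by ring.
rewrite ler_wpM2l ?mulr_ge0 ?powR_ge0//.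
rewrite -powRM ?(ltW m0) ?(ltW s1)//; apply: normc_cpowN_le; rewrite ?mulr_gt0//.
by rewrite Re_1D min1_le.
Qed.

Lemma cintegrable_ker x y r w : 0 < x -> x + y - r < 0 -> 0 <= r -> 0 < Re w ->
  cintegrable (ker x y r w).
Proof.
move=> x0 xyr r0 w0; apply: (cintegrable_le (ccontinuous_ker _ _ _ w0)).
  by move=> s s0; exact: normc_ker_le.
by apply: hintegrableZ; apply: hintegrable_pow => //; lra.
Qed.

(** The integrand is expanded by Taylor's formula and the remainder integrated. For [|h| < Re w / 2]
    the real part of the base stays above [m (1 + s)] on the whole segment, so the remainder is at
    most a constant times [|h| ^ 3 s ^ (x + 2) (1 + s) ^ (y - r - 3)], again an integrable
    kernel. *)
Lemma cdiff_Jint x y r w : 0 < x -> x + y - r < 0 -> 0 <= r -> 0 < Re w ->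
  cdiff (Jint x y r) w ((- r)%:C%C * Jint (x + 1) y (r + 1) w).
Proof.
move=> x0 xyr r0 w0; exists ((r * (r + 1) / 2)%:C%C * Jint (x + 2) y (r + 2) w).
have w20 : 0 < Re w / 2 by rewrite divr_gt0.
set m := Num.min 1 (Re w / 2); have m0 : 0 < m by exact: min1_gt0.
pose C := 8 * r * (r + 1) * (r + 2) * m `^ (- r - 3).
have i1 : cintegrable (ker x y r w) by exact: cintegrable_ker.
have i2 : cintegrable (ker (x + 1) y (r + 1) w) by apply: cintegrable_ker => //; lra.
have i3 : cintegrable (ker (x + 2) y (r + 2) w) by apply: cintegrable_ker => //; lra.
have hg : hintegrable (fun s => s `^ (x + 3 - 1) * (1 + s) `^ (y - r - 3)).
  by apply: hintegrable_pow; lra.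
exists (2 * (C * hint (fun s => s `^ (x + 3 - 1) * (1 + s) `^ (y - r - 3)))), (Re w / 2).
split=> // h hw.
have rh : - (Re w / 2) <= Re h.
  by have := le_lt_trans (normr_Re_le h) hw; rewrite ltr_norml => /andP[/ltW].
have wh0 : 0 < Re (w + h) by rewrite ReD; lra.
have i0 : cintegrable (ker x y r (w + h)) by exact: cintegrable_ker.
pose P s := ker x y r w s + ((- r)%:C%C * h * ker (x + 1) y (r + 1) w s +
   (r * (r + 1) / 2)%:C%C * h ^+ 2 * ker (x + 2) y (r + 2) w s).
have iP : cintegrable P.
  by apply: cintegrableD => //; apply: cintegrableD; exact: cintegrableZ.
have iD : cintegrable (fun s => ker x y r (w + h) s + (-1) * P s).
  by apply: cintegrableD => //; exact: cintegrableZ.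
have -> : Jint x y r (w + h) - (Jint x y r w + (- r)%:C%C * Jint (x + 1) y (r + 1) w * h +
    (r * (r + 1) / 2)%:C%C * Jint (x + 2) y (r + 2) w * h ^+ 2) =
    cint (fun s => ker x y r (w + h) s + (-1) * P s).
  rewrite cintD//; last exact: cintegrableZ.
  rewrite cintZ// /P cintD//; last by apply: cintegrableD; exact: cintegrableZ.
  rewrite cintD; [|exact: cintegrableZ|exact: cintegrableZ].
  rewrite !cintZ// -/(Jint _ _ _ _) -/(Jint _ _ _ _) -/(Jint _ _ _ _) -/(Jint _ _ _ _); ring.
have hg2 : hintegrable (fun s => (C * normc h ^+ 3) * (s `^ (x + 3 - 1) * (1 + s) `^ (y - r - 3))).
  exact: hintegrableZ.
have := normc_cint_le iD hg2 _.
rewrite hintZ// => hle; apply: le_trans (hle _) _; last first.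
  by rewrite le_eqVlt; apply/orP; left; apply/eqP; ring.
move=> s s0; have s1 : 0 < 1 + s by lra.
set q := 1 + s%:C%C * w.
have mq t : 0 <= t <= 1 -> m * (1 + s) <= Re (q + t%:C%C * (s%:C%C * h)).
  move=> /andP[t0 t1]; apply: le_trans (min1_le _ s0) _.
  rewrite ReD Re_1D !ReZ -addrA lerD2l.
  have : t * (s * - (Re w / 2)) <= t * (s * Re h).
    by rewrite ler_wpM2l// ler_pM2l.
  have : t * (s * (Re w / 2)) <= s * (Re w / 2) by rewrite ler_piMl// mulr_ge0 ?ltW.
  lra.
have tay := cpowN_taylor3 (mulr_gt0 m0 s1) mq r0.
have e1 : s `^ (x + 1 - 1) = s `^ (x - 1) * s by rewrite -powRS// addrAC.
have e2 : s `^ (x + 2 - 1) = s `^ (x - 1) * s * s by rewrite -!powRS//; congr (_ `^ _); ring.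
have e3 : s `^ (x + 3 - 1) = s `^ (x - 1) * s * s * s by rewrite -!powRS//; congr (_ `^ _); ring.
have -> : ker x y r (w + h) s + -1 * P s = (s `^ (x - 1) * (1 + s) `^ y)%:C%C *
   (cpow (- r) (q + s%:C%C * h) - (cpow (- r) q - r%:C%C * (s%:C%C * h) * cpow (- r - 1) q +
    (r * (r + 1) / 2)%:C%C * (s%:C%C * h) ^+ 2 * cpow (- r - 2) q)).
  rewrite /P /ker e1 e2 !rmorphM !rmorphN.
  have -> : 1 + s%:C%C * (w + h) = q + s%:C%C * h by rewrite /q; ring.
  have -> : - (r + 1) = - r - 1 by ring.
  have -> : - (r + 2) = - r - 2 by ring.
  rewrite -/q; ring.
rewrite normcMc normc_real ger0_norm ?mulr_ge0 ?powR_ge0//.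
apply: le_trans (ler_wpM2l _ tay) _; first by rewrite mulr_ge0 ?powR_ge0.
rewrite normcMc normc_real gtr0_norm// powRM ?(ltW m0) ?(ltW s1)// e3.
have -> : (1 + s) `^ (y - r - 3) = (1 + s) `^ y * (1 + s) `^ (- r - 3).
  by rewrite -powRDp//; congr (_ `^ _); ring.
by rewrite /C le_eqVlt; apply/orP; left; apply/eqP; ring.
Qed.

End ComplexIntegral.

(** * The hypergeometric equation and decay of its solutions *)

Section Hypergeometric.
Context {R : realType}.
Implicit Types (w z : R[i]) (s t x : R).

Lemma cint_derive0 (F F' : R -> R[i]) (g : R -> R) :
  (forall s : R, 0 < s -> is_cderive s F (F' s)) -> ccontinuous F' -> cintegrable F' ->
  (forall s : R, 0 < s -> normc (F s) <= g s) ->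
  g s @[s --> 0^'+] --> (0 : R) -> g s @[s --> +oo] --> (0 : R) -> cint F' = 0.
Proof.
move=> dF cF [i1 i2] Fg g0 g1.
have main (u u' : R -> R) : (forall s : R, 0 < s -> is_derive s 1 u (u' s)) ->
    (forall s : R, 0 < s -> {for s, continuous u'}) -> hintegrable u' ->
    (forall s : R, 0 < s -> `|u s| <= g s) -> hint u' = 0.
  move=> du cu iu ug; rewrite (hint_derive du cu (L0 := 0) (L1 := 0)) ?subrr//.
    have gN : (- g s) @[s --> 0^'+] --> (0 : R) by have h := cvgN g0; rewrite oppr0 in h; exact: h.
    apply: (squeeze_cvgr _ gN g0); near=> s.
    by rewrite -ler_norml; apply: ug.
  have gN : (- g s) @[s --> +oo] --> (0 : R) by have h := cvgN g1; rewrite oppr0 in h; exact: h.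
  apply: (squeeze_cvgr _ gN g1); near=> s.
  by rewrite -ler_norml; apply: ug; near: s; apply: nbhs_pinfty_gt; rewrite num_real.
apply: complex_ext => /=.
- apply: (main (fun s => Re (F s))) => // s s0; first by have [] := dF s s0.
    by have [] := cF s s0.
  exact: le_trans (normr_Re_le _) (Fg s s0).
- apply: (main (fun s => Im (F s))) => // s s0; first by have [] := dF s s0.
    by have [] := cF s s0.
  exact: le_trans (normr_Im_le _) (Fg s s0).
Unshelve. all: by end_near. Qed.

Variables (A B C : R).
Hypotheses (A0 : 0 < A) (B0 : 0 < B) (BC : B < C).

(* Proportional to the hypergeometric function F(A, B; A + B + 1 - C; w), in the form
   F(A, B; C; 1 - w); Euler's integral converges for [0 < B < C]. *)
Definition hyp w := Jint B (A - C) A w.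
Definition dhyp w := (- A)%:C%C * Jint (B + 1) (A - C) (A + 1) w.
Definition ddhyp w := (A * (A + 1))%:C%C * Jint (B + 2) (A - C) (A + 2) w.

Lemma cdiff_hyp w : 0 < Re w -> cdiff hyp w (dhyp w).
Proof. by move=> w0; apply: cdiff_Jint => //; move: A0 B0 BC; lra. Qed.

Lemma cdiff_dhyp w : 0 < Re w -> cdiff dhyp w (ddhyp w).
Proof.
move=> w0; have -> : ddhyp w = (- A)%:C%C * ((- (A + 1))%:C%C * Jint (B + 1 + 1) (A - C) (A + 1 + 1) w).
  have e : (A * (A + 1))%:C%C = (- A)%:C%C * (- (A + 1))%:C%C :> R[i] by rewrite -rmorphM mulrNN.
  have eB : B + 1 + 1 = B + 2 by ring.
  have eA : A + 1 + 1 = A + 2 by ring.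
  by rewrite /ddhyp eB eA e mulrA.
by apply: cdiffZ; apply: cdiff_Jint => //; move: A0 B0 BC; lra.
Qed.

(** Under the integral sign the left-hand side is the exact derivative of [- A s ^ B (1 + s) ^ (A -
    C + 1) (1 + s w) ^ (- A - 1)], which vanishes at both ends because [0 < B < C]. *)
Lemma hyp_ode w : 0 < Re w ->
  w * (1 - w) * ddhyp w + ((A + B + 1 - C)%:C%C - (A + B + 1)%:C%C * w) * dhyp w
    - (A * B)%:C%C * hyp w = 0.
Proof.
move=> w0.
have i1 : cintegrable (ker B (A - C) A w) by apply: cintegrable_ker => //; move: A0 B0 BC; lra.
have i2 : cintegrable (ker (B + 1) (A - C) (A + 1) w).
  by apply: cintegrable_ker => //; move: A0 B0 BC; lra.
have i3 : cintegrable (ker (B + 2) (A - C) (A + 2) w).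
  by apply: cintegrable_ker => //; move: A0 B0 BC; lra.
set k1 := - (A * B)%:C%C.
set k2 := ((A + B + 1 - C)%:C%C - (A + B + 1)%:C%C * w) * (- A)%:C%C.
set k3 := w * (1 - w) * (A * (A + 1))%:C%C.
pose F' s := k1 * ker B (A - C) A w s + (k2 * ker (B + 1) (A - C) (A + 1) w s +
   k3 * ker (B + 2) (A - C) (A + 2) w s).
have iF' : cintegrable F' by apply: cintegrableD; [exact: cintegrableZ|apply: cintegrableD; exact: cintegrableZ].
have <- : cint F' = 0; last first.
  rewrite cintD; [|exact: cintegrableZ|by apply: cintegrableD; exact: cintegrableZ].
  rewrite cintD; [|exact: cintegrableZ|exact: cintegrableZ].
  rewrite !cintZ// /hyp /dhyp /ddhyp /Jint /k1 /k2 /k3; ring.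
pose m := Num.min 1 (Re w) `^ (- (A + 1)).
apply: (@cint_derive0 (fun s => (- A)%:C%C * ker (B + 1) (A - C + 1) (A + 1) w s) F'
  (fun s => A * m * (s `^ B * (1 + s) `^ (- C)))).
- move=> s s0; have s1 : 0 < 1 + s by lra.
  have := is_cderiveM (is_cderive_cst (- A)%:C%C s) (is_cderive_ker (B + 1) (A - C + 1) (A + 1) w0 s0).
  move=> h; apply: (is_cderive_ext h) => //.
  rewrite mul0r add0r /F' /ker.
  have -> : B + 1 - 1 - 1 = B - 1 by ring.
  have -> : A - C + 1 - 1 = A - C by ring.
  have -> : B + 1 - 1 = B - 1 + 1 by ring.
  have -> : B + 2 - 1 = B - 1 + 1 + 1 by ring.
  rewrite !(powRS _ s0) !(powRS _ s1).
  set q := 1 + s%:C%C * w; have q0 : 0 < Re q by exact: Re_1D_gt0.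
  have n1 : - (A + 1) = - (A + 2) + 1 by ring.
  have n0 : - A = - (A + 2) + 1 + 1 by ring.
  have e1 : cpow (- (A + 1)) q = cpow (- (A + 2)) q * q by rewrite n1 (cpowS _ q0).
  have e0 : cpow (- A) q = cpow (- (A + 2)) q * q * q by rewrite n0 !(cpowS _ q0).
  have -> : - (A + 1) - 1 = - (A + 2) by ring.
  rewrite e0 e1 /k1 /k2 /k3.
  move: (cpow _ _) (s `^ _) ((1 + s) `^ _) => P a e.
  rewrite !(rmorphM, rmorphD, rmorphB, rmorphN) /q rmorph1; ring.
- have cz k (G : R -> R[i]) : (forall s : R, 0 < s -> exists d, is_cderive s G d) ->
     (forall s : R, 0 < s -> exists d, is_cderive s (fun s => k * G s) d).
    by move=> dG s /dG[d dGd]; eexists; exact: (is_cderiveM (is_cderive_cst k s) dGd).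
  have ck x y r : forall s : R, 0 < s -> exists d, is_cderive s (ker x y r w) d.
    by move=> s s0; eexists; exact: is_cderive_ker.
  apply: is_cderive_continuous => s s0.
  have [d1 h1] := cz k1 _ (ck B (A - C) A) s s0.
  have [d2 h2] := cz k2 _ (ck (B + 1) (A - C) (A + 1)) s s0.
  have [d3 h3] := cz k3 _ (ck (B + 2) (A - C) (A + 2)) s s0.
  by eexists; exact: (is_cderiveD h1 (is_cderiveD h2 h3)).
- exact: iF'.
- move=> s s0; rewrite normcMc normc_real normrN (gtr0_norm A0).
  rewrite -mulrA ler_pM2l//.
  have r0 : 0 <= A + 1 by move: A0; lra.
  apply: le_trans (normc_ker_le _ _ r0 w0 s0) _.
  rewrite /m ler_wpM2l ?powR_ge0// le_eqVlt; apply/orP; left; apply/eqP.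
  by congr (_ `^ _ * _ `^ _); ring.
- have h : A * m * (s `^ B * 1) @[s --> (0 : R)^'+] --> A * m * (0 * 1).
    by apply: cvgM; [exact: cvg_cst|apply: cvgM; [exact: powR_cvg0|exact: cvg_cst]].
  rewrite mul0r mulr0 in h; apply: (squeeze_cvgr _ (cvg_cst 0) h).
  have m0 : 0 <= A * m by rewrite mulr_ge0 ?powR_ge0// ltW.
  near=> s; apply/andP; split; first exact: mulr_ge0 m0 (mulr_ge0 (powR_ge0 _ _) (powR_ge0 _ _)).
  apply: ler_wpM2l m0 _ _ _; apply: ler_wpM2l (powR_ge0 _ _) _ _ _.
  have s1 : 1 <= 1 + s by rewrite lerDl.
  by rewrite -[leRHS](powRr0 (1 + s)); apply: ler_powR => //; move: B0 BC; lra.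
- have h : A * m * s `^ (B - C) @[s --> +oo] --> A * m * (0 : R).
    by apply: cvgM; [exact: cvg_cst|apply: powR_cvgy; move: BC; lra].
  rewrite mulr0 in h; apply: (squeeze_cvgr _ (cvg_cst 0) h).
  have m0 : 0 <= A * m by rewrite mulr_ge0 ?powR_ge0// ltW.
  near=> s; have s0 : 0 < s by near: s; apply: nbhs_pinfty_gt; rewrite num_real.
  apply/andP; split; first exact: mulr_ge0 m0 (mulr_ge0 (powR_ge0 _ _) (powR_ge0 _ _)).
  apply: ler_wpM2l m0 _ _ _; rewrite (powRDp B (- C) s0); apply: ler_wpM2l (powR_ge0 _ _) _ _ _.
  rewrite !powRN lef_pV2 ?posrE ?powR_gt0//; last by lra.
  by apply: ge0_ler_powR; rewrite ?nnegrE; move: B0 BC; lra.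
Unshelve. all: by end_near. Qed.

(** For [0 < Re w] one has [|1 + s w| >= 1] and [|1 + s w| >= s |w|], so
    [|1 + s w| ^ (- A) <= (s |w|) ^ (- sg)]. The last two conditions on [sg] make the remaining
    kernel integrable at 0 and at infinity. *)
Lemma normc_hyp_le sg : 0 <= sg -> sg <= A -> 0 < B - sg -> A + (B - sg) - C < 0 ->
  exists2 K : R, 0 <= K & forall w, 0 < Re w -> normc (hyp w) <= K * normc w `^ (- sg).
Proof.
move=> sg0 sgA Bs cond.
pose g s := s `^ (B - sg - 1) * (1 + s) `^ (A - C).
have hg : hintegrable g by apply: hintegrable_pow => //; lra.
have g0 : 0 <= hint g.
  by apply: Rintegral_ge0 => s _; rewrite mulr_ge0 ?powR_ge0.
exists (2 * hint g); first by rewrite mulr_ge0.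
move=> w w0; have wn : 0 < normc w by rewrite normc_gt0 Re_gt0_neq0.
have i1 : cintegrable (ker B (A - C) A w) by apply: cintegrable_ker => //; move: A0 B0 BC; lra.
have := normc_cint_le i1 (hintegrableZ (normc w `^ (- sg)) hg) _.
rewrite hintZ// => h; rewrite -mulrA [_ * _ `^ _]mulrC; apply: h => s s0.
rewrite /ker normcMc normc_real ger0_norm ?mulr_ge0 ?powR_ge0// /g.
set q := 1 + s%:C%C * w; have q0 : 0 < Re q by exact: Re_1D_gt0.
rewrite normc_cpow ?Re_gt0_neq0//.
have q1 : 1 <= normc q.
  by apply: le_trans (Re_le_normc _); rewrite Re_1D lerDl mulr_ge0// ltW.
have qs : normc w * s <= normc q.
  rewrite -(@ler_pXn2r _ 2) ?nnegrE ?mulr_ge0 ?normc_ge0 ?(ltW s0)//.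
  rewrite exprMn !sqr_normcE /q !(ReD, ImD, ReM, ImM, Re_real, Im_real) /=.
  rewrite -subr_ge0 [X in 0 <= X](_ : _ = 1 + 2 * (s * Re w)); last by ring.
  by rewrite addr_ge0// mulr_ge0// mulr_ge0// ltW.
have -> : B - 1 = B - sg - 1 + sg by ring.
rewrite powRDp// [leRHS](_ : _ = s `^ (B - sg - 1) * (1 + s) `^ (A - C) * normc w `^ (- sg)); last by ring.
rewrite [leLHS](_ : _ = s `^ (B - sg - 1) * (1 + s) `^ (A - C) * (s `^ sg * normc q `^ (- A))); last by ring.
rewrite ler_wpM2l ?mulr_ge0 ?powR_ge0//.
apply: (@le_trans _ _ (s `^ sg * normc q `^ (- sg))).
  by rewrite ler_wpM2l ?powR_ge0//; apply: ler_powR; rewrite ?lerN2.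
have qp : 0 < normc q by exact: lt_le_trans q1.
rewrite !powRN ler_pdivrMr ?powR_gt0// mulrC ler_pdivlMr ?powR_gt0//.
rewrite -powRM ?(ltW s0) ?(ltW wn)//.
apply: ge0_ler_powR; rewrite ?nnegrE ?mulr_ge0 ?normc_ge0 ?(ltW s0) ?(ltW wn)//.
by rewrite mulrC.
Qed.

End Hypergeometric.

(** * Euler integrals at the endpoints 0 and 1 *)

Section HypergeometricLimits.
Context {R : realType}.
Implicit Types (w z : R[i]) (s t x y r X : R).

Definition Jreal x y r X :=
  hint (fun s => s `^ (x - 1) * (1 + s) `^ y * (1 + s * X) `^ (- r)).

Lemma Jint_real x y r X : 0 < X -> Jint x y r X%:C%C = (Jreal x y r X)%:C%C.
Proof.
move=> X0; rewrite -cint_real; apply: eq_cint => s s0; rewrite /ker.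
have -> : 1 + s%:C%C * X%:C%C = (1 + s * X)%:C%C :> R[i].
  by rewrite rmorphD rmorphM rmorph1.
by rewrite cpow_real -?rmorphM// addr_gt0// mulr_gt0.
Qed.

Lemma hint_scale (c : R) (f : R -> R) : 0 < c -> (forall s, 0 < s -> 0 <= f s) ->
  (forall s, 0 < s -> {for s, continuous f}) -> hint f = hint (fun s => c * f (c * s)).
Proof. by move=> c0 f0 cf; rewrite /hint /Rintegral (integral_scale c0 f0 cf). Qed.

(** Starts at [1 / 2], so that the sequence and its reflection [1 - xn n] both stay in []0, 1[].
    Limits along it suffice to evaluate a Wronskian already known to be constant. *)
Definition vanishing_seq (n : nat) : R := n.+2%:R^-1.
Local Notation xn := vanishing_seq.

Lemma vanishing_seq_gt0 n : 0 < xn n.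
Proof. by rewrite invr_gt0 ltr0n. Qed.

Lemma vanishing_seq_lt1 n : xn n < 1.
Proof. by rewrite invf_lt1 ?ltr0n// ltr1n. Qed.

Lemma cvg_vanishing_seq : xn n @[n --> \oo] --> (0 : R).
Proof. by have := @cvg_harmonic R; rewrite -(cvg_shiftS (@harmonic R)). Qed.

Lemma continuous_add_mul_powR (u v t r : R) : 0 < v + u * t ->
  {for t, continuous (fun s => (v + u * s) `^ r)}.
Proof.
move=> p; apply: (@continuous_comp _ _ _ (fun s : R => v + u * s) (@powR R ^~ r)).
  by apply: cvgD; [exact: cvg_cst|apply: cvgM; [exact: cvg_cst|exact: cvg_id]].
exact: continuous_powR_pos.
Qed.

Lemma cvg_seq_comp (f : R -> R) (u : nat -> R) (l : R) : {for l, continuous f} ->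
  u n @[n --> \oo] --> l -> f (u n) @[n --> \oo] --> f l.
Proof. by move=> cf ul; apply: (@cvg_comp _ _ _ u f _ _ _ ul cf). Qed.

Lemma hmeasurable_Jreal x y r X : 0 <= X ->
  measurable_fun (`]0, +oo[ : set R)
    (fun s => s `^ (x - 1) * (1 + s) `^ y * (1 + s * X) `^ (- r)).
Proof.
move=> X0; apply: hmeasurable => s s0; apply: cvgM; first exact: continuous_pow_kernel.
have p : 0 < 1 + X * s by rewrite ltr_pwDl// mulr_ge0// ltW.
have := continuous_add_mul_powR (r := - r) p.
by rewrite (_ : (fun s => (1 + X * s) `^ _) = (fun s => (1 + s * X) `^ (- r)))//; apply/funext => t; rewrite mulrC.
Qed.

(** The factor [(1 + s X) ^ (- r)] is at most 1 and tends to 1; what is left is integrable because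
    [x + y < 0]. *)
Lemma Jreal_cvg0 x y r : 0 < x -> x + y < 0 -> 0 <= r ->
  Jreal x y r (xn n) @[n --> \oo] --> Betaf x (- (x + y)).
Proof.
move=> x0 xy r0; apply: (hint_dominated_convergence (g := fun s => s `^ (x - 1) * (1 + s) `^ y)).
- by move=> n; apply: hmeasurable_Jreal; rewrite ltW// vanishing_seq_gt0.
- by apply: hmeasurable => s s0; exact: continuous_pow_kernel.
- move=> s s0; have -> : - (x + - (x + y)) = y by ring.
  have p : 0 < 1 + s * 0 by rewrite mulr0 addr0.
  have := cvg_seq_comp (continuous_add_mul_powR (r := - r) p) cvg_vanishing_seq.
  rewrite mulr0 addr0 powR1 => h.
  rewrite -[X in _ --> X]mulr1; apply: cvgM; [exact: cvg_cst|exact: h].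
- move=> n s s0; have xp := vanishing_seq_gt0 n.
  rewrite ger0_norm ?mulr_ge0 ?powR_ge0// ler_piMr ?mulr_ge0 ?powR_ge0//.
  rewrite -[leRHS](powRr0 (1 + s * xn n)); apply: ler_powR; last by rewrite oppr_le0.
  by rewrite lerDl mulr_ge0// ltW.
- exact: hintegrable_pow.
Qed.

(** For [x + y > 0] the limit kernel is no longer integrable at infinity. The substitution
    [s = t / X] extracts [X ^ (- (x + y))], and the remaining [(X + t) ^ y] is dominated by [t ^ y]
    since [y <= 0]. *)
Lemma Jreal_scale_cvg0 x y r : 0 <= - y -> 0 < x + y -> x + y < r -> 0 < x ->
  xn n `^ (x + y) * Jreal x y r (xn n) @[n --> \oo] --> Betaf (x + y) (r - (x + y)).
Proof.
move=> y0 xy xyr x0.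
have scaled n : xn n `^ (x + y) * Jreal x y r (xn n) =
    hint (fun t => t `^ (x - 1) * (xn n + t) `^ y * (1 + t) `^ (- r)).
  set X := xn n; have X0 : 0 < X by exact: vanishing_seq_gt0.
  have Xi : 0 < X^-1 by rewrite invr_gt0.
  have X0' : 0 < Re (X%:C%C : R[i]) by [].
  have r0 : 0 <= r by lra.
  have xyr' : x + y - r < 0 by lra.
  have [hi _] := cintegrable_ker x0 xyr' r0 X0'.
  have {}hi : hintegrable (fun s => s `^ (x - 1) * (1 + s) `^ y * (1 + s * X) `^ (- r)).
    apply: eq_hintegrable hi => s s0; rewrite /ker.
    have -> : 1 + s%:C%C * X%:C%C = (1 + s * X)%:C%C :> R[i].
      by rewrite rmorphD rmorphM rmorph1.
    by rewrite cpow_real -?rmorphM// addr_gt0// mulr_gt0.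
  rewrite /Jreal -hintZ// (hint_scale Xi); last 2 first.
  - by move=> s _; rewrite !mulr_ge0 ?powR_ge0.
  - move=> s s0; apply: cvgM; first exact: cvg_cst.
    apply: cvgM; first exact: continuous_pow_kernel.
    have p : 0 < 1 + X * s by rewrite ltr_pwDl// mulr_ge0// ltW.
    have := continuous_add_mul_powR (r := - r) p.
    by rewrite (_ : (fun s => (1 + X * s) `^ _) = (fun s => (1 + s * X) `^ (- r)))//; apply/funext => t; rewrite mulrC.
  apply: eq_hint => s s0.
  have -> : 1 + X^-1 * s * X = 1 + s by field; rewrite gt_eqF.
  have -> : 1 + X^-1 * s = X^-1 * (X + s) by field; rewrite gt_eqF.
  have Xs : 0 <= X + s by rewrite addr_ge0 ?ltW.
  rewrite (powRM (x - 1) (ltW Xi) (ltW s0)) (powRM y (ltW Xi) Xs).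
  have e : X `^ (x + y) * (X^-1 * X^-1 `^ (x - 1) * X^-1 `^ y) = 1.
    rewrite (mulr_powRB1 (ltW Xi) x0) -(powRDp _ _ Xi) -(powRM _ (ltW X0) (ltW Xi)).
    by rewrite divff ?gt_eqF// powR1.
  transitivity (X `^ (x + y) * (X^-1 * X^-1 `^ (x - 1) * X^-1 `^ y) *
    (s `^ (x - 1) * (X + s) `^ y * (1 + s) `^ (- r))); first by ring.
  by rewrite e mul1r.
have -> : (fun n => xn n `^ (x + y) * Jreal x y r (xn n)) =
    (fun n => hint (fun t => t `^ (x - 1) * (xn n + t) `^ y * (1 + t) `^ (- r))).
  exact/funext.
apply: (hint_dominated_convergence (g := fun s => s `^ (x + y - 1) * (1 + s) `^ (- r))).
- move=> n; apply: hmeasurable => s s0; apply: cvgM; last first.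
    have p : 0 < 1 + 1 * s by rewrite mul1r addr_gt0.
    have := continuous_add_mul_powR (r := - r) p.
    by rewrite (_ : (fun s => (1 + 1 * s) `^ _) = (fun s => (1 + s) `^ (- r)))//; apply/funext => t; rewrite mul1r.
  apply: cvgM; first exact: continuous_powR_pos.
  have p : 0 < xn n + 1 * s by rewrite mul1r addr_gt0// vanishing_seq_gt0.
  have := continuous_add_mul_powR (r := y) p.
  by rewrite (_ : (fun s => (xn n + 1 * s) `^ _) = (fun s => (xn n + s) `^ y))//; apply/funext => t; rewrite mul1r.
- by apply: hmeasurable => s s0; exact: continuous_pow_kernel.
- move=> s s0; have -> : - (x + y + (r - (x + y))) = - r by ring.
  apply: cvgM; last exact: cvg_cst.
  have -> : s `^ (x + y - 1) = s `^ (x - 1) * s `^ y by rewrite -powRDp//; congr (_ `^ _); ring.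
  apply: cvgM; first exact: cvg_cst.
  have p : 0 < s + 1 * 0 by rewrite mulr0 addr0.
  have := cvg_seq_comp (continuous_add_mul_powR (r := y) p) cvg_vanishing_seq.
  rewrite mulr0 addr0.
  by rewrite (_ : (fun n => (s + 1 * xn n) `^ y) = (fun n => (xn n + s) `^ y))//; apply/funext => t; rewrite mul1r addrC.
- move=> n s s0; have xp := vanishing_seq_gt0 n.
  rewrite ger0_norm ?mulr_ge0 ?powR_ge0// ler_wpM2r ?powR_ge0//.
  have -> : s `^ (x + y - 1) = s `^ (x - 1) * s `^ y by rewrite -powRDp//; congr (_ `^ _); ring.
  rewrite ler_wpM2l ?powR_ge0//.
  have -> u : u `^ y = (u `^ (- y))^-1 by rewrite -powRN opprK.
  have -> : s `^ y = (s `^ (- y))^-1 by rewrite -powRN opprK.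
  rewrite lef_pV2 ?posrE ?powR_gt0 ?addr_gt0//.
  by apply: (ge0_ler_powR y0); rewrite ?nnegrE; lra.
- by apply: hintegrable_pow => //; lra.
Qed.

Lemma Jreal1 x y r : Jreal x y r 1 = Betaf x (r - x - y).
Proof.
apply: eq_hint => s s0; rewrite mulr1 -mulrA -powRDp ?addr_gt0//.
by congr (_ * _ `^ _); ring.
Qed.

Lemma Jreal_cvg1 x y r : 0 < x -> x + y - r < 0 -> 0 <= r ->
  Jreal x y r (1 - xn n) @[n --> \oo] --> Jreal x y r 1.
Proof.
move=> x0 xyr r0.
have r1 : 0 < Re (1%:C%C + 0%:C%C * 1%:C%C : R[i]) by rewrite ReD ReZ /= mul0r addr0.
have [d1 _] := cdiff_is_cderive (cdiff_Jint x0 xyr r0 r1).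
have cf : {for (0 : R), continuous (fun s => Re (Jint x y r (1%:C%C + s%:C%C * 1%:C%C)))}.
  by apply: differentiable_continuous; apply/derivable1_diffP; have [] := d1.
have nx : - xn n @[n --> \oo] --> (0 : R) by rewrite -[X in _ --> X]oppr0; apply: cvgN; exact: cvg_vanishing_seq.
have := cvg_seq_comp cf nx.
have e (X : R) : 0 < 1 + X -> Re (Jint x y r (1%:C%C + X%:C%C * 1%:C%C)) = Jreal x y r (1 + X).
  by move=> X0; rewrite mulr1 -rmorphD Jint_real.
rewrite e ?addr0//; apply: cvg_trans; apply: near_eq_cvg; apply: nearW => n.
by rewrite e// subr_gt0 vanishing_seq_lt1.
Qed.

End HypergeometricLimits.

(** * Expansions of complex powers of exponent at most 1 *)

Section ComplexPowerExpansion.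
Context {R : realType}.
Implicit Types (w z h : R[i]) (r : R).

Lemma cpow_shift r s w : 0 < Re w -> s = r + 1 -> cpow s w = cpow r w * w.
Proof. by move=> w0 ->; exact: cpowS. Qed.

Lemma cdiff_cpowN r w : 0 <= r -> 0 < Re w ->
  cdiff (cpow (- r)) w ((- r)%:C%C * cpow (- r - 1) w).
Proof.
move=> r0 w0; exists ((r * (r + 1) / 2)%:C%C * cpow (- r - 2) w).
have m0 : 0 < Re w / 2 by rewrite divr_gt0.
exists (8 * r * (r + 1) * (r + 2) * (Re w / 2) `^ (- r - 3)), (Re w / 2); split=> // h hw.
have rh : - (Re w / 2) <= Re h.
  by have := le_lt_trans (normr_Re_le h) hw; rewrite ltr_norml => /andP[/ltW].
have mq t : 0 <= t <= 1 -> Re w / 2 <= Re (w + t%:C%C * h).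
  move=> /andP[t0 t1]; rewrite ReD ReZ.
  have : t * - (Re w / 2) <= t * Re h by rewrite ler_wpM2l.
  have : t * (Re w / 2) <= Re w / 2 by rewrite ler_piMl// ltW.
  lra.
have := cpowN_taylor3 m0 mq r0.
rewrite [leRHS](_ : _ = 8 * r * (r + 1) * (r + 2) * (Re w / 2) `^ (- r - 3) * normc h ^+ 3); last by ring.
apply: le_trans; rewrite le_eqVlt; apply/orP; left; apply/eqP; congr normc.
rewrite rmorphN; ring.
Qed.

Lemma Re_gt0_near w : 0 < Re w -> exists r : R, 0 < r /\ forall h, normc h < r -> 0 < Re (w + h).
Proof.
move=> w0; exists (Re w); split=> // h hw; rewrite ReD.
have := le_lt_trans (normr_Re_le h) hw; rewrite ltr_norml => /andP[k _]; lra.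
Qed.

(** The Taylor estimates cover nonpositive exponents; [w ^ r = w ^ (r - 1) w] extends them to every
    [r <= 1]. *)
Lemma cdiff_cpow r w : r <= 1 -> 0 < Re w ->
  cdiff (cpow r) w (r%:C%C * cpow (r - 1) w).
Proof.
move=> r1 w0; have s0 : 0 <= 1 - r by lra.
have := cdiffM (cdiff_cpowN s0 w0) (cdiff_id w).
rewrite mulr1 => h.
have e1 : - (1 - r) = r - 1 by ring.
have e2 : cpow (- (1 - r)) w = cpow (- (1 - r) - 1) w * w by rewrite -cpowS// subrK.
have -> : r%:C%C * cpow (r - 1) w = (- (1 - r))%:C%C * cpow (- (1 - r) - 1) w * w + cpow (- (1 - r)) w.
  rewrite -mulrA -e2 e1 rmorphB rmorph1; ring.
apply: cdiff_near h; have [rr [rr0 hr]] := Re_gt0_near w0.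
by exists rr; split=> // h /hr h0; rewrite e1 -cpowS// subrK.
Qed.

End ComplexPowerExpansion.

(** * Wronskians on the strip *)

Section Wronskian.
Context {R : realType}.
Variables (alpha beta ab : R).
Hypotheses (alpha1 : alpha < 1) (beta1 : beta < 1).
Implicit Types (z w : R[i]) (u v p : R[i] -> R[i]).
Local Notation xn := (@vanishing_seq R).
Local Notation al := (alpha%:C%C : R[i]).
Local Notation be := (beta%:C%C : R[i]).

Definition in_strip z := 0 < Re z < 1.

(** The hypergeometric equation with [c = alpha] and [a + b + 1 = alpha + beta]. Its exponents are 0
    and [1 - alpha] at the point 0, and 0 and [1 - beta] at the point 1. *)
Definition solution u u' := forall z, in_strip z -> cdiff u z (u' z) /\
  exists2 u2, cdiff u' z u2 &
    z * (1 - z) * u2 + (al - (al + be) * z) * u' z - ab%:C%C * u z = 0.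

(** Near 0 a solution behaves like [l0 + k z ^ (1 - alpha)], so the weight [z ^ alpha] makes the
    derivative converge, to [l1 = (1 - alpha) k]. The pair plays the part of initial data at the
    singular point. *)
Definition boundary_data u u' (l0 l1 : R) := exists p d : nat -> R,
  [/\ forall n, u (xn n)%:C%C = (p n)%:C%C, forall n, u' (xn n)%:C%C = (d n)%:C%C,
    p n @[n --> \oo] --> l0 & xn n `^ alpha * d n @[n --> \oo] --> l1].

(** The prefactor is the reciprocal of the one in Abel's identity, which makes the whole expression
    constant. *)
Definition wronskian u u' v v' z :=
  cpow alpha z * cpow beta (1 - z) * (u z * v' z - u' z * v z).

Lemma reflect_neq1 z : z != 0 -> 1 - z != 1.
Proof. by move=> z0; rewrite eq_sym -subr_eq0 subKr. Qed.

Lemma Re_1B_gt0 z : Re z < 1 -> 0 < Re (1 - z).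
Proof. by move=> z1; rewrite ReD ReN /= subr_gt0. Qed.

Lemma cdiff_cpow_1B r z : r <= 1 -> Re z < 1 ->
  cdiff (fun z => cpow r (1 - z)) z (- (r%:C%C * cpow (r - 1) (1 - z))).
Proof.
move=> r1 z1; have w0 := Re_1B_gt0 z1.
have h : cdiff (cpow r) (1 + (-1) * z) (r%:C%C * cpow (r - 1) (1 - z)).
  by rewrite mulN1r; exact: cdiff_cpow.
have := cdiff_comp_affine h; rewrite mulrN1.
by apply: cdiff_near; exists 1; split=> // k _; rewrite mulN1r.
Qed.

Lemma cdiffN u z d : cdiff u z d -> cdiff (fun w => - u w) z (- d).
Proof.
move=> /(cdiffZ (-1)); rewrite mulN1r; apply: cdiff_near.
by exists 1; split=> // k _; rewrite mulN1r.
Qed.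

Lemma cdiffB u v z d e : cdiff u z d -> cdiff v z e -> cdiff (fun w => u w - v w) z (d - e).
Proof. by move=> hu hv; apply: cdiffD => //; exact: cdiffN. Qed.

Lemma cdiff_eq u z d e : cdiff u z d -> d = e -> cdiff u z e.
Proof. by move=> h <-. Qed.

Lemma cdiff_wronskian u u' v v' z : solution u u' -> solution v v' -> in_strip z ->
  cdiff (wronskian u u' v v') z 0.
Proof.
move=> su sv zs; have /andP[z0 z1] := zs; have w0 := Re_1B_gt0 z1.
have [du [u2 du' eu]] := su z zs; have [dv [v2 dv' ev]] := sv z zs.
have da := cdiff_cpow (ltW alpha1) z0.
have db := cdiff_cpow_1B (ltW beta1) z1.
have := cdiffM (cdiffM da db) (cdiffB (cdiffM du dv') (cdiffM du' dv)).
move=> h; apply: cdiff_eq h _.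
have -> : cpow alpha z = cpow (alpha - 1) z * z by rewrite -cpowS// subrK.
have -> : cpow beta (1 - z) = cpow (beta - 1) (1 - z) * (1 - z) by rewrite -cpowS// subrK.
move: (cpow (alpha - 1) z) (cpow (beta - 1) (1 - z)) => P Q.
have {}eu : z * (1 - z) * u2 = ab%:C%C * u z - (al - (al + be) * z) * u' z.
  by apply/eqP; rewrite -subr_eq0 -[X in _ == X]eu; apply/eqP; ring.
have {}ev : z * (1 - z) * v2 = ab%:C%C * v z - (al - (al + be) * z) * v' z.
  by apply/eqP; rewrite -subr_eq0 -[X in _ == X]ev; apply/eqP; ring.
transitivity (P * Q * ((al * (1 - z) - be * z) * (u z * v' z - u' z * v z)
   + (u z * (z * (1 - z) * v2) - v z * (z * (1 - z) * u2)))); first by ring.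
rewrite eu ev; ring.
Qed.

Lemma in_strip_segment z w (t : R) : in_strip z -> in_strip w -> 0 <= t <= 1 ->
  in_strip (z + t%:C%C * (w - z)).
Proof.
rewrite /in_strip => /andP[a1 a2] /andP[b1 b2] /andP[t0 t1].
rewrite ReD ReZ ReD ReN.
have -> : Re z + t * (Re w - Re z) = (1 - t) * Re z + t * Re w by ring.
have [->|tn] := eqVneq t 0; first by rewrite subr0 mul1r mul0r addr0 a1.
have tp : 0 < t by rewrite lt_neqAle eq_sym tn.
apply/andP; split; first by rewrite ltr_wpDl ?mulr_gt0// mulr_ge0 ?subr_ge0// ltW.
have : t * Re w < t by rewrite gtr_pMr.
have : (1 - t) * Re z <= 1 - t by rewrite ler_piMr ?subr_ge0// ltW.
lra.
Qed.

Lemma in_strip_vanishing n : in_strip (xn n)%:C%C.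
Proof. by rewrite /in_strip /= vanishing_seq_gt0 vanishing_seq_lt1. Qed.

(** The strip is convex, so the Wronskian equals its values along [xn], and these converge to the
    determinant of the endpoint data as [(1 - xn n) ^ beta] tends to 1. *)
Lemma wronskianE u u' v v' (l0 l1 m0 m1 : R) z : solution u u' -> solution v v' ->
  boundary_data u u' l0 l1 -> boundary_data v v' m0 m1 -> in_strip z ->
  wronskian u u' v v' z = (l0 * m1 - l1 * m0)%:C%C.
Proof.
move=> su sv [p [d [up ud pl dl]]] [q [e [vq ve qm em]]] zs.
pose W n : R := (1 - xn n) `^ beta * (p n * (xn n `^ alpha * e n) - xn n `^ alpha * d n * q n).
have WE n : wronskian u u' v v' z = (W n)%:C%C.
  have -> : wronskian u u' v v' z = wronskian u u' v v' (xn n)%:C%C.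
    apply: cdiff0_segment => t t01; apply: cdiff_wronskian => //.
    by apply: in_strip_segment => //; exact: in_strip_vanishing.
  have x1 : 0 < 1 - xn n by rewrite subr_gt0 vanishing_seq_lt1.
  have x0 := vanishing_seq_gt0 n (R := R).
  rewrite /wronskian up ud vq ve cpow_real//.
  have -> : 1 - (xn n)%:C%C = (1 - xn n)%:C%C :> R[i] by rewrite rmorphB rmorph1.
  rewrite cpow_real// /W !(rmorphM, rmorphB); ring.
have W0 n : W n = W 0%N by have := WE n; rewrite (WE 0%N) => -[].
have c1 : W n @[n --> \oo] --> W 0%N.
  by apply: cvg_near_cst; apply: nearW.
have c2 : W n @[n --> \oo] --> 1 * (l0 * m1 - l1 * m0).
  apply: cvgM.
    have h : 1 - xn n @[n --> \oo] --> (1 - 0 : R).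
      by apply: cvgB; [exact: cvg_cst|exact: cvg_vanishing_seq].
    rewrite subr0 in h.
    have := cvg_seq_comp (continuous_powR_pos (x := beta) (@ltr01 R)) h.
    by rewrite powR1.
  by apply: cvgB; apply: cvgM.
rewrite (WE 0%N); congr (_%:C)%C; rewrite -[RHS]mul1r; exact: (cvg_unique _ c1 c2).
Qed.

End Wronskian.

(** * Local solutions at 0 and 1 and their data at 0 *)

Section Solutions.
Context {R : realType}.
Implicit Types (z w : R[i]) (a b alpha beta : R).
Local Notation xn := (@vanishing_seq R).

(** For the parameters of the theorem [a - b = 1 - gamma], so [b <= a] is the bound [gamma <= 1],
    and [0 < b] says that the orders add up to more than 2. The conditions are symmetric in [alpha]
    and [beta], which lets one chart serve at both punctures. *)
Definition admissible a b alpha beta :=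
  [/\ 0 < b, b <= a, a + b + 1 = alpha + beta &
      [/\ a < alpha, a < beta, alpha < 1 & beta < 1]].

Lemma admissible_sym a b alpha beta :
  admissible a b alpha beta -> admissible a b beta alpha.
Proof. by move=> [b0 ba e [h1 h2 h3 h4]]; split => //; rewrite addrC [RHS]addrC -e addrC. Qed.

(* [hyp1] and [(1 - w) ^ (1 - beta) * hyp2] are the two local solutions at [1]. *)
Definition hyp1 a b beta := hyp a b beta.
Definition dhyp1 a b beta := dhyp a b beta.
Definition hyp2 a b beta := hyp (a - beta + 1) (b - beta + 1) (2 - beta).
Definition dhyp2 a b beta := dhyp (a - beta + 1) (b - beta + 1) (2 - beta).
Definition sol2 a b beta z := cpow (1 - beta) (1 - z) * hyp2 a b beta z.
Definition dsol2 a b beta z :=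
  - ((1 - beta)%:C%C * cpow (- beta) (1 - z)) * hyp2 a b beta z
  + cpow (1 - beta) (1 - z) * dhyp2 a b beta z.

Section LocalSolutions.
Variables (a b alpha beta : R).
Hypothesis adm : admissible a b alpha beta.

Let ineqs : [/\ 0 < a, 0 < b, b < alpha, b < beta & [/\ 0 < a - beta + 1, 0 < b - beta + 1,
  b - beta + 1 < 2 - beta, beta < 1 & alpha < 1]].
Proof. by case: adm => b0 ba e [h1 h2 h3 h4]; split; last split; lra. Qed.

Lemma hyp1_ode z : 0 < Re z ->
  z * (1 - z) * ddhyp a b beta z + (alpha%:C%C - (alpha%:C%C + beta%:C%C) * z) * dhyp1 a b beta z
   - (a * b)%:C%C * hyp1 a b beta z = 0.
Proof.
move=> z0; have [a0 b0 bal bbe _] := ineqs; have [_ _ e _] := adm.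
rewrite -[RHS](hyp_ode a0 b0 bbe z0) -rmorphD -e.
by have -> : alpha = a + b + 1 - beta by lra.
Qed.

(** What the equation becomes for the second factor once [(1 - z) ^ (1 - beta)] is divided out:
    again hypergeometric, with shifted parameters. *)
Lemma hyp2_ode z : 0 < Re z ->
  z * (1 - z) * ddhyp (a - beta + 1) (b - beta + 1) (2 - beta) z
   + (alpha%:C%C - (alpha - beta + 2)%:C%C * z) * dhyp2 a b beta z
   - (a * b + (1 - beta) * alpha)%:C%C * hyp2 a b beta z = 0.
Proof.
move=> z0; have [a0 b0 bal bbe [A0 B0 BC _ _]] := ineqs; have [_ _ e _] := adm.
rewrite -[RHS](hyp_ode A0 B0 BC z0).
have ae : alpha = a + b + 1 - beta by lra.
have -> : a - beta + 1 + (b - beta + 1) + 1 - (2 - beta) = alpha by rewrite ae; ring.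
have -> : a - beta + 1 + (b - beta + 1) + 1 = alpha - beta + 2 by rewrite ae; ring.
have -> : (a - beta + 1) * (b - beta + 1) = a * b + (1 - beta) * alpha by rewrite ae; ring.
by [].
Qed.

Lemma cdiff_hyp1 z : 0 < Re z -> cdiff (hyp1 a b beta) z (dhyp1 a b beta z).
Proof. by move=> z0; have [a0 b0 _ bbe _] := ineqs; exact: cdiff_hyp. Qed.

Lemma cdiff_dhyp1 z : 0 < Re z -> cdiff (dhyp1 a b beta) z (ddhyp a b beta z).
Proof. by move=> z0; have [a0 b0 _ bbe _] := ineqs; exact: cdiff_dhyp. Qed.

Lemma cdiff_hyp2 z : 0 < Re z -> cdiff (hyp2 a b beta) z (dhyp2 a b beta z).
Proof. by move=> z0; have [_ _ _ _ [A0 B0 BC _ _]] := ineqs; exact: cdiff_hyp. Qed.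

Lemma cdiff_dhyp2 z : 0 < Re z ->
  cdiff (dhyp2 a b beta) z (ddhyp (a - beta + 1) (b - beta + 1) (2 - beta) z).
Proof. by move=> z0; have [_ _ _ _ [A0 B0 BC _ _]] := ineqs; exact: cdiff_dhyp. Qed.

Lemma solution_hyp1 : solution alpha beta (a * b) (hyp1 a b beta) (dhyp1 a b beta).
Proof.
move=> z /andP[z0 _]; split; first exact: cdiff_hyp1.
by exists (ddhyp a b beta z); [exact: cdiff_dhyp1|exact: hyp1_ode].
Qed.

Lemma cdiff_sol2 z : in_strip z -> cdiff (sol2 a b beta) z (dsol2 a b beta z).
Proof.
move=> /andP[z0 z1]; have [_ _ _ _ [A0 B0 BC be1 _]] := ineqs.
have s1 : 1 - beta <= 1 by have [? ? ? [? ? ? ?]] := adm; lra.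
apply: cdiff_eq (cdiffM (cdiff_cpow_1B s1 z1) (cdiff_hyp2 z0)) _.
by rewrite /dsol2; have -> : 1 - beta - 1 = - beta by ring.
Qed.

Lemma solution_sol2 : solution alpha beta (a * b) (sol2 a b beta) (dsol2 a b beta).
Proof.
move=> z zs; split; first exact: cdiff_sol2.
have /andP[z0 z1] := zs; have [_ _ _ _ [A0 B0 BC be1 _]] := ineqs.
have s1 : 1 - beta <= 1 by have [? ? ? [? ? ? ?]] := adm; lra.
have s2 : - beta <= 1 by lra.
have d0 := cdiffZ (-1) (cdiffZ (1 - beta)%:C%C (cdiff_cpow_1B s2 z1)).
have d1 := cdiffM d0 (cdiff_hyp2 z0).
have d2 := cdiffM (cdiff_cpow_1B s1 z1) (cdiff_dhyp2 z0).
eexists.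
  apply: cdiff_near (cdiffD d1 d2); exists 1; split=> // h _.
  by rewrite /dsol2 mulN1r.
have w0 := Re_1B_gt0 z1.
have e2 : cpow (- beta) (1 - z) = cpow (- beta - 1) (1 - z) * (1 - z).
  by apply: cpow_shift => //; rewrite subrK.
have e3 : cpow (1 - beta) (1 - z) = cpow (- beta - 1) (1 - z) * (1 - z) * (1 - z).
  by rewrite -e2; apply: cpow_shift => //; rewrite addrC.
have e1 : 1 - beta - 1 = - beta by ring.
rewrite /sol2 /dsol2 e1 e2 e3.
have := hyp2_ode z0; move: (cpow _ _) => T.
move: (hyp2 _ _ _ z) (dhyp2 _ _ _ z) (ddhyp _ _ _ z) => p p' p'' ode.
rewrite -[RHS](mulr0 (T * (1 - z) * (1 - z))) -[in RHS]ode.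
rewrite !(rmorphD, rmorphB, rmorphM, rmorphN) rmorph1 ?rmorph_nat; ring.
Qed.

Let exponents_gt0 : 0 < alpha /\ 0 < beta.
Proof. by have [? ? ? [? ? ? ?]] := adm; split; lra. Qed.

Lemma cvg_vanishing_powR (r : R) : 0 < r -> xn n `^ r @[n --> \oo] --> (0 : R).
Proof.
move=> r0; apply: (@cvg_comp _ _ _ xn (@powR R ^~ r) _ (0 : R)^'+ _ _ (powR_cvg0 r0)).
by apply: cvg_at_right0; [exact: vanishing_seq_gt0|exact: cvg_vanishing_seq].
Qed.

Lemma cvg_1B_powR (r : R) : (1 - xn n) `^ r @[n --> \oo] --> (1 : R).
Proof.
have h : 1 - xn n @[n --> \oo] --> (1 - 0 : R).
  by apply: cvgB; [exact: cvg_cst|exact: cvg_vanishing_seq].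
rewrite subr0 in h.
by have := cvg_seq_comp (continuous_powR_pos (x := r) (@ltr01 R)) h; rewrite powR1.
Qed.

(** For the value the exponents of the kernel satisfy [x + y = alpha - 1 < 0], and the integral
    converges to a Beta value. For the derivative they satisfy [x + y = alpha > 0], the case in
    which the weight [xn n ^ alpha] is required. *)
Lemma boundary_data_hyp1 : boundary_data alpha (hyp1 a b beta) (dhyp1 a b beta)
  (Betaf b (1 - alpha)) (- (a * Betaf alpha (beta - b))).
Proof.
have [a0 b0 bal bbe _] := ineqs; have [_ _ e [h1 h2 h3 h4]] := adm.
exists (fun n => Jreal b (a - beta) a (xn n)), (fun n => - a * Jreal (b + 1) (a - beta) (a + 1) (xn n)).
split.
- by move=> n; exact: Jint_real (vanishing_seq_gt0 n).
- by move=> n; rewrite /dhyp1 /dhyp (Jint_real _ _ _ (vanishing_seq_gt0 n)) rmorphM.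
- have -> : 1 - alpha = - (b + (a - beta)) by lra.
  by apply: Jreal_cvg0; lra.
- have ea : alpha = b + 1 + (a - beta) by lra.
  have -> : beta - b = a + 1 - (b + 1 + (a - beta)) by lra.
  rewrite ea -mulNr.
  under eq_fun do rewrite mulrCA.
  by apply: cvgM; [exact: cvg_cst|apply: Jreal_scale_cvg0; lra].
Qed.

Lemma boundary_data_sol2 : boundary_data alpha (sol2 a b beta) (dsol2 a b beta)
  (Betaf (b - beta + 1) (1 - alpha)) (- ((a - beta + 1) * Betaf alpha (1 - b))).
Proof.
have [a0 b0 bal bbe _] := ineqs; have [_ _ e [h1 h2 h3 h4]] := adm.
have [al0 be0] := exponents_gt0.
pose P n := Jreal (b - beta + 1) (a - beta + 1 - (2 - beta)) (a - beta + 1) (xn n).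
pose Q n := Jreal (b - beta + 1 + 1) (a - beta + 1 - (2 - beta)) (a - beta + 1 + 1) (xn n).
have x1 n : 0 < 1 - xn n by rewrite subr_gt0 vanishing_seq_lt1.
have cE n r : cpow r (1 - (xn n)%:C%C) = ((1 - xn n) `^ r)%:C%C.
  by rewrite -cpow_real// rmorphB rmorph1.
have P1 : P n @[n --> \oo] --> Betaf (b - beta + 1) (1 - alpha).
  have -> : 1 - alpha = - (b - beta + 1 + (a - beta + 1 - (2 - beta))) by lra.
  by apply: Jreal_cvg0; lra.
have Q1 : xn n `^ alpha * Q n @[n --> \oo] --> Betaf alpha (1 - b).
  have ea : alpha = b - beta + 1 + 1 + (a - beta + 1 - (2 - beta)) by lra.
  have -> : 1 - b = a - beta + 1 + 1 - (b - beta + 1 + 1 + (a - beta + 1 - (2 - beta))) by lra.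
  by rewrite /Q ea; apply: Jreal_scale_cvg0; lra.
exists (fun n => (1 - xn n) `^ (1 - beta) * P n),
  (fun n => - ((1 - beta) * (1 - xn n) `^ (- beta)) * P n
     + (1 - xn n) `^ (1 - beta) * (- (a - beta + 1) * Q n)); split.
- by move=> n; rewrite /sol2 cE /hyp2 /hyp (Jint_real _ _ _ (vanishing_seq_gt0 n)) rmorphM.
- move=> n; rewrite /dsol2 !cE /hyp2 /hyp /dhyp2 /dhyp !(Jint_real _ _ _ (vanishing_seq_gt0 n)).
  by rewrite -/(P n) -/(Q n) !(rmorphD, rmorphM, rmorphN).
- rewrite -[X in _ --> X]mul1r; apply: cvgM; [exact: cvg_1B_powR|exact: P1].
- have -> : - ((a - beta + 1) * Betaf alpha (1 - b)) =
     0 * (- ((1 - beta) * 1) * Betaf (b - beta + 1) (1 - alpha)) +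
     1 * (- (a - beta + 1) * Betaf alpha (1 - b)) by rewrite mul0r add0r mul1r mulNr.
  have -> : (fun n => xn n `^ alpha * (- ((1 - beta) * (1 - xn n) `^ (- beta)) * P n
     + (1 - xn n) `^ (1 - beta) * (- (a - beta + 1) * Q n))) =
    (fun n => xn n `^ alpha * (- ((1 - beta) * (1 - xn n) `^ (- beta)) * P n)
     + (1 - xn n) `^ (1 - beta) * (- (a - beta + 1) * (xn n `^ alpha * Q n))).
    by apply/funext => n; ring.
  apply: cvgD; apply: cvgM.
  + exact: cvg_vanishing_powR.
  + apply: cvgM; last exact: P1.
    by apply: cvgN; apply: cvgM; [exact: cvg_cst|exact: cvg_1B_powR].
  + exact: cvg_1B_powR.
  + by apply: cvgM; [exact: cvg_cst|exact: Q1].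
Qed.

End LocalSolutions.

Section Reflection.
Variables (a b alpha beta : R).
Hypothesis adm : admissible a b alpha beta.

Lemma solution_reflect (u u' : R[i] -> R[i]) ab : solution beta alpha ab u u' ->
  solution alpha beta ab (fun z => u (1 - z)) (fun z => - u' (1 - z)).
Proof.
move=> su z zs.
have ws : in_strip (1 - z).
  by move: zs; rewrite /in_strip ReD ReN /= => /andP[h1 h2]; apply/andP; split; lra.
have [du [u2 du' ode]] := su _ ws.
have refl (f : R[i] -> R[i]) d : cdiff f (1 - z) d -> cdiff (fun z => f (1 - z)) z (- d).
  move=> df; have df' : cdiff f (1 + (-1) * z) d by rewrite mulN1r.
  have := cdiff_comp_affine df'; rewrite mulrN1.
  by apply: cdiff_near; exists 1; split=> // h _; rewrite mulN1r.
split; first exact: refl.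
exists u2; first by apply: cdiff_eq (cdiffN (refl _ _ du')) _; rewrite opprK.
rewrite -[RHS]ode; ring.
Qed.

Let pos : 0 < alpha. Proof. by have [? ? ? [? ? ? ?]] := adm; lra. Qed.

Lemma vanishing_reflect n : 1 - (xn n)%:C%C = (1 - xn n)%:C%C :> R[i].
Proof. by rewrite rmorphB rmorph1. Qed.

(** The solutions local at 0 have diagonal data: the regular one has only a value, and the one
    carrying [z ^ (1 - alpha)] only a weighted derivative. This makes their Wronskians with the
    solutions at 1 single products. *)
Lemma boundary_data_reflect_hyp1 : boundary_data alpha (fun z => hyp1 a b alpha (1 - z))
  (fun z => - dhyp1 a b alpha (1 - z)) (Betaf b (alpha - b)) 0.
Proof.
have [b0 ba e [h1 h2 h3 h4]] := adm.
have x1 n : 0 < 1 - xn n by rewrite subr_gt0 vanishing_seq_lt1.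
exists (fun n => Jreal b (a - alpha) a (1 - xn n)),
  (fun n => a * Jreal (b + 1) (a - alpha) (a + 1) (1 - xn n)); split.
- by move=> n; rewrite vanishing_reflect; exact: Jint_real.
- by move=> n; rewrite vanishing_reflect /dhyp1 /dhyp Jint_real// rmorphM rmorphN mulNr opprK.
- have -> : Betaf b (alpha - b) = Jreal b (a - alpha) a 1 by rewrite Jreal1; congr Betaf; ring.
  by apply: Jreal_cvg1; lra.
- rewrite -[X in _ --> X](mul0r (a * Jreal (b + 1) (a - alpha) (a + 1) 1)).
  apply: cvgM; first exact: cvg_vanishing_powR.
  by apply: cvgM; [exact: cvg_cst|apply: Jreal_cvg1; lra].
Qed.

Lemma boundary_data_reflect_sol2 : boundary_data alpha (fun z => sol2 a b alpha (1 - z))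
  (fun z => - dsol2 a b alpha (1 - z)) 0 ((1 - alpha) * Betaf (b - alpha + 1) (1 - b)).
Proof.
have [b0 ba e [h1 h2 h3 h4]] := adm.
have x1 n : 0 < 1 - xn n by rewrite subr_gt0 vanishing_seq_lt1.
pose P n := Jreal (b - alpha + 1) (a - alpha + 1 - (2 - alpha)) (a - alpha + 1) (1 - xn n).
pose Q n := Jreal (b - alpha + 1 + 1) (a - alpha + 1 - (2 - alpha)) (a - alpha + 1 + 1) (1 - xn n).
have P1 : P n @[n --> \oo] --> Betaf (b - alpha + 1) (1 - b).
  have -> : Betaf (b - alpha + 1) (1 - b) =
    Jreal (b - alpha + 1) (a - alpha + 1 - (2 - alpha)) (a - alpha + 1) 1.
    by rewrite Jreal1; congr Betaf; ring.
  by apply: Jreal_cvg1; lra.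
have Q1 : Q n @[n --> \oo] -->
    Jreal (b - alpha + 1 + 1) (a - alpha + 1 - (2 - alpha)) (a - alpha + 1 + 1) 1.
  by apply: Jreal_cvg1; lra.
have cE n r : cpow r (1 - (1 - (xn n)%:C%C)) = (xn n `^ r)%:C%C.
  by rewrite subKr cpow_real// vanishing_seq_gt0.
exists (fun n => xn n `^ (1 - alpha) * P n),
  (fun n => (1 - alpha) * xn n `^ (- alpha) * P n + xn n `^ (1 - alpha) * ((a - alpha + 1) * Q n)); split.
- by move=> n; rewrite /sol2 cE vanishing_reflect /hyp2 /hyp Jint_real// rmorphM.
- move=> n; rewrite /dsol2 !cE vanishing_reflect /hyp2 /hyp /dhyp2 /dhyp !Jint_real//.
  rewrite -/(P n) -/(Q n); move: (P n) (Q n) (xn n `^ _) (xn n `^ _) => p q u v.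
  by rewrite !(rmorphD, rmorphM, rmorphN, rmorphB); ring.
- rewrite -[X in _ --> X](mul0r (Betaf (b - alpha + 1) (1 - b))); apply: cvgM; last exact: P1.
  by apply: cvg_vanishing_powR; lra.
- have -> : (fun n => xn n `^ alpha * ((1 - alpha) * xn n `^ (- alpha) * P n +
      xn n `^ (1 - alpha) * ((a - alpha + 1) * Q n))) =
    (fun n => (1 - alpha) * P n + xn n * ((a - alpha + 1) * Q n)).
    apply/funext => n; have x0 := @vanishing_seq_gt0 R n.
    have e1 : xn n `^ alpha * xn n `^ (- alpha) = 1 by rewrite -powRDp// subrr powRr0.
    have e2 : xn n `^ alpha * xn n `^ (1 - alpha) = xn n.
      by rewrite -powRDp// addrC subrK powRr1// ltW.
    transitivity ((xn n `^ alpha * xn n `^ (- alpha)) * ((1 - alpha) * P n) +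
      (xn n `^ alpha * xn n `^ (1 - alpha)) * ((a - alpha + 1) * Q n)); first by ring.
    by rewrite e1 e2 mul1r.
  rewrite -[X in _ --> X]addr0
    -(mul0r ((a - alpha + 1) * Jreal (b - alpha + 1 + 1) (a - alpha + 1 - (2 - alpha)) (a - alpha + 1 + 1) 1)).
  apply: cvgD; first by apply: cvgM; [exact: cvg_cst|exact: P1].
  apply: cvgM; first exact: cvg_vanishing_seq.
  by apply: cvgM; [exact: cvg_cst|exact: Q1].
Qed.

End Reflection.
End Solutions.

(** * Hermitian forms and the Wronskian of the solutions at 1 *)

Section Connection.
Context {R : realType}.
Implicit Types (z w : R[i]).

(** Inserting [e1] and [e2] produces a mixed term in [v1] and [v2] with coefficient proportional to
    [X n1 n2 - m1 m2 / X]. The relation [XE] cancels it, and [KE] simplifies the two diagonal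
    coefficients. *)
Lemma hermitian_change (u1 u2 v1 v2 : R[i]) (U1 U2 m1 n1 m2 n2 K X : R) :
  0 < U1 -> 0 < U2 -> 0 < m1 -> 0 < m2 -> 0 < n1 -> 0 < n2 -> 0 < K -> 0 < X ->
  n2 * m1 - n1 * m2 = K -> X ^+ 2 * (n1 * n2) = m1 * m2 ->
  u1 * K%:C%C = U1%:C%C * (n2%:C%C * v1 - n1%:C%C * v2) ->
  u2 * K%:C%C = U2%:C%C * (m2%:C%C * v1 - m1%:C%C * v2) ->
  X / U1 ^+ 2 * normc u1 ^+ 2 - (X * U2 ^+ 2)^-1 * normc u2 ^+ 2 =
  X * n2 / (m1 * K) * normc v1 ^+ 2 - X * n1 / (m2 * K) * normc v2 ^+ 2.
Proof.
move=> U10 U20 m10 m20 n10 n20 K0 X0 KE XE e1 e2.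
pose c := Re v1 * Re v2 + Im v1 * Im v2.
have sq (p q : R) : normc (p%:C%C * v1 - q%:C%C * v2) ^+ 2 =
    p ^+ 2 * normc v1 ^+ 2 - 2 * p * q * c + q ^+ 2 * normc v2 ^+ 2.
  by rewrite !sqr_normcE /c !ReImE; ring.
have f1 : normc u1 ^+ 2 = (U1 / K) ^+ 2 * (n2 ^+ 2 * normc v1 ^+ 2 - 2 * n2 * n1 * c + n1 ^+ 2 * normc v2 ^+ 2).
  rewrite -sq; have := congr1 (fun z => normc z ^+ 2) e1.
  rewrite /= !normcMc !normc_real !gtr0_norm// !exprMn => h.
  apply: (mulIf (_ : K ^+ 2 != 0)); first by rewrite expf_neq0// gt_eqF.
  rewrite h; set N := normc _ ^+ 2; field; by rewrite gt_eqF.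
have f2 : normc u2 ^+ 2 = (U2 / K) ^+ 2 * (m2 ^+ 2 * normc v1 ^+ 2 - 2 * m2 * m1 * c + m1 ^+ 2 * normc v2 ^+ 2).
  rewrite -sq; have := congr1 (fun z => normc z ^+ 2) e2.
  rewrite /= !normcMc !normc_real !gtr0_norm// !exprMn => h.
  apply: (mulIf (_ : K ^+ 2 != 0)); first by rewrite expf_neq0// gt_eqF.
  rewrite h; set N := normc _ ^+ 2; field; by rewrite gt_eqF.
have Xi : X^-1 = X * (n1 * n2) / (m1 * m2).
  by rewrite -XE; field; rewrite !gt_eqF.
rewrite f1 f2 [(X * _)^-1]invfM Xi.
move: (normc v1 ^+ 2) (normc v2 ^+ 2) => p q.
have Kn : n2 * m1 - n1 * m2 != 0 by rewrite KE gt_eqF.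
rewrite -KE; field.
by rewrite Kn !gt_eqF.
Qed.

Variables (a b alpha beta : R).
Hypothesis adm : admissible a b alpha beta.

(** The Wronskian of [hyp1] and [sol2] with the factor [(1 - w) ^ (- beta)] removed. It remains
    meaningful at [w = 1], where the second summand vanishes and Beta integrals give the value. *)
Definition local_wronskian beta w :=
  - ((1 - beta)%:C%C * (hyp1 a b beta w * hyp2 a b beta w)) +
  (1 - w) * (hyp1 a b beta w * dhyp2 a b beta w - dhyp1 a b beta w * hyp2 a b beta w).

Definition local_value beta := (1 - beta) * Betaf b (beta - b) * Betaf (b - beta + 1) (1 - b).

Lemma cdiff_local_wronskian w : 0 < Re w ->
  cdiff (fun w => cpow alpha w * local_wronskian beta w) w 0.
Proof.
move=> w0; have [b0 ba e [h1 h2 h3 h4]] := adm.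
have p1 := cdiff_hyp1 adm w0; have p2 := cdiff_hyp2 adm w0.
have d1 := cdiff_dhyp1 adm w0; have d2 := cdiff_dhyp2 adm w0.
have pw := cdiff_cpow (ltW h3) w0.
have y1 := cdiffB (cdiff_cst w 1) (cdiff_id w).
have E := cdiffD (cdiffN (cdiffZ (1 - beta)%:C%C (cdiffM p1 p2)))
  (cdiffM y1 (cdiffB (cdiffM p1 d2) (cdiffM d1 p2))).
apply: cdiff_eq (cdiffM pw E) _.
have o1 := hyp1_ode adm w0; have o2 := hyp2_ode adm w0.
have -> : cpow alpha w = cpow (alpha - 1) w * w by rewrite -cpowS// subrK.
move: (cpow _ _) o1 o2.
move: (hyp1 a b beta w) (hyp2 a b beta w) (dhyp1 a b beta w) (dhyp2 a b beta w)
  (ddhyp a b beta w) (ddhyp (a - beta + 1) (b - beta + 1) (2 - beta) w).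
move=> q1 q2 q1' q2' q1'' q2'' P o1 o2.
have {}o1 : w * (1 - w) * q1'' = (a * b)%:C%C * q1 - (alpha%:C%C - (alpha%:C%C + beta%:C%C) * w) * q1'.
  by apply/eqP; rewrite -subr_eq0 -[X in _ == X]o1; apply/eqP; ring.
have {}o2 : w * (1 - w) * q2'' = (a * b + (1 - beta) * alpha)%:C%C * q2 -
    (alpha%:C%C - (alpha - beta + 2)%:C%C * w) * q2'.
  by apply/eqP; rewrite -subr_eq0 -[X in _ == X]o2; apply/eqP; ring.
transitivity (P * (alpha%:C%C * (- ((1 - beta)%:C%C * (q1 * q2)) + (1 - w) * (q1 * q2' - q1' * q2))
  + w * (- ((1 - beta)%:C%C * (q1' * q2 + q1 * q2')) - (q1 * q2' - q1' * q2))
  + (q1 * (w * (1 - w) * q2'') - q2 * (w * (1 - w) * q1'')))); first by ring.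
rewrite o1 o2 !(rmorphD, rmorphB, rmorphM, rmorphN) rmorph1 ?rmorph_nat; ring.
Qed.

Lemma hyp_at1 (A B C : R) : hyp A B C 1 = (Betaf B (C - B))%:C%C.
Proof.
have e : A - B - (A - C) = C - B by ring.
by rewrite /hyp (Jint_real B (A - C) A (@ltr01 R)) Jreal1 e.
Qed.

Lemma local_wronskianE w : 0 < Re w ->
  cpow alpha w * local_wronskian beta w = (- local_value beta)%:C%C.
Proof.
move=> w0; have [b0 ba e [h1 h2 h3 h4]] := adm.
have -> : cpow alpha w * local_wronskian beta w = cpow alpha 1 * local_wronskian beta 1.
  apply: (@cdiff0_segment _ (fun w => cpow alpha w * local_wronskian beta w) 1 w) => t /andP[t0 t1].
  apply: cdiff_local_wronskian; rewrite ReD ReZ ReD ReN /=.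
  have -> : 1 + t * (Re w - 1) = (1 - t) + t * Re w by ring.
  have [->|tn] := eqVneq t 0; first by rewrite subr0 mul0r addr0.
  by rewrite ltr_wpDl ?subr_ge0// mulr_gt0// lt_neqAle eq_sym tn.
have c1 : cpow alpha 1 = 1 :> R[i] by rewrite (cpow_real alpha (@ltr01 R)) powR1.
rewrite c1 mul1r.
rewrite /local_wronskian subrr mul0r addr0 /hyp1 /hyp2 !hyp_at1 /local_value.
have -> : 2 - beta - (b - beta + 1) = 1 - b by ring.
by rewrite -!rmorphM -rmorphN mulrA.
Qed.

Lemma wronskian_sol12 z : in_strip z ->
  wronskian alpha beta (hyp1 a b beta) (dhyp1 a b beta) (sol2 a b beta) (dsol2 a b beta) z =
  (- local_value beta)%:C%C.
Proof.
move=> /andP[z0 z1]; rewrite -(local_wronskianE z0) /wronskian -mulrA; congr (_ * _).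
have w0 := Re_1B_gt0 z1.
have e1 : cpow beta (1 - z) * cpow (- beta) (1 - z) = 1 by rewrite -cpowD subrr cpow0.
have e2 : cpow beta (1 - z) * cpow (1 - beta) (1 - z) = 1 - z.
  by rewrite -cpowD addrC subrK cpow1.
rewrite /sol2 /dsol2 /local_wronskian.
move: (cpow beta _) (cpow (- beta) _) (cpow (1 - beta) _) e1 e2 => Q Q' Q'' e1 e2.
rewrite -e2.
transitivity (- ((1 - beta)%:C%C * (hyp1 a b beta z * hyp2 a b beta z)) * (Q * Q') +
  Q * Q'' * (hyp1 a b beta z * dhyp2 a b beta z - dhyp1 a b beta z * hyp2 a b beta z)); first by ring.
by rewrite e1 mulr1.
Qed.

(** The power of [1 - w] enters through its modulus only, so the form has no branch cut on the
    half-plane [0 < Re w], even beyond [Re w = 1]. *)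
Definition hform beta A B w : R := A * normc (hyp1 a b beta w) ^+ 2 -
  B * (normc (1 - w) `^ (1 - beta) * normc (hyp2 a b beta w)) ^+ 2.

End Connection.

(** * The connection formula *)

Section ConnectionFormula.
Context {R : realType}.
Variables (a b alpha beta : R).
Hypothesis adm : admissible a b alpha beta.
Implicit Types z : R[i].

Lemma local_value_gt0 : 0 < local_value b beta.
Proof.
have [b0 ba e [h1 h2 h3 h4]] := adm.
have s0 : 0 < 1 - beta by lra.
have p1 : 0 < beta - b by lra.
have p2 : 0 < b - beta + 1 by lra.
have p3 : 0 < 1 - b by lra.
exact: mulr_gt0 (mulr_gt0 s0 (Betaf_gt0 b0 p1)) (Betaf_gt0 p2 p3).
Qed.

(** [A * Betaf b (alpha - b) ^ 2] is the value of the form at the puncture 0, where the second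
    solution vanishes. The two products equal to 1 are the curvature normalizations in the two
    charts. *)
Lemma connection_formula : exists A B A1 B1 : R,
  [/\ 0 < A /\ 0 < B, 0 < A1 /\ 0 < B1,
    A * Betaf b (alpha - b) ^+ 2 * (delta a b alpha * (1 - alpha)) = 1,
    A * B * local_value b alpha ^+ 2 = 1 /\ A1 * B1 * local_value b beta ^+ 2 = 1 &
    forall z, in_strip z -> hform a b alpha A B (1 - z) = hform a b beta A1 B1 z].
Proof.
have [b0 ba e [h1 h2 h3 h4]] := adm.
have a0 : 0 < a by lra.
have a1 : a < 1 by lra.
have b1 : b < 1 by lra.
have al0 : 0 < alpha by lra.
have bal : b < alpha by lra.
have s0 : 0 < 1 - alpha by lra.
have p1 : 0 < alpha - b by lra.
have p2 : 0 < b - alpha + 1 by lra.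
have p3 : 0 < 1 - b by lra.
have p4 : 0 < b - beta + 1 by lra.
have p5 : 0 < beta - b by lra.
have p6 : 0 < a - beta + 1 by lra.
have q1 : alpha - a = b - beta + 1 by lra.
have q2 : alpha - b = a - beta + 1 by lra.
have q3 : a + 1 - alpha = beta - b by lra.
have D0 := delta_gt0 a0 a1 b0 b1 al0 h3 h1 bal.
have DB := delta_Betaf a0 a1 b0 b1 al0 h3 h1 bal.
rewrite q1 q3 [in X in _ = X]q2 in DB.
have su1 := solution_reflect (solution_hyp1 (admissible_sym adm)).
have su2 := solution_reflect (solution_sol2 (admissible_sym adm)).
have sv1 := solution_hyp1 adm; have sv2 := solution_sol2 adm.
have bu1 := boundary_data_reflect_hyp1 adm; have bu2 := boundary_data_reflect_sol2 adm.
have bv1 := boundary_data_hyp1 adm; have bv2 := boundary_data_sol2 adm.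
have U10 := Betaf_gt0 b0 p1; have U20 := Betaf_gt0 p2 p3.
have m10 := Betaf_gt0 b0 s0; have m20 := Betaf_gt0 p4 s0.
have n10 := mulr_gt0 a0 (Betaf_gt0 al0 p5); have n20 := mulr_gt0 p6 (Betaf_gt0 al0 p3).
have K0 := local_value_gt0.
have LV : local_value b alpha = Betaf b (alpha - b) * ((1 - alpha) * Betaf (b - alpha + 1) (1 - b)).
  rewrite /local_value; move: (Betaf b (alpha - b)) (Betaf _ _) => x y; ring.
rewrite LV; move: bu1 bu2 bv1 bv2 U10 U20 m10 m20 n10 n20 K0 D0 DB.
have V12 := wronskian_sol12 adm.
move: V12; move: (local_value b beta) (delta a b alpha).
move: (Betaf b (alpha - b)) (Betaf (b - alpha + 1) (1 - b)) (Betaf b (1 - alpha))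
  (Betaf (b - beta + 1) (1 - alpha)) (Betaf alpha (beta - b)) (Betaf alpha (1 - b)).
move=> U1 U2 m1 m2 k1 k2 K D V12 bu1 bu2 bv1 bv2 U10 U20 m10 m20 n10 n20 K0 D0 DB.
set n1 := a * k1 in n10 bv1; set n2 := (a - beta + 1) * k2 in n20 bv2.
set U2' := (1 - alpha) * U2 in bu2 *.
have U20' : 0 < U2' by exact: mulr_gt0.
set X := (D * (1 - alpha))^-1.
have DA : 0 < D * (1 - alpha) by exact: mulr_gt0.
have X0 : 0 < X by rewrite invr_gt0.
have XE : X ^+ 2 * (n1 * n2) = m1 * m2.
  have -> : n1 * n2 = (D * (1 - alpha)) ^+ 2 * (m1 * m2) by rewrite DB /n1 /n2; ring.
  by rewrite /X exprVn mulKf// expf_neq0// gt_eqF.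
have half : in_strip (2^-1%:C%C : R[i]).
  by rewrite /in_strip /= invr_gt0 ltr0n /= invf_lt1 ?ltr0n// ltr1n.
(* The Wronskian of the two solutions at 1 has been computed at the point 1, in [V12], and again
   from their data at 0. Equating the two values at the sample point [1 / 2] yields this relation
   between Beta values. *)
have KE : n2 * m1 - n1 * m2 = K.
  have := wronskianE h3 h4 sv1 sv2 bv1 bv2 half; rewrite V12// => /complexI h.
  by apply: oppr_inj; rewrite h; ring.
exists (X / U1 ^+ 2), ((X * U2' ^+ 2)^-1), (X * n2 / (m1 * K)), (X * n1 / (m2 * K)).
have AB1 : X * n2 / (m1 * K) * (X * n1 / (m2 * K)) * K ^+ 2 = 1.
  transitivity ((X ^+ 2 * (n1 * n2)) / (m1 * m2)); first by field; rewrite !gt_eqF.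
  by rewrite XE divff// gt_eqF// mulr_gt0.
split.
- by split; [apply: divr_gt0 => //; exact: exprn_gt0|rewrite invr_gt0 mulr_gt0// exprn_gt0].
- by split; apply: divr_gt0; exact: mulr_gt0.
- rewrite divfK ?expf_neq0 ?gt_eqF// /X mulVf// gt_eqF//.
- by split => //; field; rewrite !gt_eqF.
move=> z zs; have /andP[z0 z1] := zs.
pose u1 := hyp1 a b alpha (1 - z); pose u2 := sol2 a b alpha (1 - z).
pose v1 := hyp1 a b beta z; pose v2 := sol2 a b beta z.
have w11 := wronskianE h3 h4 su1 sv1 bu1 bv1 zs.
have w12 := wronskianE h3 h4 su1 sv2 bu1 bv2 zs.
have w21 := wronskianE h3 h4 su2 sv1 bu2 bv1 zs.
have w22 := wronskianE h3 h4 su2 sv2 bu2 bv2 zs.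
have vv := V12 z zs.
(* Cramer's rule: the coordinates of [u1] in the basis [v1], [v2] are quotients of Wronskians, and
   all of these are known constants. *)
have e1 : u1 * K%:C%C = U1%:C%C * (n2%:C%C * v1 - n1%:C%C * v2).
  have -> : K%:C%C = - (- K)%:C%C :> R[i] by rewrite rmorphN opprK.
  rewrite -vv.
  transitivity (- (v1 * (U1 * - n2 - 0 * m2)%:C%C - v2 * (U1 * - n1 - 0 * m1)%:C%C)).
    by rewrite -w11 -w12 /wronskian /u1 /v1 /v2; ring.
  by rewrite !(rmorphB, rmorphM, rmorphN) rmorph0; ring.
have e2 : u2 * K%:C%C = U2'%:C%C * (m2%:C%C * v1 - m1%:C%C * v2).
  have -> : K%:C%C = - (- K)%:C%C :> R[i] by rewrite rmorphN opprK.
  rewrite -vv.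
  transitivity (- (v1 * (0 * - n2 - U2' * m2)%:C%C - v2 * (0 * - n1 - U2' * m1)%:C%C)).
    by rewrite -w21 -w22 /wronskian /u2 /v1 /v2; ring.
  by rewrite !(rmorphB, rmorphM, rmorphN) rmorph0; ring.
have := hermitian_change U10 U20' m10 m20 n10 n20 K0 X0 KE XE e1 e2.
have n2E (w : R[i]) (be : R) : w != 1 -> normc (sol2 a b be w) = normc (1 - w) `^ (1 - be) * normc (hyp2 a b be w).
  by move=> w1; rewrite /sol2 normcMc normc_cpow// subr_eq0 eq_sym.
have zn1 : z != 1 by apply: contraTneq z1 => ->; rewrite ltxx.
have zn0 : 1 - z != 1 by exact: reflect_neq1 (Re_gt0_neq0 z0).
by rewrite /u2 /v2 !n2E.
Qed.

End ConnectionFormula.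

(** * Neighbourhoods and limits in terms of the modulus *)

Section ComplexNeighbourhoods.
Context {R : realType}.
Implicit Types (z w h p d : R[i]) (f : R[i] -> R[i]) (g : R[i] -> R).

Lemma norm_normc (z : R[i]) : `|z| = (normc z)%:C%C.
Proof. by case: z. Qed.

(** Radii of balls in [R[i]^o] are positive elements of [R[i]]; for the order on [R[i]] these have
    zero imaginary part, so they are real radii. *)
Lemma nbhs_normc (z : R[i]) (P : set R[i]) :
  nbhs (z : R[i]^o) P <-> exists r : R, 0 < r /\ forall h, normc h < r -> P (z + h).
Proof.
split.
  move=> /nbhs_ballP[e /= e0 be]; exists (Re e).
  have eE : e = (Re e)%:C%C.
    by move: e0; case: (e) => x y; rewrite ltcE /= => /andP[/eqP -> _].
  split; first by move: e0; rewrite eE ltcE /= => /andP[].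
  move=> h hr; apply: be; rewrite /ball /= opprD addNKr normrN norm_normc eE.
  by rewrite ltcE /= eqxx.
move=> [r [r0 hP]]; apply/nbhs_ballP; exists r%:C%C; first by rewrite /= ltcE /= eqxx.
move=> w; rewrite /ball /= norm_normc ltcE /= => /andP[_ wr].
have -> : w = z + (w - z) by rewrite addrC subrK.
by apply: hP; rewrite normcBC.
Qed.

Lemma near_normc z (P : set R[i]) : (exists r : R, 0 < r /\ forall h, normc h < r -> P (z + h)) ->
  \forall w \near (z : R[i]^o), P w.
Proof. by move/nbhs_normc. Qed.

Lemma cvg_normc g z (l : R) : g w @[w --> (z : R[i]^o)] --> l <->
  forall e : R, 0 < e -> exists r : R, 0 < r /\ forall h, normc h < r -> `|g (z + h) - l| < e.
Proof.
split.
  move=> /cvgrPdist_lt gl e /gl /nbhs_normc [r [r0 hr]]; exists r; split=> // h /hr.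
  by rewrite distrC.
move=> H; have FF : Filter (nbhs (z : R[i]^o)) by exact: nbhs_filter.
have K := (@cvgrPdist_lt R R _ _ FF g l).2; apply: K => e e0; have [r [r0 hr]] := H e e0.
apply: near_normc; exists r; split=> // h /hr.
by rewrite /= distrC.
Qed.

Lemma expand_cvg g z p (c : R) : expand g z p c -> g w @[w --> (z : R[i]^o)] --> g z.
Proof.
move=> [q hq]; apply/cvg_normc => e e0.
have : rbigO 1 (fun h => g (z + h) - g z).
  have h1 := bigO_mono (isT : (1 <= 3)%N) hq.
  have h2 := bigO_mono (isT : (1 <= 2)%N) (rbigO_quad q c).
  have h3 := rbigOD h1 (rbigOD (rbigO_lin p) h2).
  by apply: rbigO_ext h3 => h; ring.
move=> /bigO_ge0[K [r [r0 r1 K0 hK]]].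
have K1 : 0 < K + 1 by lra.
exists (Num.min r (e / (K + 1))); rewrite lt_min r0 divr_gt0//; split=> // h.
rewrite lt_min => /andP[/hK]; rewrite normc_real expr1 => h1 h2; apply: le_lt_trans h1 _.
rewrite ltr_pdivlMr// in h2; have := normc_ge0 h; nra.
Qed.

Lemma cdiff_normc_cvg f z d : cdiff f z d ->
  normc (f w) ^+ 2 @[w --> (z : R[i]^o)] --> normc (f z) ^+ 2.
Proof. by move=> /expand_sqr_normc/expand_cvg. Qed.

Lemma ler_normcB z w : `|normc z - normc w| <= normc (z - w).
Proof.
have := normcDc (z - w) w; have := normcDc (w - z) z.
rewrite !subrK normcBC ler_norml => h1 h2; apply/andP; split; lra.
Qed.

Lemma normc_affine_cvg p d z :
  normc (p + d * w) @[w --> (z : R[i]^o)] --> normc (p + d * z).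
Proof.
apply/cvg_normc => e e0; have d1 : 0 < 1 + normc d by rewrite ltr_pwDl// normc_ge0.
exists (e / (1 + normc d)); split; first exact: divr_gt0.
move=> h; rewrite ltr_pdivlMr// => hr.
apply: le_lt_trans (ler_normcB _ _) _.
have -> : p + d * (z + h) - (p + d * z) = d * h by ring.
by apply: le_lt_trans hr; rewrite normcMc mulrC ler_wpM2l ?normc_ge0// lerDr.
Qed.

Lemma normc_cvg z : normc w @[w --> (z : R[i]^o)] --> normc z.
Proof.
have := @normc_affine_cvg 0 1 z; rewrite add0r mul1r.
by under eq_fun do rewrite add0r mul1r.
Qed.

Lemma normc_1B_cvg z : normc (1 - w) @[w --> (z : R[i]^o)] --> normc (1 - z).
Proof.
have := @normc_affine_cvg 1 (-1) z; rewrite mulN1r.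
by under eq_fun do rewrite mulN1r.
Qed.

(** Half the logarithm of the squared modulus; the two contributions to its Laplacian in [expand_ln]
    cancel, which is the harmonicity of [ln |w|]. *)
Lemma expand_ln_normc_affine p d z : d != 0 -> p + d * z != 0 ->
  exists q, expand (fun w => ln (normc (p + d * w))) z q 0.
Proof.
move=> d0 w0; have n0 : 0 < normc (p + d * z) ^+ 2 by rewrite exprn_gt0// normc_gt0.
have e1 := expand_sqr_normc (cdiff_affine p d z).
have e2 := expandZ 2^-1 (expand_ln n0 e1).
eexists; apply: (expand_eq (expand_near _ e2)); last first.
- rewrite !normcMc [normc (_^*)%C](_ : _ = normc (p + d * z)); last first.
    by case: (p + d * z) => x y /=; rewrite sqrrN.
  rewrite (_ : normc 2 = 2); last by rewrite -(rmorph_nat (real_complex R)) normc_real normr_nat.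
  have n1 : 0 < normc (p + d * z) by rewrite normc_gt0.
  by field; rewrite gt_eqF.
- reflexivity.
exists (normc (p + d * z) / (1 + normc d)); have d1 : 0 < 1 + normc d by rewrite ltr_pwDl// normc_ge0.
split; first by rewrite divr_gt0// normc_gt0.
move=> h; rewrite ltr_pdivlMr// => hr.
have n1 : 0 < normc (p + d * (z + h)).
  have := ler_normcB (p + d * (z + h)) (p + d * z).
  have -> : p + d * (z + h) - (p + d * z) = d * h by ring.
  rewrite normcMc ler_norml => /andP[k _]; have := normc_ge0 h; nra.
by rewrite lnXn// -(mulr_natr (ln _)) mulrC mulfK ?pnatr_eq0.
Qed.

(** The potential of the spherical metric: its Laplacian is [4 / (1 + |z| ^ 2) ^ 2]. *)
Lemma expand_ln_1D_sqr z : exists q,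
  expand (fun w => ln (1 + normc w ^+ 2)) z q ((1 + normc z ^+ 2)^-1 ^+ 2).
Proof.
have g0 : 0 < 1 + normc z ^+ 2 by rewrite ltr_pwDl// sqr_ge0.
have e1 := expandD (expand_cst 1 z) (expand_sqr_normc (cdiff_id z)).
eexists; apply: (expand_eq (expand_ln g0 e1)); first reflexivity.
rewrite !add0r mulr1 !normcMc [normc (_^*)%C](_ : _ = normc z); last first.
  by case: (z) => x y /=; rewrite sqrrN.
rewrite (_ : normc 2 = 2); last by rewrite -(rmorph_nat (real_complex R)) normc_real normr_nat.
by rewrite Normc.normc1; field; rewrite gt_eqF.
Qed.

End ComplexNeighbourhoods.

(** * Curvature of the comparison metric in one chart *)

Section DensityExpansion.
Context {R : realType}.
Variables (a b alpha beta A B : R).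
Hypothesis adm : admissible a b alpha beta.
Implicit Types (z w h : R[i]).

Definition chart_density w : R :=
  normc w `^ alpha * normc (1 - w) `^ beta * hform a b beta A B w.

(** Rests on the identity [N (A |a1| ^ 2 - B |b1| ^ 2) - |A conj(a0) a1 - B conj(b0) b1| ^ 2 = - A B
    |a0 b1 - a1 b0| ^ 2]. For a form in two holomorphic functions the Laplacian of [ln N] thus
    depends only on [N] and on the Wronskian. *)
Lemma hermitian_laplacian (a0 a1 b0 b1 : R[i]) (N : R) :
  N = A * normc a0 ^+ 2 - B * normc b0 ^+ 2 -> N != 0 ->
  (A * normc a1 ^+ 2 + - B * normc b1 ^+ 2) / N -
  normc (A%:C%C * (2 * a0^*%C * a1) + (- B)%:C%C * (2 * b0^*%C * b1)) ^+ 2 / (4 * N ^+ 2) =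
  - (A * B * normc (a0 * b1 - a1 * b0) ^+ 2) / N ^+ 2.
Proof.
move=> NE N0.
have -> : normc (A%:C%C * (2 * a0^*%C * a1) + (- B)%:C%C * (2 * b0^*%C * b1)) ^+ 2 =
   4 * (N * (A * normc a1 ^+ 2 - B * normc b1 ^+ 2) + A * B * normc (a0 * b1 - a1 * b0) ^+ 2).
  rewrite NE !sqr_normcE; case: a0 {NE} => x x'; case: a1 => y y'; case: b0 => u u'; case: b1 => v v' /=.
  ring.
by field.
Qed.

Lemma hform_branch z : z != 1 -> 0 < Re z -> exists (f2 : R[i] -> R[i]) d2,
  [/\ cdiff f2 z d2, exists r : R, 0 < r /\ forall h, normc h < r ->
      normc (f2 (z + h)) = normc (1 - (z + h)) `^ (1 - beta) * normc (hyp2 a b beta (z + h)) &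
    normc (hyp1 a b beta z * d2 - dhyp1 a b beta z * f2 z) =
    normc (1 - z) `^ (- beta) * normc (local_wronskian a b beta z)].
Proof.
move=> z1 z0; have [b0 ba e [h1 h2 h3 h4]] := adm.
have y0 : 1 - z != 0 by rewrite subr_eq0 eq_sym.
have n0 : 0 < normc (1 - z) by rewrite normc_gt0.
pose k := (normc (1 - z) `^ (1 - beta))%:C%C : R[i].
pose p := (1 - z)^-1; pose q := - (1 - z)^-1.
have pq w : p + q * w = (1 - w) / (1 - z) by rewrite /p /q mulrBl mul1r mulNr mulrC.
have pqz : p + q * z = 1 by rewrite pq divff.
have s1 : 1 - beta <= 1 by lra.
have c1 : cdiff (cpow (1 - beta)) (p + q * z) (1 - beta)%:C%C.
  rewrite pqz; apply: cdiff_eq (cdiff_cpow s1 _) _; first by rewrite /= ltr01.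
  have -> : cpow (1 - beta - 1) 1 = 1 :> R[i] by rewrite (cpow_real _ (@ltr01 R)) powR1.
  by rewrite mulr1.
have c1z : cpow (1 - beta) (p + q * z) = 1 :> R[i].
  by rewrite pqz (cpow_real _ (@ltr01 R)) powR1.
have c2 := cdiffZ k (cdiffM (cdiff_comp_affine c1) (cdiff_hyp2 adm z0)).
exists (fun w => k * (cpow (1 - beta) (p + q * w) * hyp2 a b beta w)); eexists; split; first exact: c2.
- exists (normc (1 - z)); split => // h hr.
  have w0 : 1 - (z + h) != 0.
    rewrite -normc_gt0; have := ler_normcB (1 - (z + h)) (1 - z).
    have -> : 1 - (z + h) - (1 - z) = - h by ring.
    by rewrite normcNc ler_norml => /andP[]; lra.
  have p0 : p + q * (z + h) != 0 by rewrite pq mulf_neq0 ?invr_eq0.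
  rewrite !normcMc mulrA; congr (_ * _).
  rewrite /k normc_real ger0_norm ?powR_ge0// normc_cpow// -powRM ?normc_ge0// -normcMc pq.
  by rewrite mulrC divfK.
rewrite /= c1z !mul1r.
have -> : hyp1 a b beta z * (k * ((1 - beta)%:C%C * q * hyp2 a b beta z + dhyp2 a b beta z))
   - dhyp1 a b beta z * (k * hyp2 a b beta z) = k * ((1 - z)^-1 * local_wronskian a b beta z).
  rewrite /local_wronskian /q.
  move: (hyp1 _ _ _ _) (hyp2 _ _ _ _) (dhyp1 _ _ _ _) (dhyp2 _ _ _ _) => P1 P2 Q1 Q2.
  by field; exact: y0.
rewrite !normcMc Normc.normcV /k normc_real ger0_norm ?powR_ge0// mulrA; congr (_ * _).
rewrite -[X in _ * X]powR_inv1 ?normc_ge0// -powRDp//; congr (_ `^ _); ring.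
Qed.

Lemma hform_expand z : z != 1 -> 0 < Re z -> exists p c, expand (hform a b beta A B) z p c /\
  (hform a b beta A B z != 0 -> c / hform a b beta A B z - normc p ^+ 2 / (4 * hform a b beta A B z ^+ 2) =
   - (A * B * (normc (1 - z) `^ (- beta) * normc (local_wronskian a b beta z)) ^+ 2) / hform a b beta A B z ^+ 2).
Proof.
move=> z1 z0; have [f2 [d2 [df2 fE WE]]] := hform_branch z1 z0.
have e1 := expand_sqr_normc (cdiff_hyp1 adm z0).
have e2 := expand_sqr_normc df2.
have e3 := expandD (expandZ A e1) (expandZ (- B) e2).
have hE : exists r : R, 0 < r /\ forall h, normc h < r ->
    A * normc (hyp1 a b beta (z + h)) ^+ 2 + - B * normc (f2 (z + h)) ^+ 2 = hform a b beta A B (z + h).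
  have [r [r0 hr]] := fE; exists r; split=> // h /hr ->.
  by rewrite /hform mulNr.
eexists; eexists; split; first exact: (expand_near hE e3).
move=> h0; rewrite -WE; apply: hermitian_laplacian => //.
by have [r [r0 hr]] := hE; have := hr 0; rewrite addr0 Normc.normc0 => /(_ r0) <-; rewrite mulNr.
Qed.

Lemma chart_density_cvg z : z != 1 -> 0 < Re z ->
  chart_density w @[w --> (z : R[i]^o)] --> chart_density z.
Proof.
move=> z1 z0; have [p [c [/expand_cvg h _]]] := hform_expand z1 z0.
have n0 : 0 < normc z by rewrite normc_gt0 Re_gt0_neq0.
have n1 : 0 < normc (1 - z) by rewrite normc_gt0 subr_eq0 eq_sym.
have k0 : normc w `^ alpha @[w --> (z : R[i]^o)] --> normc z `^ alpha.
  exact: (@cvg_comp _ _ _ (fun w : R[i]^o => normc w) (@powR R ^~ alpha) _ _ _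
    (@normc_cvg _ z) (continuous_powR_pos n0)).
have k1 : normc (1 - w) `^ beta @[w --> (z : R[i]^o)] --> normc (1 - z) `^ beta.
  exact: (@cvg_comp _ _ _ (fun w : R[i]^o => normc (1 - w)) (@powR R ^~ beta) _ _ _
    (@normc_1B_cvg _ z) (continuous_powR_pos n1)).
exact: (cvgM (cvgM k0 k1) h).
Qed.

(** The two powers have harmonic logarithms, so only the form contributes. By [local_wronskianE] its
    Wronskian has modulus [local_value / (|z| ^ alpha |1 - z| ^ beta)], and the normalization of
    [A B] turns the result into [- 1 / D ^ 2]. *)
Lemma ln_chart_density_expand z : z != 1 -> 0 < Re z -> 0 < chart_density z ->
  A * B * local_value b beta ^+ 2 = 1 ->
  exists p, expand (fun w => ln (chart_density w)) z p (- (chart_density z)^-1 ^+ 2).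
Proof.
move=> z1 z0 D0 AB.
have zn : z != 0 by exact: Re_gt0_neq0.
have yn : 1 - z != 0 by rewrite subr_eq0 eq_sym.
have n0 : 0 < normc z by rewrite normc_gt0.
have n1 : 0 < normc (1 - z) by rewrite normc_gt0.
have H0 : 0 < hform a b beta A B z.
  by move: D0; rewrite /chart_density pmulr_rgt0// mulr_gt0 ?powR_gt0.
have [p [c [eh cE]]] := hform_expand z1 z0.
have [q1 e1] : exists q, expand (fun w => ln (normc w)) z q 0.
  have [|q h] := @expand_ln_normc_affine R 0 1 z (oner_neq0 _); first by rewrite add0r mul1r.
  exists q; apply: expand_near h; exists 1; split=> // h _; by rewrite add0r mul1r.
have [q2 e2] : exists q, expand (fun w => ln (normc (1 - w))) z q 0.
  have m1 : -1 != 0 :> R[i] by rewrite oppr_eq0 oner_neq0.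
  have [|q h] := @expand_ln_normc_affine R 1 (-1) z m1; first by rewrite mulN1r.
  exists q; apply: expand_near h; exists 1; split=> // h _; by rewrite mulN1r.
have e3 := expandD (expandD (expandZ alpha e1) (expandZ beta e2)) (expand_ln H0 eh).
eexists; apply: (expand_eq (expand_near _ e3)); first last.
- rewrite !mulr0 !add0r cE ?gt_eqF//.
  have LW : normc z `^ alpha * normc (local_wronskian a b beta z) = local_value b beta.
    have := congr1 (@normc R) (local_wronskianE adm z0).
    by rewrite normcMc normc_cpow// normc_real normrN gtr0_norm//; exact: (local_value_gt0 adm).
  have -> : normc (local_wronskian a b beta z) = (normc z `^ alpha)^-1 * local_value b beta.
    by rewrite -LW mulKf// gt_eqF// powR_gt0.
  rewrite /chart_density powRN.
  have -> : A * B * ((normc (1 - z) `^ beta)^-1 * ((normc z `^ alpha)^-1 * local_value b beta)) ^+ 2 =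
     ((normc (1 - z) `^ beta)^-1 * (normc z `^ alpha)^-1) ^+ 2 * (A * B * local_value b beta ^+ 2).
    by ring.
  rewrite AB mulr1; have := powR_gt0 alpha n0; have := powR_gt0 beta n1.
  move: (_ `^ beta) (_ `^ alpha) H0 => u v; move: (hform _ _ _ _ _ _) => N N0 u0 v0.
  by field; rewrite !gt_eqF.
- reflexivity.
have /cvg_normc/(_ _ H0) [r [r0 hr]] := expand_cvg eh.
exists (Num.min r (Num.min (normc z) (normc (1 - z)))); rewrite !lt_min r0 n0 n1; split=> // h.
rewrite !lt_min => /and3P[/hr hH hz hy].
have m0 : 0 < normc (z + h).
  have := ler_normcB (z + h) z; have -> : z + h - z = h by ring.
  by rewrite ler_norml => /andP[]; lra.
have m1 : 0 < normc (1 - (z + h)).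
  have := ler_normcB (1 - (z + h)) (1 - z).
  have -> : 1 - (z + h) - (1 - z) = - h by ring.
  by rewrite normcNc ler_norml => /andP[]; lra.
have mH : 0 < hform a b beta A B (z + h) by move: hH; rewrite ltr_distl subrr => /andP[].
by rewrite /chart_density !lnM ?posrE ?mulr_gt0 ?powR_gt0// !ln_powR.
Qed.

End DensityExpansion.

(** * Gluing the two charts and growth at infinity *)

Section GluedDensity.
Context {R : realType}.
Variables (a b alpha beta A B A1 B1 : R).
Hypothesis adm : admissible a b alpha beta.
Hypotheses (A0 : 0 < A) (B0 : 0 < B) (A10 : 0 < A1) (B10 : 0 < B1).
Hypothesis glue : forall z, in_strip z -> hform a b alpha A B (1 - z) = hform a b beta A1 B1 z.
Implicit Types (z w h p d : R[i]) (g : R[i] -> R).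

(** By [glue] the second formula holds on all of [0 < Re z], so the cut leaves no seam: around every
    point one of the two formulas is valid on a whole neighbourhood. *)
Definition density z : R :=
  if Re z < 1 then chart_density a b beta alpha A B (1 - z)
  else chart_density a b alpha beta A1 B1 z.

Lemma density_left z : Re z < 1 -> density z = chart_density a b beta alpha A B (1 - z).
Proof. by move=> z1; rewrite /density z1. Qed.

Lemma density_right z : 0 < Re z -> density z = chart_density a b alpha beta A1 B1 z.
Proof.
move=> z0; rewrite /density; case: ifPn => [z1|_]; last by [].
rewrite /chart_density glue /in_strip ?z0// subKr.
by rewrite [normc (1 - z) `^ _ * _]mulrC.
Qed.

Lemma expand_reflect g z p (c : R) : expand g (1 - z) p c ->
  expand (fun w => g (1 - w)) z (- p) c.
Proof.
move=> [q [K [r [r0 hK]]]]; exists q, K, r; split=> // h hr.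
have := hK (- h); rewrite normcNc => /(_ hr); rewrite sqrrN mulrN -mulNr.
by have -> : 1 - (z + h) = 1 - z - h by ring.
Qed.

Lemma cvg_reflect g z (l : R) : g w @[w --> ((1 - z : R[i]) : R[i]^o)] --> l ->
  g (1 - w) @[w --> (z : R[i]^o)] --> l.
Proof.
move=> /cvg_normc H; apply/cvg_normc => e /H [r [r0 hr]]; exists r; split=> // h hh.
have -> : 1 - (z + h) = 1 - z + - h by ring.
by apply: hr; rewrite normcNc.
Qed.

Lemma cvg_near_eq g1 g2 z (l : R) : (exists r : R, 0 < r /\ forall h, normc h < r ->
   g1 (z + h) = g2 (z + h)) -> g1 w @[w --> (z : R[i]^o)] --> l -> g2 w @[w --> (z : R[i]^o)] --> l.
Proof.
move=> [s [s0 hs]] /cvg_normc H; apply/cvg_normc => e /H [r [r0 hr]].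
exists (Num.min r s); rewrite lt_min r0 s0; split=> // h; rewrite lt_min => /andP[/hr h1 /hs <-].
exact: h1.
Qed.

Lemma Re_lt1_near z : Re z < 1 -> exists r : R, 0 < r /\ forall h, normc h < r -> Re (z + h) < 1.
Proof.
move=> z1; exists (1 - Re z); rewrite subr_gt0; split=> // h hr; rewrite ReD.
by have := le_lt_trans (normr_Re_le h) hr; rewrite ltr_norml => /andP[_]; lra.
Qed.

Lemma density_cvg z : z != 0 -> z != 1 -> density w @[w --> (z : R[i]^o)] --> density z.
Proof.
move=> z0 z1; have [zl|zr] := ltP (Re z) 1.
  rewrite (density_left zl); have [r [r0 hr]] := Re_lt1_near zl.
  apply: (@cvg_near_eq (fun w => chart_density a b beta alpha A B (1 - w))).
    by exists r; split=> // h /hr k; rewrite density_left.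
  apply: (@cvg_reflect (chart_density a b beta alpha A B)).
  exact: (@chart_density_cvg _ _ _ _ _ A B (admissible_sym adm) _ (reflect_neq1 z0) (Re_1B_gt0 zl)).
have zp : 0 < Re z by exact: lt_le_trans zr.
rewrite (density_right zp); have [r [r0 hr]] := Re_gt0_near zp.
apply: (@cvg_near_eq (chart_density a b alpha beta A1 B1)).
  by exists r; split=> // h /hr k; rewrite density_right.
exact: (@chart_density_cvg _ _ _ _ _ A1 B1 adm).
Qed.

Lemma density_expand z : A * B * local_value b alpha ^+ 2 = 1 ->
  A1 * B1 * local_value b beta ^+ 2 = 1 -> z != 0 -> z != 1 -> 0 < density z ->
  exists p, expand (fun w => ln (density w)) z p (- (density z)^-1 ^+ 2).
Proof.
move=> AB AB1 z0 z1; have [zl|zr] := ltP (Re z) 1.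
  rewrite (density_left zl) => D0; have [r [r0 hr]] := Re_lt1_near zl.
  have [p hp] := ln_chart_density_expand (admissible_sym adm) (reflect_neq1 z0) (Re_1B_gt0 zl) D0 AB.
  exists (- p); apply: expand_near (expand_reflect hp).
  by exists r; split=> // h /hr k; rewrite density_left.
have zp : 0 < Re z by exact: lt_le_trans zr.
rewrite (density_right zp) => D0; have [r [r0 hr]] := Re_gt0_near zp.
have [p hp] := ln_chart_density_expand adm z1 zp D0 AB1.
exists p; apply: expand_near hp.
by exists r; split=> // h /hr k; rewrite density_right.
Qed.

(** The negative term is dropped, and the decay of [hyp1] is used with [sg = b - e / 2], as close to
    [b] as convergence of the integral at 0 permits. *)
Lemma hform_le (be C D e : R) : 0 < C -> 0 < D -> a + b + 1 < 2 + be -> a < be -> 0 < b -> b <= a ->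
  0 < e -> e < b -> e < be - a ->
  exists2 K : R, 0 <= K & forall w (m : R), 0 < Re w -> 0 < m -> m <= normc w ->
    hform a b be C D w <= K * m `^ (- (2 * b - e)).
Proof.
move=> C0 D0 _ abe b0 ba e0 eb ea.
have a0 : 0 < a by lra.
have bbe : b < be by lra.
have s0 : 0 <= b - e / 2 by lra.
have sa : b - e / 2 <= a by lra.
have bs : 0 < b - (b - e / 2) by lra.
have co : a + (b - (b - e / 2)) - be < 0 by lra.
have [K K0 hK] := normc_hyp_le a0 b0 bbe s0 sa bs co.
exists (C * K ^+ 2); first by rewrite mulr_ge0 ?(ltW C0) ?exprn_ge0.
move=> w m w0 m0 mw; rewrite /hform.
have wn : 0 < normc w by exact: lt_le_trans mw.
apply: (@le_trans _ _ (C * normc (hyp1 a b be w) ^+ 2)).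
  by rewrite gerBl mulr_ge0 ?(ltW D0)// sqr_ge0.
rewrite -mulrA ler_pM2l//.
have -> : m `^ (- (2 * b - e)) = (m `^ (- (b - e / 2))) ^+ 2.
  by rewrite expr2 -powRDp//; congr (_ `^ _); lra.
rewrite -exprMn lerXn2r ?nnegrE ?mulr_ge0 ?normc_ge0 ?powR_ge0//.
apply: le_trans (hK w w0) _; rewrite ler_wpM2l//.
rewrite !powRN lef_pV2 ?posrE ?powR_gt0//.
by apply: (ge0_ler_powR s0); rewrite ?nnegrE ?normc_ge0 ?(ltW m0).
Qed.

Lemma density_le e : 0 < e -> e < b -> e < alpha - a -> e < beta - a ->
  exists2 K : R, 0 <= K & forall z, density z <=
    K * (normc z `^ alpha * normc (1 - z) `^ beta * (1 + normc z) `^ (- (2 * b - e))).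
Proof.
move=> e0 eb eal ebe; have [b0 ba ab [h1 h2 h3 h4]] := adm.
have [K K0 hK] := @hform_le alpha A B e A0 B0 ltac:(lra) h1 b0 ba e0 eb eal.
have [L L0 hL] := @hform_le beta A1 B1 e A10 B10 ltac:(lra) h2 b0 ba e0 eb ebe.
(* With the plane split at [Re z = 1 / 2], the coordinate of the chart in use has modulus at least
   [(1 + |z|) / 5]; this is the [m] passed to the bounds [hK] and [hL]. *)
pose c := 5 `^ (2 * b - e) : R.
have c0 : 0 <= c by exact: powR_ge0.
exists ((K + L) * c); first by rewrite mulr_ge0 ?addr_ge0.
move=> z.
have n0 := normc_ge0 z; have p0 : 0 < 1 + normc z by lra.
have P0 : 0 <= normc z `^ alpha * normc (1 - z) `^ beta by rewrite mulr_ge0 ?powR_ge0.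
have key (M m H : R) : 0 <= M -> M <= K + L -> H <= M * ((1 + normc z) / 5) `^ (- (2 * b - e)) ->
    normc z `^ alpha * normc (1 - z) `^ beta * H <=
    (K + L) * c * (normc z `^ alpha * normc (1 - z) `^ beta * (1 + normc z) `^ (- (2 * b - e))).
  move=> M0 MKL hH; rewrite mulrCA ler_wpM2l// ; apply: le_trans hH _.
  have -> : ((1 + normc z) / 5) `^ (- (2 * b - e)) = c * (1 + normc z) `^ (- (2 * b - e)).
    rewrite powRM ?invr_ge0 ?(ltW p0)// mulrC; congr (_ * _).
    by rewrite -powR_inv1// -powRrM /c; congr (_ `^ _); ring.
  by rewrite mulrA ler_wpM2r ?powR_ge0// ler_wpM2r.
have t := normcDc z (1 - z); have t2 := normcDc (1 - z) (- (1 : R[i])).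
have [zl|zr] := leP (Re z) 2^-1.
  have zl1 : Re z < 1 by apply: le_lt_trans zl _; rewrite invf_lt1 ?ltr0n// ltr1n.
  have w0 := Re_1B_gt0 zl1.
  have rw : 1 - Re z <= normc (1 - z) by apply: le_trans (Re_le_normc _); rewrite ReD ReN.
  have t3 : normc z <= normc (1 - z) + 1.
    have := normcDc (- (1 - z)) 1; rewrite normcNc Normc.normc1.
    by have -> : - (1 - z) + 1 = z by ring.
  rewrite density_left// /chart_density subKr [normc (1 - z) `^ _ * _]mulrC.
  apply: (key K 0); rewrite ?lerDl//.
  apply: hK => //; first by rewrite divr_gt0.
  by rewrite ler_pdivrMr//; lra.
have zp : 0 < Re z by apply: lt_trans zr; rewrite invr_gt0 ltr0n.
rewrite density_right// /chart_density; apply: (key L 0); rewrite ?lerDr//.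
apply: hL => //; first by rewrite divr_gt0.
have := Re_le_normc z; rewrite ler_pdivrMr//; lra.
Qed.

End GluedDensity.

(** * Maxima of upper semi-continuous functions *)

Section MaximumOnSquare.
Context {R : realType}.
Implicit Types (z w h : R[i]) (f : R[i] -> R).

Definition usc_at f z := forall y, f z < y ->
  exists r : R, 0 < r /\ forall h, normc h < r -> f (z + h) < y.

(** Compactness of the square containing the disc is used twice, each time for the open sets
    [F < i]: with [i] near infinity it bounds [F], and with [i] just below an unattained supremum it
    would give a smaller upper bound. The maximum point may lie outside the disc. *)
Lemma usc_max_on_square f (M : R) : 0 < M -> (forall z, usc_at f z) ->
  exists z0, forall z, normc z <= M -> f z <= f z0.
Proof.
move=> M0 uf; pose F (p : R * R) := f (p.1 +i* p.2)%C.
pose I : set R := `[- M, M]%classic; pose K : set (R * R) := I `*` I.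
have cK : compact K by apply: compact_setX; exact: segment_compact.
have uF p y : F p < y -> \forall p' \near p, F p' < y.
  move=> /uf [r [r0 hr]]; have r2 : 0 < r / 2 by rewrite divr_gt0.
  apply/nbhs_ballP; exists (r / 2) => //= q [b1 b2].
  rewrite /F; have -> : (q.1 +i* q.2)%C = (p.1 +i* p.2)%C + ((q.1 - p.1) +i* (q.2 - p.2))%C.
    by apply: complex_ext => /=; ring.
  apply: hr; apply: le_lt_trans (normc_le_ReIm _) _ => /=.
  rewrite /ball /= distrC in b1; rewrite /ball /= distrC in b2.
  by rewrite [r]splitr ltrD.
have inK z : normc z <= M -> K (Re z, Im z).
  move=> zM; rewrite /K /I /=; split; rewrite /= in_itv /= -ler_norml; apply: le_trans zM.
    exact: normr_Re_le.
  exact: normr_Im_le.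
have FE z : F (Re z, Im z) = f z by rewrite /F; case: z.
have nc := cK; rewrite compact_near_coveringP in nc.
have prodP p y (G : set_system R) : Filter G -> F p < y -> (\forall i \near G, y < i) ->
    \forall p' \near p & i \near G, F p' < i.
  move=> FG /uF h1 h2; exists ([set p' | F p' < y], [set i | y < i]) => //.
  by move=> [p' i] /= [k1 k2]; exact: lt_trans k1 k2.
have [i0 hi0] : exists i0 : R, forall p, K p -> F p < i0.
  have near_i : \forall i \near +oo%R, K `<=` (fun p => F p < i).
    apply: (nc R (+oo%R : set_system R) (fun i p => F p < i)) => p Kp.
    apply: (prodP p (F p + 1)); first by rewrite ltrDl.
    by apply: nbhs_pinfty_gt; rewrite num_real.
  by have [i hi] := filter_ex near_i; exists i => p /hi.
pose S := F @` K.
have K0 : K (0, 0) by have := inK 0; rewrite Normc.normc0 => /(_ (ltW M0)).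
have hS : has_sup S.
  split; first by exists (F (0, 0)), (0, 0).
  by exists i0 => _ [p Kp <-]; rewrite ltW// hi0.
have leS p : K p -> F p <= sup S by move=> Kp; apply: sup_upper_bound => //; exists p.
have [[p Kp pS]|no] := pselect (exists2 p, K p & F p = sup S).
  by exists (p.1 +i* p.2)%C => z /inK Kz; rewrite -FE -/(F p) pS leS.
exfalso.
have ltS p : K p -> F p < sup S.
  by move=> Kp; rewrite lt_neqAle leS// andbT; apply/eqP => e; apply: no; exists p.
have near_i : \forall i \near (sup S)^'-, K `<=` (fun p => F p < i).
  apply: (nc R ((sup S)^'-) (fun i p => F p < i)) => p Kp.
  have pS := ltS p Kp; apply: (prodP p ((F p + sup S) / 2)); first by lra.
  by apply: nbhs_left_gt; lra.
have near_S : \forall i \near (sup S)^'-, i < sup S by exact: nbhs_left_lt.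
have [i [hi iS]] := filter_ex (filterI near_i near_S).
have : sup S <= i.
  apply: ge_sup; first by exists (F (0, 0)), (0, 0).
  by move=> _ [p Kp <-]; rewrite ltW// hi.
by rewrite leNgt iS.
Qed.

End MaximumOnSquare.

(** * The barrier function *)

Section Barrier.
Context {R : realType}.
Implicit Types (z w h : R[i]).

(* Its logarithm is [-oo] at the three punctures and has Laplacian [- 8 / (1 + |z| ^ 2) ^ 2]
   elsewhere, so that [barrier ^ e] forces the maximum principle at a small cost. *)
Definition barrier z : R := normc z * normc (1 - z) / (1 + normc z ^+ 2) ^+ 2.

Lemma normc_1B_le z : normc (1 - z) <= 1 + normc z.
Proof. by have := normcDc 1 (- z); rewrite normcNc Normc.normc1. Qed.

Lemma barrier_ge0 z : 0 <= barrier z.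
Proof. by apply: divr_ge0; [rewrite mulr_ge0 ?normc_ge0|exact: sqr_ge0]. Qed.

Lemma barrier_gt0 z : z != 0 -> z != 1 -> 0 < barrier z.
Proof.
move=> z0 z1; have p : 0 < 1 + normc z ^+ 2 by rewrite ltr_pwDl ?sqr_ge0.
by rewrite divr_gt0 ?mulr_gt0 ?exprn_gt0// normc_gt0// subr_eq0 eq_sym.
Qed.

Lemma barrier_le1 z : barrier z <= 1.
Proof.
have n0 := normc_ge0 z; have n1 := normc_1B_le z.
have p : 0 < 1 + normc z ^+ 2 by rewrite ltr_pwDl ?sqr_ge0.
rewrite ler_pdivrMr ?exprn_gt0// mul1r.
apply: (@le_trans _ _ (normc z * (1 + normc z))); first by rewrite ler_wpM2l.
have : 0 <= normc z ^+ 2 by exact: sqr_ge0.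
have : 0 <= (1 - normc z) ^+ 2 by exact: sqr_ge0.
nra.
Qed.

Lemma barrier_le z : barrier z <= normc z * normc (1 - z).
Proof.
have p : 1 <= (1 + normc z ^+ 2) ^+ 2 by rewrite exprn_ege1// lerDl sqr_ge0.
rewrite ler_pdivrMr; last by exact: lt_le_trans p.
by rewrite ler_peMr// mulr_ge0 ?normc_ge0.
Qed.

Lemma barrier_le_infty z : barrier z <= 4 * (1 + normc z) ^- 2.
Proof.
have n0 := normc_ge0 z; have n1 := normc_1B_le z.
have p : 0 < 1 + normc z ^+ 2 by rewrite ltr_pwDl ?sqr_ge0.
have q : 0 < 1 + normc z by lra.
rewrite ler_pdivrMr ?exprn_gt0// mulrAC ler_pdivlMr ?exprn_gt0//.
apply: (@le_trans _ _ ((1 + normc z) ^+ 2 * (1 + normc z) ^+ 2)).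
  rewrite ler_wpM2r ?sqr_ge0// expr2 ler_pM ?normc_ge0//; lra.
rewrite -exprMn -[4](_ : 2 ^+ 2 = _); last by rewrite -natrX.
rewrite -exprMn lerXn2r ?nnegrE ?mulr_ge0 ?sqr_ge0 ?(ltW q) ?(ltW p)//.
have : 0 <= (1 - normc z) ^+ 2 by exact: sqr_ge0.
nra.
Qed.

Lemma barrier_cvg z : barrier w @[w --> (z : R[i]^o)] --> barrier z.
Proof.
have p : (1 + normc z ^+ 2) ^+ 2 != 0 by rewrite expf_neq0// gt_eqF// ltr_pwDl ?sqr_ge0.
have n := @normc_cvg R z.
have n2 : normc w ^+ 2 @[w --> (z : R[i]^o)] --> normc z ^+ 2 by exact: (cvgM n n).
have d1 : 1 + normc w ^+ 2 @[w --> (z : R[i]^o)] --> 1 + normc z ^+ 2.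
  exact: (cvgD (cvg_cst _) n2).
have d2 : (1 + normc w ^+ 2) ^+ 2 @[w --> (z : R[i]^o)] --> (1 + normc z ^+ 2) ^+ 2.
  exact: (cvgM d1 d1).
exact: (cvgM (cvgM n (@normc_1B_cvg R z)) (cvgV p d2)).
Qed.

Lemma ln_barrier_expand z : z != 0 -> z != 1 -> exists p,
  expand (fun w => ln (barrier w)) z p (- 2 * (1 + normc z ^+ 2)^-1 ^+ 2).
Proof.
move=> z0 z1.
have n0 : 0 < normc z by rewrite normc_gt0.
have n1 : 0 < normc (1 - z) by rewrite normc_gt0 subr_eq0 eq_sym.
have [q1 e1] : exists q, expand (fun w => ln (normc w)) z q 0.
  have [|q h] := @expand_ln_normc_affine R 0 1 z (oner_neq0 _); first by rewrite add0r mul1r.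
  by exists q; apply: expand_near h; exists 1; split=> // h _; rewrite add0r mul1r.
have [q2 e2] : exists q, expand (fun w => ln (normc (1 - w))) z q 0.
  have m1 : -1 != 0 :> R[i] by rewrite oppr_eq0 oner_neq0.
  have [|q h] := @expand_ln_normc_affine R 1 (-1) z m1.
    by rewrite mulN1r subr_eq0 eq_sym.
  by exists q; apply: expand_near h; exists 1; split=> // h _; rewrite mulN1r.
have [q3 e3] := expand_ln_1D_sqr z.
have e4 := expandD (expandD e1 e2) (expandZ (- 2) e3).
eexists; apply: (expand_eq (expand_near _ e4)); [|reflexivity|by rewrite addr0 add0r].
exists (Num.min (normc z) (normc (1 - z))); rewrite lt_min n0 n1; split=> // h.
rewrite lt_min => /andP[hz hy].
have m0 : 0 < normc (z + h).
  have := ler_normcB (z + h) z; have -> : z + h - z = h by ring.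
  by rewrite ler_norml => /andP[]; lra.
have m1 : 0 < normc (1 - (z + h)).
  have := ler_normcB (1 - (z + h)) (1 - z).
  have -> : 1 - (z + h) - (1 - z) = - h by ring.
  by rewrite normcNc ler_norml => /andP[]; lra.
have p : 0 < 1 + normc (z + h) ^+ 2 by rewrite ltr_pwDl ?sqr_ge0.
rewrite /barrier ln_div ?posrE ?mulr_gt0 ?exprn_gt0// lnM ?posrE// lnXn//.
by rewrite mulNr mulr_natl.
Qed.

End Barrier.

Lemma puncturedP (R : realType) (z : R[i]) : z != 0 -> z != 1 -> (~` [set 0; 1]) z.
Proof. by move=> /eqP z0 /eqP z1 [/= /z0|/= /z1]. Qed.

Lemma SK_metric_gt0 (R : realType) (lam : R[i] -> R) (z : R[i]) :
  SK_metric (~` [set 0; 1]) lam -> z != 0 -> z != 1 -> 0 < lam z.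
Proof. by move=> [[pos _] _] z0 z1; apply/pos/puncturedP. Qed.

(** * Smallness of the comparison function near the punctures *)

Section OuterEstimate.
Context {R : realType}.
Variables (alpha beta gamma b e0 : R) (lam D : R[i] -> R).
Implicit Types (z w h : R[i]).
Hypotheses (alpha0 : 0 < alpha) (alpha1 : alpha < 1) (beta0 : 0 < beta) (beta1 : beta < 1)
  (gamma0 : 0 < gamma) (gamma1 : gamma <= 1) (e00 : 0 < e0) (e0b : e0 <= b)
  (b2 : 2 * b = alpha + beta + gamma - 2).
Hypothesis SK : SK_metric (~` [set 0; 1]) lam.
Hypothesis D_le : forall e, 0 < e -> e < e0 -> exists2 K : R, 0 <= K & forall z, D z <=
  K * (normc z `^ alpha * normc (1 - z) `^ beta * (1 + normc z) `^ (- (2 * b - e))).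
Hypothesis lam_le : exists L r0 : R, 0 < r0 /\ forall z, z != 0 -> z != 1 ->
  [/\ normc z < r0 -> lam z * normc z `^ alpha <= L,
      normc (1 - z) < r0 -> lam z * normc (1 - z) `^ beta <= L
    & r0^-1 < normc z -> lam z * normc z `^ (2 - gamma) <= L].

Let lam_gt0 z : z != 0 -> z != 1 -> 0 < lam z.
Proof. exact: (SK_metric_gt0 SK). Qed.

Definition weight e z : R := Num.max (D z) 0 * barrier z `^ e.
Definition comp e z : R := lam z * weight e z.

(** The growth exponent is [alpha + beta - (2 b - e) = 2 - gamma + e], at most 2 once [e <= gamma].
    Boundedness of [D / (1 + |z| ^ 2)] is what makes the Laplacian of the barrier harmless at a
    maximum. *)
Lemma density_le_sqr : exists2 K : R, 0 <= K & forall z, D z <= K * (1 + normc z ^+ 2).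
Proof.
pose e := Num.min (e0 / 2) (gamma / 2).
have e1 : 0 < e by rewrite lt_min !divr_gt0.
have e2 : e < e0 by rewrite gt_min; apply/orP; left; move: e00; lra.
have e3 : e <= gamma by rewrite ge_min; apply/orP; right; move: gamma0; lra.
have [K K0 hK] := D_le e1 e2.
exists (2 * K); first by rewrite mulr_ge0.
move=> z; apply: le_trans (hK z) _; have n0 := normc_ge0 z; have n1 := normc_1B_le z.
have P1 : 1 <= 1 + normc z by rewrite lerDl.
have P0 : 0 < 1 + normc z by exact: lt_le_trans P1.
apply: (@le_trans _ _ (K * (2 * (1 + normc z ^+ 2)))); last by rewrite mulrCA mulrA.
rewrite ler_wpM2l//.
apply: (@le_trans _ _ ((1 + normc z) `^ alpha * (1 + normc z) `^ beta * (1 + normc z) `^ (- (2 * b - e)))).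
  rewrite ler_wpM2r ?powR_ge0// ler_pM ?powR_ge0//.
    by apply: (ge0_ler_powR (ltW alpha0)); rewrite ?nnegrE ?(ltW P0)// lerDr.
  by apply: (ge0_ler_powR (ltW beta0)); rewrite ?nnegrE ?normc_ge0 ?(ltW P0).
rewrite -!powRDp//; apply: (@le_trans _ _ ((1 + normc z) `^ 2)).
  by apply: ler_powR => //; move: b2 e3; lra.
rewrite -[2]/(2%:R) powR_mulrn ?(ltW P0)//.
have : 0 <= (1 - normc z) ^+ 2 by exact: sqr_ge0.
nra.
Qed.

(** Near 0 and 1 the powers in [lam] and [D] cancel. At infinity [lam] contributes
    [|z| ^ (gamma - 2)] and [D] contributes [|z| ^ (2 - gamma + e)]; the excess [e] is matched by
    [barrier ^ (e / 2)], of order [|z| ^ (- e)]. *)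
Lemma comp_outer_le e : 0 < e -> e < e0 -> exists C r0 : R, [/\ 0 <= C, 0 < r0, r0 <= 1 &
  forall z, z != 0 -> z != 1 ->
  [\/ normc z < r0, normc (1 - z) < r0 | r0^-1 < normc z] -> comp (e / 2) z <= C].
Proof.
move=> e1 e2; have [K K0 hK] := D_le e1 e2; have [L0 [r1 [r10 hL0]]] := lam_le.
pose L := `|L0|; have LL : L0 <= L by exact: ler_norm.
have L00 : 0 <= L by exact: normr_ge0.
pose c4 := 4 `^ (e / 2) : R; have c40 : 0 <= c4 by exact: powR_ge0.
have LK : 0 <= L * K by exact: mulr_ge0.
exists ((2 + 4 * c4) * (L * K)), (Num.min r1 1).
split; [by rewrite mulr_ge0// addr_ge0// mulr_ge0|by rewrite lt_min r10 ltr01|by rewrite ge_min lexx orbT|].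
move=> z z0 z1; have [h1 h2 h3] := hL0 z z0 z1; have l0 := lam_gt0 z0 z1.
have n0 := normc_ge0 z; have n1 := normc_1B_le z; have m0 := normc_ge0 (1 - z).
have P1 : 1 <= 1 + normc z by rewrite lerDl.
have P0 : 0 < 1 + normc z by exact: lt_le_trans P1.
set u := normc z `^ alpha; set v := normc (1 - z) `^ beta; set p := (1 + normc z) `^ (- (2 * b - e)).
have u0 : 0 <= u by exact: powR_ge0.
have v0 : 0 <= v by exact: powR_ge0.
have pp0 : 0 <= p by exact: powR_ge0.
have p1 : p <= 1.
  by rewrite -[leRHS](powRr0 (1 + normc z)); apply: ler_powR => //; move: e2 e0b e1; lra.
have Dp : Num.max (D z) 0 <= K * (u * v * p) by rewrite ge_max hK !mulr_ge0.
set k := barrier z `^ (e / 2); have k0 : 0 <= k by exact: powR_ge0.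
have e20 : 0 <= e / 2 by rewrite divr_ge0// ltW.
have k1 : k <= 1.
  have o1 : 1 `^ (e / 2) = 1 :> R by rewrite powR1.
  by rewrite -[leRHS]o1; apply: (ge0_ler_powR e20); rewrite ?nnegrE ?barrier_ge0 ?barrier_le1.
have two (x s : R) : 0 <= x -> x <= 2 -> 0 <= s -> s <= 1 -> x `^ s <= 2.
  move=> x0 x2 s0 s1; apply: (@le_trans _ _ (2 `^ s)); first by apply: (ge0_ler_powR s0); rewrite ?nnegrE.
  by rewrite -[leRHS]powRr1//; apply: ler_powR => //; rewrite ler1n.
have step : comp (e / 2) z <= lam z * (K * (u * v * p) * k).
  by rewrite /comp /weight ler_pM2l// ler_wpM2r.
move=> zc; apply: le_trans step _; move: zc.
have near_case (x y : R) : 0 <= x -> 0 <= y -> lam z * x <= L -> y <= 2 -> u * v = x * y ->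
    lam z * (K * (u * v * p) * k) <= (2 + 4 * c4) * (L * K).
  move=> x0 y0 lx y2 ->.
  have -> : lam z * (K * (x * y * p) * k) = (lam z * x) * K * (y * (p * k)) by ring.
  apply: (@le_trans _ _ (L * K * 2)).
    rewrite ler_pM ?mulr_ge0 ?(ltW l0)//; first by rewrite ler_wpM2r.
    by rewrite -[leRHS]mulr1 ler_pM ?mulr_ge0// -[leRHS]mulr1 ler_pM.
  by rewrite mulrC ler_wpM2r// lerDl mulr_ge0.
case=> [|| zr].
- rewrite lt_min => /andP[zr zr1]; apply: (near_case u v) => //; first exact: le_trans (h1 zr) LL.
  by apply: two; rewrite ?(ltW beta0) ?(ltW beta1)//; lra.
- rewrite lt_min => /andP[zr zr1]; apply: (near_case v u) => //; last by rewrite mulrC.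
    exact: le_trans (h2 zr) LL.
  apply: two; rewrite ?(ltW alpha0) ?(ltW alpha1)//.
  have := normcDc (- (1 - z)) 1; rewrite normcNc Normc.normc1.
  have -> : - (1 - z) + 1 = z by ring.
  by lra.
have rmin : 0 < Num.min r1 1 by rewrite lt_min r10 ltr01.
have zr1 : r1^-1 < normc z.
  by apply: le_lt_trans zr; rewrite lef_pV2 ?posrE// ge_min lexx.
have zr2 : 1 <= normc z.
  by apply: ltW; apply: le_lt_trans zr; rewrite invf_ge1// ge_min lexx orbT.
have hl := le_trans (h3 zr1) LL.
have kle : k <= c4 * (1 + normc z) `^ (- e).
  apply: (@le_trans _ _ ((4 * (1 + normc z) ^- 2) `^ (e / 2))).
    apply: (ge0_ler_powR e20); rewrite ?nnegrE ?barrier_ge0 ?barrier_le_infty//.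
    by rewrite mulr_ge0// invr_ge0 sqr_ge0.
  rewrite powRM ?invr_ge0 ?sqr_ge0// ler_wpM2l ?powR_ge0//.
  rewrite -powR_invn ?(ltW P0)// -powRrM le_eqVlt; apply/orP; left; apply/eqP; congr (_ `^ _).
  by field.
have uvp : u * v * p * (1 + normc z) `^ (- e) <= (1 + normc z) `^ (2 - gamma).
  apply: (@le_trans _ _ ((1 + normc z) `^ alpha * (1 + normc z) `^ beta * p * (1 + normc z) `^ (- e))).
    rewrite ler_wpM2r ?powR_ge0// ler_wpM2r// ler_pM//.
      by apply: (ge0_ler_powR (ltW alpha0)); rewrite ?nnegrE ?(ltW P0)// lerDr.
    by apply: (ge0_ler_powR (ltW beta0)); rewrite ?nnegrE ?(ltW P0).
  rewrite -!powRDp// le_eqVlt; apply/orP; left; apply/eqP; congr (_ `^ _).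
  by rewrite b2; ring.
have P2 : (1 + normc z) `^ (2 - gamma) <= 4 * normc z `^ (2 - gamma).
  have g0 : 0 < 2 - gamma by rewrite subr_gt0 (le_lt_trans gamma1)// ltr1n.
  apply: (@le_trans _ _ ((2 * normc z) `^ (2 - gamma))).
    by apply: (ge0_ler_powR (ltW g0)); rewrite ?nnegrE ?(ltW P0) ?mulr_ge0//; lra.
  rewrite powRM// ler_wpM2r ?powR_ge0//.
  apply: (@le_trans _ _ (2 `^ 2)).
    by apply: ler_powR; rewrite ?ler1n//; move: gamma0; lra.
  by rewrite -[X in _ `^ X]/(2%:R) powR_mulrn// -natrX.
apply: (@le_trans _ _ (lam z * (K * (u * v * p) * (c4 * (1 + normc z) `^ (- e))))).
  by rewrite ler_pM2l// ler_wpM2l// !mulr_ge0.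
have -> : lam z * (K * (u * v * p) * (c4 * (1 + normc z) `^ (- e))) =
   (K * c4) * (lam z * (u * v * p * (1 + normc z) `^ (- e))) by ring.
apply: (@le_trans _ _ ((K * c4) * (4 * L))).
  rewrite ler_wpM2l ?mulr_ge0//.
  apply: (@le_trans _ _ (lam z * (4 * normc z `^ (2 - gamma)))).
    by rewrite ler_pM2l//; exact: le_trans uvp P2.
  by rewrite mulrCA ler_pM2l.
have -> : K * c4 * (4 * L) = 4 * c4 * (L * K) by ring.
by rewrite ler_wpM2r// lerDr.
Qed.

(** The power [barrier ^ e] is split into two halves: one keeps the product bounded, the other tends
    to zero at the punctures. *)
Lemma comp_outer_small e y : 0 < e -> e < e0 -> 0 < y -> exists r : R, 0 < r /\
  forall z, z != 0 -> z != 1 ->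
  [\/ normc z < r, normc (1 - z) < r | r^-1 < normc z] -> comp e z < y.
Proof.
move=> e1 e2 y0; have [C [r0 [C0 r00 r01 hC]]] := comp_outer_le e1 e2.
have e20 : 0 < e / 2 by rewrite divr_gt0.
have C1 : 0 < C + 1 by lra.
have yC : 0 < y / (C + 1) by rewrite divr_gt0.
(* The threshold for which [barrier < t] gives [barrier ^ (e / 2) < y / (C + 1)]. *)
pose t := (y / (C + 1)) `^ (2 / e); have t0 : 0 < t by exact: powR_gt0.
have tE : t `^ (e / 2) = y / (C + 1).
  rewrite -powRrM (_ : 2 / e * (e / 2) = 1) ?powRr1 ?(ltW yC)//.
  by field; rewrite gt_eqF.
(* The 8 covers the constants of both barrier bounds: a factor 2 near 0 and 1, and 4 at infinity. *)
exists (Num.min r0 (t / 8)); rewrite lt_min r00 divr_gt0//; split=> // z z0 z1 zc.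
have rm : 0 < Num.min r0 (t / 8) by rewrite lt_min r00 divr_gt0.
have n0 := normc_ge0 z; have n1 := normc_1B_le z; have m0 := normc_ge0 (1 - z).
have cC : comp (e / 2) z <= C.
  apply: hC => //; case: zc => [zc|zc|zc].
  - by constructor 1; move: zc; rewrite lt_min => /andP[].
  - by constructor 2; move: zc; rewrite lt_min => /andP[].
  by constructor 3; apply: le_lt_trans zc; rewrite lef_pV2 ?posrE// ge_min lexx.
have bt : barrier z < t.
  case: zc => [|| zc].
  - rewrite lt_min => /andP[zr zt]; apply: le_lt_trans (barrier_le z) _.
    have : normc z * normc (1 - z) <= normc z * 2 by rewrite ler_wpM2l//; lra.
    lra.
  - rewrite lt_min => /andP[zr zt]; apply: le_lt_trans (barrier_le z) _.
    have z2 : normc z <= 2.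
      have := normcDc (- (1 - z)) 1; rewrite normcNc Normc.normc1.
      have -> : - (1 - z) + 1 = z by ring.
  by lra.
    have : normc z * normc (1 - z) <= 2 * normc (1 - z) by rewrite ler_wpM2r.
    lra.
  have zt : (t / 8)^-1 < normc z.
    by apply: le_lt_trans zc; rewrite lef_pV2 ?posrE ?divr_gt0// ge_min lexx orbT.
  have P0 : 0 < 1 + normc z by lra.
  apply: le_lt_trans (barrier_le_infty z) _; rewrite ltr_pdivrMr ?exprn_gt0//.
  have : 1 < normc z * (t / 8) by rewrite -ltr_pdivrMr ?divr_gt0// mul1r.
  nra.
have -> : comp e z = comp (e / 2) z * barrier z `^ (e / 2).
  rewrite /comp /weight -!mulrA -powRDp ?barrier_gt0//.
  by rewrite -splitr.
have kt : barrier z `^ (e / 2) < y / (C + 1).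
  by rewrite -tE; apply: (gt0_ltr_powR e20); rewrite ?nnegrE ?barrier_ge0 ?(ltW t0).
apply: (@le_lt_trans _ _ (C * barrier z `^ (e / 2))); first by rewrite ler_wpM2r ?powR_ge0.
rewrite ltr_pdivlMr// in kt; have := powR_ge0 (barrier z) (e / 2); nra.
Qed.

End OuterEstimate.

(** * The maximum principle *)

Section MaximumPrinciple.
Context {R : realType}.
Variables (e0 : R) (lam D : R[i] -> R).
Implicit Types (z w h : R[i]).
Hypothesis e00 : 0 < e0.
Hypothesis SK : SK_metric (~` [set 0; 1]) lam.
Hypothesis D_cvg : forall z, z != 0 -> z != 1 -> D w @[w --> (z : R[i]^o)] --> D z.
Hypothesis D_expand : forall z, z != 0 -> z != 1 -> 0 < D z ->
  exists p, expand (fun w => ln (D w)) z p (- (D z)^-1 ^+ 2).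
Hypothesis D_le_sqr : exists2 K : R, 0 <= K & forall z, D z <= K * (1 + normc z ^+ 2).
Hypothesis comp_small : forall e y : R, 0 < e -> e < e0 -> 0 < y -> exists r : R, 0 < r /\
  forall z, z != 0 -> z != 1 ->
  [\/ normc z < r, normc (1 - z) < r | r^-1 < normc z] -> comp lam D e z < y.

Let lam_gt0 z : z != 0 -> z != 1 -> 0 < lam z.
Proof. exact: (SK_metric_gt0 SK). Qed.

Let near_punctured z : z != 0 -> z != 1 -> exists r : R, 0 < r /\ forall h, normc h < r ->
  z + h != 0 /\ z + h != 1.
Proof.
move=> z0 z1; have n0 : 0 < normc z by rewrite normc_gt0.
have n1 : 0 < normc (1 - z) by rewrite normc_gt0 subr_eq0 eq_sym.
exists (Num.min (normc z) (normc (1 - z))); rewrite lt_min n0 n1; split=> // h.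
rewrite lt_min => /andP[h0 h1]; split.
  apply: contraTneq h0 => e; rewrite -leNgt.
  by rewrite (_ : z = - h) ?normcNc//; apply/eqP; rewrite -addr_eq0 e.
by apply: contraTneq h1 => e; rewrite -leNgt -e addrC addKr.
Qed.

(** The barrier vanishes at 0 and 1 and [0 ^ e = 0] for [e > 0], whatever values the total functions
    [lam] and [D] take there. *)
Lemma comp_puncture e z : 0 < e -> (z == 0) || (z == 1) -> comp lam D e z = 0.
Proof.
move=> ep h; have -> : comp lam D e z = lam z * (Num.max (D z) 0 * barrier z `^ e) by [].
rewrite (_ : barrier z = 0) ?powR0 ?gt_eqF// ?mulr0 ?mulr0//.
rewrite /barrier; case/orP: h => /eqP ->; first by rewrite Normc.normc0 !mul0r.
by rewrite subrr Normc.normc0 mulr0 mul0r.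
Qed.

Lemma weight_cvg e z : z != 0 -> z != 1 ->
  weight D e w @[w --> (z : R[i]^o)] --> weight D e z.
Proof.
move=> z0 z1.
have h1 : Num.max (D w) 0 @[w --> (z : R[i]^o)] --> Num.max (D z) 0.
  have /cvg_normc dz := @D_cvg _ z0 z1; apply/cvg_normc => y y0; have [r [r0 hr]] := dz y y0.
  exists r; split=> // h /hr; apply: le_lt_trans; move: (D (z + h)) (D z) => u v.
  have := ler_norm (u - v); have := ler_norm (v - u); rewrite distrC => k1 k2.
  rewrite ler_norml /Num.max; have := normr_ge0 (u - v) => k3.
  by case: ltP => k4; case: ltP => k5; apply/andP; split; lra.
have b0 := barrier_gt0 z0 z1.
have h2 : barrier w `^ e @[w --> (z : R[i]^o)] --> barrier z `^ e.
  exact: (@cvg_comp _ _ _ (fun w : R[i]^o => barrier w) (@powR R ^~ e) _ _ _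
    (@barrier_cvg R z) (continuous_powR_pos b0)).
exact: (cvgM h1 h2).
Qed.

Lemma comp_usc e z : 0 < e -> e < e0 -> usc_at (comp lam D e) z.
Proof.
move=> ep ee y; have [pz|npz] := boolP ((z == 0) || (z == 1)).
  rewrite comp_puncture// => y0; have [r [r0 hr]] := comp_small ep ee y0.
  exists r; split=> // h hh.
  have [pw|] := boolP ((z + h == 0) || (z + h == 1)); first by rewrite comp_puncture.
  rewrite negb_or => /andP[w0 w1]; apply: hr => //.
  case/orP: pz => /eqP ->; first by constructor 1; rewrite add0r.
  constructor 2; by rewrite opprD addNKr normcNc.
move: npz; rewrite negb_or => /andP[z0 z1] zy.
have l0 := lam_gt0 z0 z1.
have m0 : 0 <= weight D e z by rewrite mulr_ge0 ?powR_ge0// le_max lexx orbT.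
have s0 : 0 < lam z + weight D e z + 1 by lra.
(* With [d <= 1], the product [(lam + d) (weight + d)] exceeds [lam weight] by at most
   [d (lam + weight + 1)], which this choice keeps below the available gap. *)
pose d := Num.min 1 ((y - comp lam D e z) / (lam z + weight D e z + 1) / 2).
have yc : 0 < y - comp lam D e z by lra.
have d0 : 0 < d by rewrite lt_min ltr01 !divr_gt0.
have d1 : d <= 1 by rewrite ge_min lexx.
have d2 : d * (lam z + weight D e z + 1) < y - comp lam D e z.
  apply: (@le_lt_trans _ _ ((y - comp lam D e z) / 2)); last by lra.
  by rewrite -ler_pdivlMr// mulrAC ge_min lexx orbT.
have /cvg_normc/(_ d d0) [r1 [r10 hr1]] := @weight_cvg e z z0 z1.
have [r2 [r20 hr2]] := near_punctured z0 z1.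
case: SK => -[pos usc] _.
have ld : lam z < lam z + d by rewrite ltrDl.
have /nbhs_normc [r3 [r30 hr3]] := usc z (lam z + d) (puncturedP z0 z1) ld.
exists (Num.min r1 (Num.min r2 r3)); rewrite !lt_min r10 r20 r30; split=> // h.
rewrite !lt_min => /and3P[/hr1 k1 /hr2 [w0 w1] /hr3 /(_ (puncturedP w0 w1)) k3].
have lw := lam_gt0 w0 w1.
have mw : 0 <= weight D e (z + h) by rewrite mulr_ge0 ?powR_ge0// le_max lexx orbT.
have k2 : weight D e (z + h) < weight D e z + d by move: k1; rewrite ltr_norml => /andP[_]; lra.
rewrite /comp in d2 yc *; apply: (@le_lt_trans _ _ ((lam z + d) * (weight D e z + d))).
  by rewrite ler_pM// ltW.
have -> : (lam z + d) * (weight D e z + d) = lam z * weight D e z + d * (lam z + weight D e z + d) by ring.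
have : d * (lam z + weight D e z + d) <= d * (lam z + weight D e z + 1) by rewrite ler_pM2l// lerD2l.
by lra.
Qed.

(** At a maximum, [ln lam] is touched from above by a constant minus [ln D] minus [e ln barrier],
    whose Laplacian is four times the stated bound. Positivity of [comp] puts the point where
    [D > 0], the only place where [ln D] has an expansion. *)
Lemma max_curvature e z : 0 < e -> e < e0 -> z != 0 -> z != 1 -> 0 < comp lam D e z ->
  (forall w, comp lam D e w <= comp lam D e z) ->
  0 < D z /\ lam z ^+ 2 <= (D z)^-1 ^+ 2 + 2 * e * (1 + normc z ^+ 2)^-1 ^+ 2.
Proof.
move=> ep ee z0 z1 c0 cmax.
have l0 := lam_gt0 z0 z1; have b0 := barrier_gt0 z0 z1.
have D0 : 0 < D z.
  move: c0; rewrite /comp /weight pmulr_rgt0// pmulr_lgt0 ?powR_gt0//.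
  by rewrite lt_max ltxx orbF.
split=> //.
have [p1 x1] := D_expand z0 z1 D0.
have [p2 x2] := ln_barrier_expand z0 z1.
have x3 := expandD (expand_cst (ln (comp lam D e z)) z)
  (expandD (expandZ (-1) x1) (expandZ (- e) x2)).
have compE w : 0 < D w -> 0 < lam w -> 0 < barrier w ->
    ln (comp lam D e w) = ln (lam w) + (ln (D w) + e * ln (barrier w)).
  move=> Dw lw bw; rewrite /comp /weight max_l ?(ltW Dw)//.
  have pw : 0 < barrier w `^ e by exact: powR_gt0.
  have m1 : 0 < D w * barrier w `^ e by exact: mulr_gt0.
  by rewrite lnM ?posrE// lnM ?posrE// ln_powR.
have curv : (gauss_curvature lam z <= (- 4)%:E)%E by case: SK => _; apply; exact: puncturedP.
have := curvature_at_contact l0 _ _ x3 curv.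
have -> : 0 + (-1 * - (D z)^-1 ^+ 2 + - e * (-2 * (1 + normc z ^+ 2)^-1 ^+ 2)) =
   (D z)^-1 ^+ 2 + 2 * e * (1 + normc z ^+ 2)^-1 ^+ 2 by ring.
apply; first by rewrite compE//; ring.
have /cvg_normc/(_ _ D0) [r1 [r10 hr1]] := @D_cvg _ z0 z1.
have [r2 [r20 hr2]] := near_punctured z0 z1.
exists (Num.min r1 r2); rewrite lt_min r10 r20; split=> // h.
rewrite lt_min => /andP[/hr1 k1 /hr2 [w0 w1]].
have Dw : 0 < D (z + h) by move: k1; rewrite ltr_norml => /andP[]; lra.
have lw := lam_gt0 w0 w1; have bw := barrier_gt0 w0 w1.
have cw : 0 < comp lam D e (z + h).
  by rewrite /comp /weight max_l ?(ltW Dw)// !mulr_gt0 ?powR_gt0.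
have : ln (comp lam D e (z + h)) <= ln (comp lam D e z) by rewrite ler_ln ?posrE.
rewrite (compE (z + h))//; lra.
Qed.

(** Multiplying the bound of [max_curvature] by [D ^ 2] gives [(lam D) ^ 2 <= 1 + 2 e (D / (1 + |z|
    ^ 2)) ^ 2] at the maximum. The quadratic bound on [D] makes the error linear in [e], with a
    constant free of [e]. *)
Lemma comp_le : exists2 K : R, 0 <= K & forall e z, 0 < e -> e < e0 ->
  z != 0 -> z != 1 -> comp lam D e z ^+ 2 <= 1 + e * K.
Proof.
have [K K0 hK] := D_le_sqr; exists (2 * K ^+ 2); first by rewrite mulr_ge0 ?sqr_ge0.
move=> e z ep ee z0 z1; have [c0|c0] := ltP 0 (comp lam D e z); last first.
  have : comp lam D e z = 0.
    apply/le_anti; rewrite c0/= mulr_ge0 ?mulr_ge0 ?powR_ge0//; first exact: ltW (lam_gt0 z0 z1).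
    by rewrite le_max lexx orbT.
  by move=> ->; rewrite expr0n /= addr_ge0// mulr_ge0 ?(ltW ep)// mulr_ge0 ?sqr_ge0.
have [r [r0 hr]] := comp_small ep ee c0.
have n0 := normc_ge0 z; have ri : 0 < r^-1 by rewrite invr_gt0.
have M0 : 0 < r^-1 + normc z by lra.
have usc w : usc_at (comp lam D e) w by exact: comp_usc.
(* The disc of radius [1 / r + |z|] contains [z], and outside it [comp] stays below its value at
   [z]. Hence [zm] is a global maximum, and it is not a puncture because the value there is
   positive. *)
have [zm zmax] := usc_max_on_square M0 usc.
have zc : comp lam D e z <= comp lam D e zm by apply: zmax; rewrite lerDr ltW.
have cm : 0 < comp lam D e zm by exact: lt_le_trans zc.
have : ~~ ((zm == 0) || (zm == 1)) by apply: contraTN cm => /(comp_puncture ep) ->; rewrite ltxx.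
rewrite negb_or => /andP[m0 m1].
have gmax w : comp lam D e w <= comp lam D e zm.
  have [wM|wM] := leP (normc w) (r^-1 + normc z); first exact: zmax.
  have [pw|] := boolP ((w == 0) || (w == 1)); first by rewrite (comp_puncture ep pw) ltW.
  rewrite negb_or => /andP[w0 w1]; apply: le_trans zc; apply/ltW/hr => //.
  by constructor 3; lra.
have [Dm lm] := max_curvature ep ee m0 m1 cm gmax.
have lp := lam_gt0 m0 m1.
have bw : barrier zm `^ e <= 1.
  have o1 : 1 `^ e = 1 :> R by rewrite powR1.
  by rewrite -[leRHS]o1; apply: (ge0_ler_powR (ltW ep)); rewrite ?nnegrE ?barrier_ge0 ?barrier_le1.
have cl : comp lam D e zm <= lam zm * D zm.
  by rewrite /comp /weight max_l ?(ltW Dm)// ler_pM2l// ler_piMr// ltW.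
apply: (@le_trans _ _ (comp lam D e zm ^+ 2)).
  by rewrite lerXn2r// nnegrE ltW.
apply: (@le_trans _ _ ((lam zm * D zm) ^+ 2)).
  by rewrite lerXn2r// nnegrE ltW// mulr_gt0.
have q0 : 0 < 1 + normc zm ^+ 2 by rewrite ltr_pwDl ?sqr_ge0.
have DK := hK zm.
have t1 : D zm / (1 + normc zm ^+ 2) <= K by rewrite ler_pdivrMr.
have t0 : 0 <= D zm / (1 + normc zm ^+ 2) by rewrite divr_ge0 ?ltW.
have t2 : (D zm / (1 + normc zm ^+ 2)) ^+ 2 <= K ^+ 2 by rewrite lerXn2r// nnegrE.
rewrite exprMn; apply: (@le_trans _ _ (((D zm)^-1 ^+ 2 + 2 * e * (1 + normc zm ^+ 2)^-1 ^+ 2) * D zm ^+ 2)).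
  by rewrite ler_wpM2r ?sqr_ge0.
have -> : ((D zm)^-1 ^+ 2 + 2 * e * (1 + normc zm ^+ 2)^-1 ^+ 2) * D zm ^+ 2 =
   1 + 2 * e * (D zm / (1 + normc zm ^+ 2)) ^+ 2.
  by field; rewrite !gt_eqF.
have -> : e * (2 * K ^+ 2) = 2 * e * K ^+ 2 by ring.
by rewrite lerD2l ler_wpM2l// mulr_ge0// ltW.
Qed.

Lemma comparison_principle z : z != 0 -> z != 1 -> lam z * D z <= 1.
Proof.
move=> z0 z1; have [K K0 hK] := comp_le.
have l0 := lam_gt0 z0 z1; have b0 := barrier_gt0 z0 z1.
have [D0|D0] := leP (D z) 0.
  by rewrite (@le_trans _ _ 0)// mulr_ge0_le0// ltW.
set t := lam z * D z; have t0 : 0 < t by exact: mulr_gt0.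
rewrite leNgt; apply/negP => t1.
have b1 := barrier_le1 z.
pose l := - ln (barrier z); have l00 : 0 <= l by rewrite oppr_ge0 ln_le0.
have tt : 1 < t ^+ 2 by rewrite exprn_egt1.
have den : 0 < K + 2 * t ^+ 2 * l + 1.
  by rewrite ltr_wpDl ?addr_ge0 ?mulr_ge0// ltW// exprn_gt0.
(* The limit [e -> 0] made explicit. Since [barrier ^ e >= 1 - e l], the bound on [comp] gives
   [t ^ 2 (1 - 2 e l) <= 1 + e K]. The third entry contradicts this when [t > 1]; the second gives
   [e l <= 1 / 2], so that [1 - e l] may be squared. *)
pose e := Num.min (e0 / 2) (Num.min (2 * (l + 1))^-1 ((t ^+ 2 - 1) / (K + 2 * t ^+ 2 * l + 1) / 2)).
have l1 : 0 < 2 * (l + 1) by rewrite mulr_gt0// ltr_wpDl.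
have st : 0 < t ^+ 2 - 1 by rewrite subr_gt0.
have e1 : 0 < e by rewrite !lt_min !divr_gt0//= invr_gt0 l1.
have e2 : e < e0 by rewrite gt_min ltr_pdivrMr// ltr_pMr// ltr1n.
have e3 : e * (K + 2 * t ^+ 2 * l + 1) <= (t ^+ 2 - 1) / 2.
  rewrite -ler_pdivlMr// mulrAC.
  by rewrite /e !ge_min lexx !orbT.
have e4 : e * (2 * (l + 1)) <= 1.
  by rewrite -ler_pdivlMr// mul1r /e !ge_min lexx !orbT.
have el : e * l <= 1 / 2 by move: e4; rewrite mulrCA mulrDr mulr1; lra.
have el0 : 0 <= e * l by rewrite mulr_ge0// ltW.
have be : 1 - e * l <= barrier z `^ e.
  rewrite /powR gt_eqF// (_ : e * ln (barrier z) = - (e * l)); last by rewrite /l mulrN opprK.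
  exact: expR_ge1Dx.
have := hK e z e1 e2 z0 z1.
rewrite /comp /weight max_l ?(ltW D0)// mulrA -/t exprMn => h.
have s1 : (1 - e * l) ^+ 2 <= (barrier z `^ e) ^+ 2.
  by rewrite lerXn2r ?nnegrE ?powR_ge0//; lra.
have s2 : t ^+ 2 * (1 - 2 * (e * l)) <= t ^+ 2 * (barrier z `^ e) ^+ 2.
  rewrite ler_wpM2l ?sqr_ge0//; apply: le_trans s1.
  by rewrite -subr_ge0 (_ : _ - _ = (e * l) ^+ 2) ?sqr_ge0//; ring.
have e5 : e * (K + 2 * t ^+ 2 * l + 1) = e * K + 2 * (t ^+ 2 * (e * l)) + e by ring.
have e6 : t ^+ 2 * (1 - 2 * (e * l)) = t ^+ 2 - 2 * (t ^+ 2 * (e * l)) by ring.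
rewrite e6 in s2; rewrite e5 in e3; lra.
Qed.

End MaximumPrinciple.

(** * Upper bounds for the density at a singularity *)

Section Singularities.
Context {R : realType}.
Implicit Types (alpha : R) (z : R[i]) (lam : R[i] -> R).

Lemma near_0'_normc (P : set R[i]) : (\forall z \near (0 : R[i]^o)^', P z) ->
  exists r : R, 0 < r /\ forall z, z != 0 -> normc z < r -> P z.
Proof.
move=> H; have /nbhs_normc [r [r0 hr]] : nbhs (0 : R[i]^o) [set z | z != 0 -> P z] by exact: H.
by exists r; split=> // z z0 /hr; rewrite add0r /=; apply.
Qed.

Lemma near_0'_normc_lt (r : R) : 0 < r -> \forall z \near (0 : R[i]^o)^', z != 0 /\ normc z < r.
Proof.
move=> r0; rewrite /dnbhs near_withinE; apply/nbhs_normc; exists r; split=> // h hr z0.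
by rewrite add0r in z0 *.
Qed.

(** Both types of singularity yield the same upper bound: in the logarithmic case the extra term
    [- ln (ln (1 / |z|))] is nonpositive as soon as [|z| < exp (- 1)]. *)
Lemma has_singularity_le lam p alpha : has_singularity lam p alpha ->
  exists C r : R, 0 < r /\ forall z, z != 0 -> normc z < r ->
    ln (local_density lam p z) <= - alpha * ln (normc z) + C.
Proof.
move=> [a1 slt seq]; have [alt|age] := ltP alpha 1.
  have /eqaddOP/bigO_exP [k k0 /near_0'_normc [r [r0 hr]]] := slt alt.
  exists k, r; split=> // z z0 /(hr _ z0) /=.
  rewrite normr1 mulr1 => /ler_normlP[_].
  rewrite -[(_ - _) z]/(ln (local_density lam p z) - - alpha * ln (normc z)); lra.
have ae : alpha = 1 by apply/le_anti/andP.
have /eqaddOP/bigO_exP [k k0 /near_0'_normc [r [r0 hr]]] := seq ae.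
exists k, (Num.min r (expR (- 1))); split=> [|z z0]; first by rewrite lt_min r0 expR_gt0.
rewrite lt_min => /andP[/(hr _ z0) + zr] /=.
have n0 : 0 < normc z by rewrite normc_gt0.
rewrite normr1 mulr1 => /ler_normlP[_].
rewrite -[(_ - _) z]/(ln (local_density lam p z) -
  (- ln (normc z) - ln (ln (1 / normc z)))).
have : 0 <= ln (ln (1 / normc z)).
  rewrite ln_ge0// div1r lnV// lerNr.
  by rewrite -[leRHS]expRK ler_ln ?posrE ?expR_gt0// ltW.
rewrite ae; lra.
Qed.

Lemma ln_le_powR (x n alpha C : R) : 0 < x -> 0 < n ->
  ln x <= - alpha * ln n + C -> x * n `^ alpha <= expR C.
Proof.
move=> x0 n0 h; rewrite -[leLHS]lnK ?posrE ?mulr_gt0 ?powR_gt0// ler_expR.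
by rewrite lnM ?posrE ?powR_gt0// ln_powR; lra.
Qed.

Lemma singularity_density_le lam p alpha : has_singularity lam p alpha ->
  (exists s : R, 0 < s /\ forall z, z != 0 -> normc z < s -> 0 < local_density lam p z) ->
  exists C r : R, 0 < r /\ forall z, z != 0 -> normc z < r ->
    local_density lam p z * normc z `^ alpha <= C.
Proof.
move=> /has_singularity_le [C [r [r0 hr]]] [s [s0 hs]].
exists (expR C), (Num.min r s); split=> [|z z0]; first by rewrite lt_min r0.
rewrite lt_min => /andP[/(hr _ z0) zr /(hs _ z0) zs].
by apply: ln_le_powR zr; rewrite ?normc_gt0.
Qed.

Lemma limf_esup_0'_le (f : R[i] -> R) (l : R) :
  (forall e : R, 0 < e -> exists r : R, 0 < r /\
    forall z, z != 0 -> normc z < r -> f z <= l + e) ->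
  (limf_esup (fun z : R[i]^o => (f z)%:E) (0%R : R[i]^o)^' <= l%:E)%E.
Proof.
move=> H; apply/lee_addgt0Pr => e e0; have [r [r0 hr]] := H e e0.
apply: (@le_trans _ _ (ereal_sup ((fun z : R[i]^o => (f z)%:E) @` [set z | z != 0 /\ normc z < r]))).
  apply: ereal_inf_lbound; exists [set z | z != 0 /\ normc z < r] => //.
  exact: near_0'_normc_lt.
by apply: ge_ereal_sup => _ [z [z0 zr] <-]; rewrite -EFinD lee_fin hr.
Qed.

End Singularities.

(** * The three punctures together *)

Section ThreeSingularities.
Context {R : realType}.
Variables (alpha beta gamma : R) (lam : R[i] -> R).
Implicit Type z : R[i].
Hypothesis SK : SK_metric (~` [set 0; 1]) lam.
Hypotheses (sing0 : has_singularity lam (Some 0) alpha)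
  (sing1 : has_singularity lam (Some 1) beta) (singoo : has_singularity lam None gamma).

(** At infinity the local density at [1 / z] is [lam z |z| ^ 2], so order [gamma] in the local
    coordinate becomes the exponent [2 - gamma] in [|z|]. *)
Lemma three_singularities_le : exists L r0 : R, 0 < r0 /\ forall z, z != 0 -> z != 1 ->
  [/\ normc z < r0 -> lam z * normc z `^ alpha <= L,
      normc (1 - z) < r0 -> lam z * normc (1 - z) `^ beta <= L
    & r0^-1 < normc z -> lam z * normc z `^ (2 - gamma) <= L].
Proof.
have neq1 z : normc z < 1 -> z != 1.
  by apply: contraTneq => ->; rewrite Normc.normc1 ltxx.
have [|C0 [r0 [r00 h0]]] := singularity_density_le sing0.
  exists 1; split=> // z z0 z1; rewrite /= add0r; exact: (SK_metric_gt0 SK z0 (neq1 _ z1)).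
have [|C1 [r1 [r10 h1]]] := singularity_density_le sing1.
  exists 1; split=> // z z0 z1; apply: (SK_metric_gt0 SK).
    rewrite addrC addr_eq0; apply: contraTneq z1 => ->.
    by rewrite normcNc Normc.normc1 ltxx.
  by rewrite -subr_eq0 addrAC subrr add0r.
have [|C2 [r2 [r20 h2]]] := singularity_density_le singoo.
  exists 1; split=> // z z0 z1; have n0 : 0 < normc z by rewrite normc_gt0.
  apply: mulr_gt0; last by rewrite invr_gt0 exprn_gt0.
  apply: (SK_metric_gt0 SK); first by rewrite invr_eq0.
  by rewrite invr_eq1 neq1.
exists (Num.max C0 (Num.max C1 C2)), (Num.min r0 (Num.min r1 r2)).
split=> [|z z0 z1]; first by rewrite !lt_min r00 r10.
have n0 : 0 < normc z by rewrite normc_gt0.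
split.
- rewrite !lt_min => /andP[/(h0 _ z0) /= +] _; rewrite add0r => h.
  by apply: le_trans h _; rewrite le_max lexx.
- rewrite !lt_min normcBC => /and3P[_ zr _].
  have y0 : z - 1 != 0 by rewrite subr_eq0.
  have := h1 _ y0 zr; rewrite /= subrKC => h.
  by apply: le_trans h _; rewrite !le_max lexx orbT.
- move=> zr; have zi : normc z^-1 < r2.
    rewrite Normc.normcV invf_plt ?posrE//; apply: le_lt_trans zr.
    by rewrite lef_pV2 ?posrE ?lt_min ?r00 ?r10// !ge_min lexx !orbT.
  have w0 : z^-1 != 0 by rewrite invr_eq0.
  have := h2 _ w0 zi; rewrite /= invrK Normc.normcV.
  have -> : (normc z)^-1 `^ gamma = normc z `^ (- gamma).
    by rewrite -powR_inv1 ?ltW// -powRrM mulN1r.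
  have -> : normc z `^ (2 - gamma) = normc z ^+ 2 * normc z `^ (- gamma).
    by rewrite -(powR_mulrn 2 (ltW n0)) -powRD// (gt_eqF n0) implybT.
  rewrite exprVn invrK -mulrA => h.
  by apply: le_trans h _; rewrite !le_max lexx !orbT.
Qed.

End ThreeSingularities.

(** * Value of the comparison form at the puncture 0 *)

Section DensityAt0.
Context {R : realType}.
Variables (a b alpha beta A B : R).
Implicit Type w : R[i].
Hypothesis adm : admissible a b alpha beta.

Lemma normc_1B_powR_cvg1 (s : R) : 0 < s ->
  normc (1 - w) `^ s @[w --> (1 : R[i]^o)] --> (0 : R).
Proof.
move=> s0; apply/cvg_normc => e e0; exists (e `^ s^-1); split; first exact: powR_gt0.
move=> h hr; rewrite subr0 ger0_norm ?powR_ge0//.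
have -> : 1 - (1 + h) = - h by ring.
rewrite normcNc; have := gt0_ltr_powR s0 (normc_ge0 h) (powR_ge0 e s^-1) hr.
by rewrite -powRrM mulVf ?gt_eqF// powRr1// ltW.
Qed.

(** The second solution carries the factor [|1 - w| ^ (1 - alpha)], which vanishes in the limit
    because [alpha < 1]; only the regular solution contributes. *)
Lemma hform_cvg1 : hform a b alpha A B w @[w --> (1 : R[i]^o)] -->
  A * Betaf b (alpha - b) ^+ 2.
Proof.
have [b0 ba ab [h1 h2 h3 h4]] := adm; have adm' := admissible_sym adm.
have o1 : 0 < Re (1 : R[i]) by rewrite /= ltr01.
have k1 := cdiff_normc_cvg (cdiff_hyp1 adm' o1).
have k2 := cdiff_normc_cvg (cdiff_hyp2 adm' o1).
have s0 : 0 < 1 - alpha by rewrite subr_gt0.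
have k3 := normc_1B_powR_cvg1 s0.
have k4 : A * normc (hyp1 a b alpha w) ^+ 2 - B * (normc (1 - w) `^ (1 - alpha) *
    normc (1 - w) `^ (1 - alpha) * normc (hyp2 a b alpha w) ^+ 2) @[w --> (1 : R[i]^o)] -->
    A * normc (hyp1 a b alpha 1) ^+ 2 - B * (0 * 0 * normc (hyp2 a b alpha 1) ^+ 2).
  exact: (cvgB (cvgM (cvg_cst A) k1) (cvgM (cvg_cst B) (cvgM (cvgM k3 k3) k2))).
have E : A * Betaf b (alpha - b) ^+ 2 = A * normc (hyp1 a b alpha 1) ^+ 2 -
   B * (0 * 0 * normc (hyp2 a b alpha 1) ^+ 2).
  by rewrite !mul0r mulr0 subr0 /hyp1 hyp_at1 normc_real real_normK ?num_real.
rewrite E; have -> // : hform a b alpha A B = fun w => A * normc (hyp1 a b alpha w) ^+ 2 -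
    B * (normc (1 - w) `^ (1 - alpha) * normc (1 - w) `^ (1 - alpha) *
    normc (hyp2 a b alpha w) ^+ 2).
by apply/funext => w; rewrite /hform exprMn [_ `^ _ ^+ 2]expr2.
Qed.

Lemma density_cvg0 A1 B1 :
  exists q : R[i] -> R, q w @[w --> (0 : R[i]^o)] --> A * Betaf b (alpha - b) ^+ 2 /\
    forall w, Re w < 1 -> density a b alpha beta A B A1 B1 w = normc w `^ alpha * q w.
Proof.
exists (fun w => normc (1 - w) `^ beta * hform a b alpha A B (1 - w)); split.
  have k : normc w `^ beta @[w --> (1 : R[i]^o)] --> normc (1 : R[i]) `^ beta.
    have n1 : 0 < normc (1 : R[i]) by rewrite Normc.normc1.
    exact: (@cvg_comp _ _ _ (fun w : R[i]^o => normc w) (@powR R ^~ beta) _ _ _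
      (@normc_cvg _ 1) (continuous_powR_pos n1)).
  have k' : normc w `^ beta * hform a b alpha A B w @[w --> (1 : R[i]^o)] -->
      A * Betaf b (alpha - b) ^+ 2.
    rewrite -[X in _ --> X]mul1r; have o : normc (1 : R[i]) `^ beta = 1 by rewrite Normc.normc1 powR1.
    rewrite o in k; exact: (cvgM k hform_cvg1).
  apply: (@cvg_reflect _ (fun w => normc w `^ beta * hform a b alpha A B w)).
  by rewrite subr0.
by move=> w w1; rewrite density_left// /chart_density subKr mulrCA mulrA.
Qed.

End DensityAt0.

(** * From the comparison to the upper limit at 0 *)

Lemma singularity_limit_le (R : realType) (alpha l : R) (lam D q : R[i] -> R) : 0 < l ->
  (forall z, z != 0 -> z != 1 -> lam z * D z <= 1) ->
  q w @[w --> (0 : R[i]^o)] --> l ->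
  (forall w, Re w < 1 -> D w = normc w `^ alpha * q w) ->
  (limf_esup (fun z : R[i]^o => (normc z `^ alpha * lam z)%:E) (0%R : R[i]^o)^' <= l^-1%:E)%E.
Proof.
move=> l0 lamD ql DE; apply: limf_esup_0'_le => e e0.
have /cvg_normc/(_ _ l0) [r1 [r10 hr1]] := ql.
have vq : (q w)^-1 @[w --> (0 : R[i]^o)] --> l^-1 by exact: (cvgV (lt0r_neq0 l0) ql).
have /cvg_normc/(_ _ e0) [r2 [r20 hr2]] := vq.
exists (Num.min 1 (Num.min r1 r2)); rewrite !lt_min r10 r20 ltr01; split=> // z z0.
rewrite !lt_min => /and3P[z1 /hr1 + /hr2]; rewrite add0r.
rewrite !ltr_norml => /andP[+ _] /andP[_]; rewrite ltrBDr ltrBlDr => q0 qe.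
have zn1 : z != 1 by apply: contraTneq z1 => ->; rewrite Normc.normc1 ltxx.
have qp : 0 < q z by move: q0; lra.
have Rz : Re z < 1 by apply: le_lt_trans z1; apply: le_trans (normr_Re_le z); exact: ler_norm.
have := lamD z z0 zn1; rewrite DE// mulrA [lam z * _]mulrC -ler_pdivlMr// div1r => h.
by apply: (le_trans h); rewrite addrC ltW.
Qed.

Theorem theorem4p4 (R : realType) (alpha beta gamma : R) (lam : R[i] -> R)
    (Halpha : 0 < alpha < 1) (Hbeta : 0 < beta < 1) (Hgamma : 0 < gamma <= 1)
    (Hsum : 2 < alpha + beta + gamma)
    (Hlam : SK_metric (~` [set 0; 1]) lam)
    (Hsing0 : has_singularity lam (Some 0) alpha)
    (Hsing1 : has_singularity lam (Some 1) beta)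
    (Hsingoo : has_singularity lam None gamma) :
  let a := (alpha + beta - gamma) / 2 in
  let b := (alpha + beta + gamma - 2) / 2 in
  let c := alpha in
  let d := delta a b c in
  let l := limf_esup (fun z : R[i]^o => (Normc.normc z `^ alpha * lam z)%:E)
             (0 : R[i]^o)^' in
  (l <= (d / (1 - d ^+ 2) * (1 - alpha))%:E)%E.
Proof.
cbv zeta; set a := (_ - gamma) / 2; set b := (_ - 2) / 2.
have [alpha0 alpha1] := andP Halpha; have [beta0 beta1] := andP Hbeta.
have [gamma0 gamma1] := andP Hgamma.
have b0 : 0 < b by rewrite /b; lra.
have ba : b <= a by rewrite /a /b; lra.
have ac : a < alpha by rewrite /a; lra.
have abe : a < beta by rewrite /a; lra.
have b2 : 2 * b = alpha + beta + gamma - 2 by rewrite /b; lra.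
have adm : admissible a b alpha beta by split => //; rewrite /a /b; lra.
have a0 : 0 < a by lra.
have a1 : a < 1 by lra.
have b1 : b < 1 by lra.
have bc : b < alpha by lra.
have e1 : 0 < alpha - a by rewrite subr_gt0.
have e2 : 0 < beta - a by rewrite subr_gt0.
(* The admissible loss in the growth exponent of [D]: below [b], so that the decay exponent stays
   positive, and below [alpha - a] and [beta - a], so that the Euler integrals of both charts still
   converge at infinity. *)
pose e0 := Num.min b (Num.min (alpha - a) (beta - a)).
have e00 : 0 < e0 by rewrite !lt_min b0 e1.
have e0b : e0 <= b by rewrite ge_min lexx.
have [A [B [A1 [B1 [[A0 B0] [A10 B10] limE [AB AB1] glue]]]]] := connection_formula adm.
pose D := density a b alpha beta A B A1 B1.
have D_cvg z : z != 0 -> z != 1 -> D w @[w --> (z : R[i]^o)] --> D z.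
  exact: (density_cvg adm glue).
have D_expand z : z != 0 -> z != 1 -> 0 < D z ->
    exists p, expand (fun w => ln (D w)) z p (- (D z)^-1 ^+ 2).
  exact: (density_expand adm glue AB AB1).
have D_le e : 0 < e -> e < e0 -> exists2 K : R, 0 <= K & forall z, D z <=
    K * (normc z `^ alpha * normc (1 - z) `^ beta * (1 + normc z) `^ (- (2 * b - e))).
  move=> ep; rewrite !lt_min => /and3P[eb ea ebe].
  exact: (density_le adm A0 B0 A10 B10 glue ep eb ea ebe).
have lam_le := three_singularities_le Hlam Hsing0 Hsing1 Hsingoo.
have D_sqr := density_le_sqr alpha0 beta0 gamma0 e00 b2 D_le.
have small := @comp_outer_small _ _ _ _ _ _ _ _ alpha0 alpha1 beta0 beta1 gamma0 gamma1 e0b b2 Hlam D_le lam_le.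
have lamD := @comparison_principle _ e0 lam D e00 Hlam D_cvg D_expand D_sqr small.
have [q [q0 qD]] := @density_cvg0 _ _ _ _ _ A B adm A1 B1.
have d0 := delta_gt0 a0 a1 b0 b1 alpha0 alpha1 ac bc.
have d1 := delta_lt1 a0 a1 b0 b1 alpha0 alpha1 ac bc.
have s0 : 0 < 1 - alpha by rewrite subr_gt0.
move: (delta a b alpha) d0 d1 limE => d d0 d1 limE.
have ds : 0 < d * (1 - alpha) by exact: mulr_gt0.
have lE : A * Betaf b (alpha - b) ^+ 2 = (d * (1 - alpha))^-1.
  by apply: (mulIf (lt0r_neq0 ds)); rewrite limE mulVf ?gt_eqF.
rewrite lE in q0.
have li : 0 < (d * (1 - alpha))^-1 by rewrite invr_gt0.
apply: le_trans (singularity_limit_le li lamD q0 qD) _; rewrite invrK lee_fin.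
have d2 : 0 < 1 - d ^+ 2 by rewrite subr_gt0 exprn_ilt1// ltW.
by rewrite ler_wpM2r ?(ltW s0)// ler_pdivlMr// ler_piMr ?(ltW d0)// gerBl sqr_ge0.
Qed.
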